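(* Let $m,n\in\mathbb{N}\setminus\{0\}$ and $p\in(\mathbb{N}\setminus\{0\})\cup\{\infty\}$ with $p\ge\max\{m,2\}$. For $i\in\{1,\ldots,n\}$ let $f_i\colon\mathbb{R}^m\to\mathbb{R}$ be continuous and piecewise-$C^p$ with representation $(\{P_i^j\}_{j=1}^{J_i},\{f_i^j\}_{j=1}^{J_i})$ and piecewise gradient $\widetilde\nabla f_i$ with respect to this representation. Let $f=\frac1n\sum_{i=1}^n f_i$ and assume that $f$ is bounded below. Let $(i_k)_{k\in\mathbb{N}}$ be the i.i.d. random indices, uniformly distributed on $\{1,\ldots,n\}$, on the probability space $(\Omega,\mathcal F,\mathbb P)$ described in the context. Let $(\alpha_k)_{k\in\mathbb{N}}$ be positive real numbers with $\sum_{k=0}^\infty\alpha_k=\infty$ and $\alpha_k=o(1/\log k)$ as $k\to\infty$. Suppose that, for all $i\in\{1,\ldots,n\}$, the interface $$\mathcal I_i\coloneqq\bigcup_{\substack{j,\ell\in\{1,\ldots,J_i\}\\ j\ne\ell}}\bigl(\operatorname{cl}P_i^j\cap\operatorname{cl}P_i^\ell\bigr)$$ is Lebesgue negligible. Then there exists $\Gamma\subset(0,\infty)$ of full Lebesgue measure such that, for Lebesgue-almost every $c>0$, $c\alpha_k\in\Gamma$ for all $k\in\mathbb{N}$. For each such $c>0$ (i.e. each $c>0$ with $c\alpha_k\in\Gamma$ for all $k$), there exists $G\subset\mathbb{R}^m$ of full Lebesgue measure with the following property: if $x_0\in G$ and the iterates generated by $$x_{k+1}=x_k-c\,\alpha_k\widetilde\nabla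 f_{i_k}(x_k),\qquad k\in\mathbb{N},$$ are bounded $\mathbb P$-almost surely, then $\mathbb P$-almost surely $$\lim_{k\to\infty}\operatorname{dist}\bigl(x_k,\{x\in\mathbb{R}^m:0\in\partial^c f(x)\}\bigr)=0,$$ and the sequence of function values $(f(x_k))_{k\in\mathbb{N}}$ converges. Moreover, the set of limit points of $(x_k)_{k\in\mathbb{N}}$ is connected ($\mathbb P$-almost surely).
   Context: A continuous function $g\colon\mathbb{R}^m\to\mathbb{R}$ is piecewise-$C^p$ if there exist a finite Borel partition $\mathbb{R}^m=\bigsqcup_{j=1}^J P^j$ (nonempty, pairwise disjoint Borel sets) and $C^p$ functions $g^1,\ldots,g^J\colon\mathbb{R}^m\to\mathbb{R}$ with $g(x)=g^j(x)$ whenever $x\in P^j$; the pair $(\{P^j\},\{g^j\})$ is a representation of $g$. The piecewise gradient of $g$ with respect to this representation is $\widetilde\nabla g(x)=\nabla g^j(x)$ for $x\in P^j$. Such functions are locally Lipschitz. The Clarke subdifferential of a locally Lipschitz $\varphi\colon\mathbb{R}^m\to\mathbb{R}$ is $\partial^c\varphi(x)=\operatorname{conv}\{u:\exists(x_\ell)\subset\Omega_\varphi,\ x_\ell\to x,\ \nabla\varphi(x_\ell)\to u\}$, where $\Omega_\varphi$ is the (full-measure) set of points of differentiability of $\varphi$ and $\operatorname{conv}$ is the convex hull. Probability setting: $(\Omega_0,\mathcal F_0,\mathbb P^0)$ is a probability space with a random variable $\iota\colon\Omega_0\to\{1,\ldots,n\}$ satisfying $\mathbb P^0(\iota=\ell)=1/n$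 for each $\ell$. Set $\Omega=\Omega_0^{\mathbb N}$, $\mathcal F=\mathcal F_0^{\otimes\mathbb N}$, $\mathbb P=(\mathbb P^0)^{\otimes\mathbb N}$, and $i_k(\omega)=\iota(\omega_k)$ for $\omega=(\omega_0,\omega_1,\ldots)$; thus the $i_k$ are i.i.d. uniform on $\{1,\ldots,n\}$. ''Full Lebesgue measure'' means that the complement (in $(0,\infty)$, resp. $\mathbb{R}^m$) is Lebesgue null. $\operatorname{dist}(x,S)=\inf\{\|x-y\|:y\in S\}$, with $\operatorname{dist}(x,\varnothing)=\infty$. $\operatorname{cl}$ is the closure. A limit point of $(x_k)$ is a limit of a convergent subsequence. *)

(* Defs.v *)
From HB Require Import structures.
From mathcomp Require Import all_boot all_order all_algebra.
From mathcomp Require Import all_classical all_reals all_analysis.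

Set Implicit Arguments.
Unset Strict Implicit.
Unset Printing Implicit Defensive.

Import Order.TTheory GRing.Theory Num.Theory.
Import numFieldNormedType.Exports.

Local Open Scope classical_set_scope.
Local Open Scope ring_scope.

Section Euclidean.
Context {R : realType} {m : nat}.
Implicit Types (x y : 'rV[R]_m) (g : 'rV[R]_m -> R).

(* The library norm on 'rV[R]_m is the sup norm; this is the Euclidean one. *)
Definition enorm x : R := Num.sqrt (\sum_(i < m) x 0 i ^+ 2).

(* The infimum of the empty set in \bar R is +oo. *)
Definition dist_to x (S : set 'rV[R]_m) : \bar R :=
  ereal_inf [set (enorm (x - y))%:E | y in S].

Definition gradient g x : 'rV[R]_m :=
  \row_(i < m) 'D_(delta_mx 0 i) g x.

(* Existence and continuity of all iterated partial derivatives up to order k. *)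
Fixpoint continuously_differentiable (k : nat) g : Prop :=
  if k is k'.+1 then
    continuous g /\
    forall i : 'I_m, (forall x, derivable g x (delta_mx 0 i)) /\
      continuously_differentiable k' ('D_(delta_mx 0 i) g)
  else continuous g.

(* Regularity exponents live in option nat, None standing for infinity. *)
Definition class_C (p : option nat) g : Prop :=
  if p is Some k then continuously_differentiable k g
  else forall k, continuously_differentiable k g.

Definition le_exponent (k : nat) (p : option nat) : bool :=
  if p is Some q then (k <= q)%N else true.

Definition borel_set : set (set 'rV[R]_m) := <<s [set U | open U] >>.

Definition borel_partition (J : nat) (P : 'I_J -> set 'rV[R]_m) : Prop :=
  [/\ forall j, borel_set (P j),
      forall j, P j !=set0,
      trivIset setT P
    & \bigcup_j P j = setT].

Definition piecewise_representation (p : option nat) g (J : nat)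
    (P : 'I_J -> set 'rV[R]_m) (gs : 'I_J -> 'rV[R]_m -> R) : Prop :=
  [/\ continuous g,
      borel_partition P,
      forall j, class_C p (gs j)
    & forall j x, P j x -> g x = gs j x].

(* For a partition P the sum has exactly one term. *)
Definition piecewise_gradient (J : nat) (P : 'I_J -> set 'rV[R]_m)
    (gs : 'I_J -> 'rV[R]_m -> R) x : 'rV[R]_m :=
  \sum_(j < J | x \in P j) gradient (gs j) x.

Definition interface (J : nat) (P : 'I_J -> set 'rV[R]_m) : set 'rV[R]_m :=
  \bigcup_(jl in [set jl : 'I_J * 'I_J | jl.1 != jl.2])
    (closure (P jl.1) `&` closure (P jl.2)).

Definition convex_hull (A : set 'rV[R]_m) : set 'rV[R]_m :=
  [set u | exists (N : nat) (t : 'I_N -> R) (v : 'I_N -> 'rV[R]_m),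
    [/\ forall i, 0 <= t i, \sum_(i < N) t i = 1, forall i, A (v i)
      & u = \sum_(i < N) t i *: v i]].

Definition clarke_subdifferential g x : set 'rV[R]_m :=
  convex_hull [set u | exists xs : nat -> 'rV[R]_m,
    [/\ forall l, differentiable g (xs l),
        xs l @[l --> \oo] --> x
      & gradient g (xs l) @[l --> \oo] --> u]].

Definition limit_points (xs : nat -> 'rV[R]_m) : set 'rV[R]_m :=
  [set y | exists phi : nat -> nat,
    {homo phi : k l / (k < l)%N} /\ xs (phi k) @[k --> \oo] --> y].

Definition box (a b : 'rV[R]_m) : set 'rV[R]_m :=
  [set x | forall i, a 0 i <= x 0 i <= b 0 i].

(* m-dimensional Lebesgue outer measure, by countable covers with boxes. *)
Definition lebesgue_outer (A : set 'rV[R]_m) : \bar R :=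
  ereal_inf [set v | exists a b : nat -> 'rV[R]_m,
    [/\ forall k i, a k 0 i <= b k 0 i,
        A `<=` \bigcup_k box (a k) (b k)
      & v = (\sum_(0 <= k <oo) (\prod_(i < m) (b k 0 i - a k 0 i))%:E)%E]].

Definition lebesgue_null (A : set 'rV[R]_m) : Prop := lebesgue_outer A = 0%E.

End Euclidean.

Section InfiniteProduct.
Context {d0 : measure_display} {T0 : measurableType d0}.

Definition coordinate_preimages : set (set (nat -> T0)) :=
  \bigcup_k preimage_set_system setT (fun w : nat -> T0 => w k) measurable.

(* nat -> T0 with the product sigma-algebra. *)
Definition infinite_product := g_sigma_algebraType coordinate_preimages.

(* The defining (and characterizing) property of the power of P0. *)
Definition is_product_measure (R : realType) (P0 : probability T0 R)
    (P : probability infinite_product R) : Prop :=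
  forall (N : nat) (A : nat -> set T0), (forall k, measurable (A k)) ->
    P [set w : infinite_product | forall k, (k < N)%N -> A k (w k)] =
    (\prod_(k < N) P0 (A k))%E.

End InfiniteProduct.
Arguments infinite_product {d0} T0.

Fixpoint sgd (R : realType) (m n : nat) (grad : 'I_n -> 'rV[R]_m -> 'rV[R]_m)
    (step : nat -> R) (idx : nat -> 'I_n) (x0 : 'rV[R]_m) (k : nat) : 'rV[R]_m :=
  if k is k'.+1 then
    let x := sgd grad step idx x0 k' in x - step k' *: grad (idx k') x
  else x0.

(* Main.v *)
(** Off the interfaces f coincides locally with one of finitely many averages
    g_j of smooth pieces, so x_k is a noisy Euler scheme for the inclusion
    gamma' in - conv {grad g_j (gamma) : gamma in C_j}, with C_j the closure of
    the open set where f = g_j.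

    - Noise. Conditionally centred increments of size O(a_k) with
      a_k = o(1 / log k) have, by Chernoff's bound with th = 4 ln k / eta, window
      sums exceeding eta with probability at most k^-2; Borel-Cantelli applies.
    - Descent. Along an ultrafilter the interpolated iterates converge to a
      Lipschitz curve gamma. The integrated inclusion gives
      f (gamma T) - f (gamma 0) <= - |gamma T - gamma 0|^2 / T, because the
      Lipschitz function f (gamma) - g_j (gamma) does not vary on its zero set,
      which contains the times spent on the piece j; by Gordan's alternative the
      decrease is strict from a point where 0 is not in the hull.
    - Sard. The critical values of f contain no interval. After Taylor expansion
      on small cubes this is a statement about near critical values of
      polynomials of bounded degree, where quantifier elimination bounds the
      number of alternations of a definable selection uniformly in the
      coefficients. Hence f (x_k) cannot oscillate, so it converges and every
      limit point is critical.
    - Step sizes. x - al grad g (x) pulls null sets back to null sets unless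
      1 / al is an eigenvalue of the Hessian of g on a set of positive measure;
      since a point carries at most m eigenvalues, this excludes only countably
      many al. So for almost every x_0 no iterate meets an interface. *)

Require Import Defs.
From HB Require Import structures.
From mathcomp Require Import all_boot all_order all_algebra.
From mathcomp Require Import all_classical all_reals all_analysis.
From mathcomp Require Import measurable_realfun lra ring zify.
From mathcomp Require ordered_qelim qe_rcf polyrcf.

Set Implicit Arguments.
Unset Strict Implicit.
Unset Printing Implicit Defensive.

Import Order.TTheory GRing.Theory Num.Theory.
Import numFieldNormedType.Exports.

Local Open Scope classical_set_scope.
Local Open Scope ring_scope.

Module ord := ordered_qelim.ord.

Local Notation contdiff := continuously_differentiable.
Local Notation partial i g := ('D_(delta_mx 0 i) g).

(** * Row vectors and limits along ultrafilters *)

Section Limits.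
Context {R : realType} {V : normedModType R} {S : Type}.
Variables (F : set_system S) (FF : Filter F).

Lemma cvg_sum (I : Type) (r : seq I) (f : I -> S -> V) (l : I -> V) :
  (forall i, f i x @[x --> F] --> l i) ->
  \sum_(i <- r) f i x @[x --> F] --> \sum_(i <- r) l i.
Proof. by move=> fl; apply: cvg_big => [|i _]; [exact: add_continuous|exact: fl]. Qed.

End Limits.

Section ContinuousFunctions.
Context {R : realType} {T : topologicalType}.
Implicit Types f g : T -> R.

Lemma continuous_sum (I : Type) (r : seq I) (f : I -> T -> R) :
  (forall i, continuous (f i)) -> continuous (fun x => \sum_(i <- r) f i x).
Proof. by move=> cf x; apply: cvg_sum => i; exact: cf. Qed.

Lemma continuous_mul f g : continuous f -> continuous g ->
  continuous (fun x => f x * g x).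
Proof. by move=> cf cg x; exact: cvgM (cf x) (cg x). Qed.

Lemma continuous_sub f g : continuous f -> continuous g ->
  continuous (fun x => f x - g x).
Proof. by move=> cf cg x; exact: cvgB (cf x) (cg x). Qed.

Lemma closed_le_continuous f g : continuous f -> continuous g ->
  closed [set x | f x <= g x].
Proof.
move=> cf cg; rewrite (_ : [set x | _] = [set x | f x - g x <= 0]).
  by move: (continuous_sub cf cg) => /continuous_closedP/(_ [set y | y <= 0] (@closed_le _ 0)).
by apply/seteqP; split=> x /=; rewrite subr_le0.
Qed.

Lemma closed_eq_continuous f g : continuous f -> continuous g ->
  closed [set x | f x = g x].
Proof.
move=> cf cg; rewrite (_ : [set x | _] = [set x | f x <= g x] `&` [set x | g x <= f x]).
  by apply: closedI; exact: closed_le_continuous.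
apply/seteqP; split=> x /=; first by move=> ->.
by move=> [fg gf]; apply/eqP; rewrite eq_le fg.
Qed.

Lemma closed_forall (I : Type) (A : I -> set T) : (forall i, closed (A i)) ->
  closed [set x | forall i, A i x].
Proof. by move=> cA x clx i; apply: cA; apply: closure_subset clx => y; exact. Qed.

End ContinuousFunctions.

Section RowVectors.
Context {R : realType} {m : nat}.
Implicit Types (x y z : 'rV[R]_m) (M : R).

Lemma ler_coord_norm x i : `|x 0 i| <= `|x|.
Proof.
rewrite [leRHS]/Num.norm /= mx_normrE.
exact: (le_bigmax _ (fun ij => `|x ij.1 ij.2|) (ord0, i)).
Qed.

Lemma ler_coord_distl x y i : `|x 0 i - y 0 i| <= `|x - y|.
Proof. by have := ler_coord_norm (x - y) i; rewrite !mxE. Qed.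

Lemma rV_norm_leP x M : 0 <= M -> reflect (forall i, `|x 0 i| <= M) (`|x| <= M).
Proof.
move=> M0; apply: (iffP idP) => [xM i|xM]; first exact: le_trans (ler_coord_norm x i) xM.
rewrite [leLHS]/Num.norm /= mx_normrE.
by apply/bigmax_leP; split=> // -[i j] _ /=; rewrite (ord1 i).
Qed.

Lemma compact_norm_le M : compact [set x : 'rV[R]_m | `|x| <= M].
Proof.
apply: bounded_closed_compact.
  by exists M; split=> [|K MK x /le_trans]; [exact: num_real|apply; exact: ltW].
apply: closed_le_continuous; last exact: cst_continuous.
exact: norm_continuous.
Qed.

Section Filters.
Variables (T : Type) (F : set_system T) (FF : Filter F).

Lemma cvg_rV (x : T -> 'rV[R]_m) (l : 'rV[R]_m) :
  (forall i, x t 0 i @[t --> F] --> l 0 i) -> x t @[t --> F] --> l.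
Proof.
move=> xl; apply/cvgrPdist_le => e e0.
have : \forall t \near F, forall i, `|l 0 i - x t 0 i| <= e.
  by apply: filter_forall => i; move/cvgrPdist_le : (xl i); exact.
apply: filterS => t lxt; apply/rV_norm_leP => [|i]; first exact: ltW.
by rewrite !mxE.
Qed.

Lemma cvg_coord (x : T -> 'rV[R]_m) (l : 'rV[R]_m) i :
  x t @[t --> F] --> l -> x t 0 i @[t --> F] --> l 0 i.
Proof. by move=> xl; exact: cvg_comp xl (@coord_continuous R 1 m 0 i l). Qed.

End Filters.

(* The mean value theorem is applied one coordinate at a time, so that
   intermediate points live in the coordinate rectangle spanned by x and y. *)
Definition in_rectangle x y (z : 'rV[R]_m) : Prop :=
  forall l, exists2 t, 0 <= t <= 1 & z 0 l = x 0 l + t * (y 0 l - x 0 l).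

Lemma in_rectangle_ball x y z w M : in_rectangle x y z ->
  `|x - w| <= M -> `|y - w| <= M -> `|z - w| <= M.
Proof.
move=> xyz xM yM; have M0 := le_trans (normr_ge0 _) xM.
apply/rV_norm_leP => // l; have [t /andP[t0 t1] zE] := xyz l; rewrite !mxE zE.
have := le_trans (ler_coord_distl x w l) xM; have := le_trans (ler_coord_distl y w l) yM.
rewrite !ler_norml => /andP[yl yr] /andP[xl xr]; apply/andP; split; nra.
Qed.

Lemma in_rectangle_norm_le x y z M : in_rectangle x y z ->
  `|x| <= M -> `|y| <= M -> `|z| <= M.
Proof. by move=> xyz; have := @in_rectangle_ball x y z 0 M xyz; rewrite !subr0. Qed.

Lemma in_rectangle_dist_le x y z : in_rectangle x y z -> `|z - x| <= `|y - x|.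
Proof. by move=> xyz; apply: in_rectangle_ball xyz _ _; rewrite ?subrr ?normr0. Qed.

End RowVectors.

Definition frequently (A : set nat) := forall N, exists2 k, (N <= k)%N & A k.

Lemma not_near_frequently (A : set nat) :
  ~ (\forall k \near \oo, A k) -> frequently (~` A).
Proof.
move=> nA N; apply: contrapT => nfreq; apply: nA; exists N => // k /= Nk.
by apply: contrapT => nAk; apply: nfreq; exists k.
Qed.

Class free_ultrafilter (U : set_system nat) : Prop := FreeUltrafilter {
  free_ultrafilter_ultra :: UltraFilter U;
  free_ultrafilter_oo : \oo `<=` U }.

Lemma frequently_free_ultrafilter (A : set nat) : frequently A ->
  exists2 U : set_system nat, free_ultrafilter U & U A.
Proof.
move=> freqA; pose F := within A \oo.
have FF : ProperFilter F.
  apply: Build_ProperFilter_ex => B [N _ NB]; have [k Nk Ak] := freqA N.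
  by exists k; apply: NB.
have [U [UU FU]] := ultraFilterLemma FF; exists U; last by apply: FU; apply: withinT.
by split=> // B ooB; apply: FU; apply: filterS ooB => k Bk _.
Qed.

Lemma free_ultrafilter_exists : exists U : set_system nat, free_ultrafilter U.
Proof. by have [|U] := @frequently_free_ultrafilter setT; [move=> N; exists N|exists U]. Qed.

Section FreeUltrafilters.
Variables (U : set_system nat) (UU : free_ultrafilter U).

Lemma cvg_free_ultrafilter (T : topologicalType) (u : nat -> T) (l : T) :
  u k @[k --> \oo] --> l -> u k @[k --> U] --> l.
Proof. by move=> ul A /ul; exact: free_ultrafilter_oo. Qed.

Lemma free_ultrafilter_ge N : \forall k \near U, (N <= k)%N.
Proof. by apply: free_ultrafilter_oo; exact: nbhs_infty_ge. Qed.

Lemma free_ultrafilter_frequently (A : set nat) : U A -> frequently A.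
Proof.
move=> UA N; have [k [Ak Nk]] := filter_ex (filterI UA (free_ultrafilter_ge N)).
by exists k.
Qed.

End FreeUltrafilters.

Section UltrafilterLimits.
Context {T : Type} {U : set_system T} {UU : UltraFilter U}.

Lemma compact_ultra_cvg (X : topologicalType) (A : set X) (x : T -> X) :
  compact A -> (forall t, A (x t)) -> exists2 l, A l & x t @[t --> U] --> l.
Proof.
move=> cA Ax; have UA : U (x @^-1` A) by apply: filterE.
have [l [Al cl]] := cA (x t @[t --> U]) _ UA; exists l => // B nB.
have [//|UB] := in_ultra_setVsetC (x @^-1` B) UU.
by have [y []] := cl (~` B) B UB nB.
Qed.

Lemma ultra_cvg_rV (R : realType) (m : nat) (x : T -> 'rV[R]_m) (M : R) :
  (forall t, `|x t| <= M) -> exists l, x t @[t --> U] --> (l : 'rV[R]_m).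
Proof. by move=> /(compact_ultra_cvg (@compact_norm_le R m M))[l _]; exists l. Qed.

Lemma ultra_cvg_real (R : realType) (x : T -> R) (a b : R) :
  (forall t, a <= x t <= b) -> exists l, x t @[t --> U] --> (l : R).
Proof.
move=> xab; have [t|l _ xl] := @compact_ultra_cvg _ _ x (@segment_compact R a b).
  by rewrite /= in_itv /= xab.
by exists l.
Qed.

Lemma ultra_constant (J : finType) (c : T -> J) : exists j, \forall t \near U, c t = j.
Proof.
apply: contrapT => ncst.
have notc j : \forall t \near U, c t <> j.
  have [cj|//] := in_ultra_setVsetC [set t | c t = j] UU.
  by exfalso; apply: ncst; exists j.
have : \forall t \near U, forall j, c t <> j by apply: filter_forall.
by move=> /filter_ex[t /(_ (c t))]; apply.
Qed.

End UltrafilterLimits.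

Lemma cvg_natSinv_dist (R : realType) (V : normedModType R) (u : nat -> V) (l : V) :
  (forall n, `|u n - l| <= n.+1%:R^-1) -> u n @[n --> \oo] --> l.
Proof.
move=> ul; apply/cvgrPdist_lt => e e0; near=> n; rewrite distrC.
by apply: le_lt_trans (ul n) _; near: n; exact: near_infty_natSinv_lt (PosNum e0).
Unshelve. all: by end_near. Qed.

Section Subdivisions.
Context {R : realType} (a b : R) (n : nat).

Definition subdivision (k : nat) : R := a + k%:R * ((b - a) / n%:R).

Lemma subdivision0 : subdivision 0 = a.
Proof. by rewrite /subdivision mul0r addr0. Qed.

Lemma subdivisionS k : subdivision k.+1 = subdivision k + (b - a) / n%:R.
Proof. by rewrite /subdivision -natr1 mulrDl mul1r addrA. Qed.

Hypothesis n_gt0 : (0 < n)%N.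

Lemma subdivision_last : subdivision n = b.
Proof. by rewrite /subdivision mulrC divfK ?pnatr_eq0 -?lt0n // addrC subrK. Qed.

Lemma subdivision_lt : a < b -> {homo subdivision : i j / (i < j)%N >-> i < j}.
Proof.
move=> ab i j ij; rewrite ltrD2l ltr_pM2r ?ltr_nat //.
by rewrite divr_gt0 ?subr_gt0 ?ltr0n.
Qed.

Lemma subdivision_itv k : a <= b -> (k <= n)%N -> a <= subdivision k <= b.
Proof.
move=> ab kn; have h0 : 0 <= (b - a) / n%:R by rewrite divr_ge0 ?subr_ge0.
rewrite /subdivision lerDl mulr_ge0 //= -[leRHS]subdivision_last lerD2l.
by rewrite ler_wpM2r // ler_nat.
Qed.

End Subdivisions.

Section Grids.
Context {R : realType} {m : nat}.
Implicit Types (x : 'rV[R]_m).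

Lemma cell_truncn (a h t : R) : 0 < h -> a <= t ->
  `|t - (a + (2 * (Num.truncn ((t - a) / (2 * h)))%:R + 1) * h)| <= h.
Proof.
move=> h0 at_; have h2 : 0 < 2 * h by rewrite mulr_gt0.
have /truncn_itv/andP[] : 0 <= (t - a) / (2 * h) by rewrite divr_ge0 ?(ltW h2) // subr_ge0.
move: (Num.truncn _) => k; rewrite ler_pdivlMr // ltr_pdivrMr // -[k.+1%:R]natr1 ler_norml.
by move: (k%:R) => u tl tr; apply/andP; split; lra.
Qed.

Variables (b : R) (L : nat).

Definition grid_center (z : {ffun 'I_m -> 'I_L.+2}) : 'rV[R]_m :=
  \row_i (- b + (2 * (z i)%:R + 1) * (b / L.+1%:R)).

Hypothesis b_gt0 : 0 < b.

Let h_gt0 : 0 < b / L.+1%:R. Proof. by rewrite divr_gt0. Qed.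

Let bE : L.+1%:R * (b / L.+1%:R) = b. Proof. by rewrite mulrC divfK. Qed.

Lemma grid_center_norm z : `|grid_center z| <= 2 * b.
Proof.
apply/rV_norm_leP => [|i]; first by rewrite mulr_ge0 // ltW.
have zL : (z i)%:R <= L.+1%:R :> R by rewrite ler_nat -ltnS.
have L1 : 1 <= L.+1%:R :> R by rewrite ler1n.
rewrite mxE ler_norml; move: bE h_gt0; move: (b / _) zL L1 => h zL L1 bE' h0.
have z0 : 0 <= (z i)%:R :> R by [].
by apply/andP; split; nra.
Qed.

Lemma grid_cover x : `|x| <= b -> exists z, `|x - grid_center z| <= b / L.+1%:R.
Proof.
move=> /(rV_norm_leP _ (ltW b_gt0)) xb.
have xbd i : - b <= x 0 i <= b by rewrite -ler_norml.
pose k i := Num.truncn ((x 0 i - (- b)) / (2 * (b / L.+1%:R))).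
have kL i : (k i < L.+2)%N.
  have q0 : 0 <= (x 0 i - (- b)) / (2 * (b / L.+1%:R)).
    apply: divr_ge0; last by rewrite mulr_ge0 // ltW.
    by rewrite subr_ge0; case/andP: (xbd i).
  rewrite /k truncn_lt_nat // ltr_pdivrMr ?mulr_gt0 // -[L.+2%:R]natr1 mulrDl mul1r mulrCA bE.
  by have /andP[_] := xbd i; move: h_gt0; move: (b / _) (x 0 i) => h y *; lra.
exists [ffun i => Ordinal (kL i)]; apply/rV_norm_leP; first exact: ltW.
move=> i; rewrite !mxE ffunE; apply: cell_truncn => //.
by case/andP: (xbd i).
Qed.

Lemma grid_volume :
  #|{: {ffun 'I_m -> 'I_L.+2}}|%:R * (b / L.+1%:R) ^+ m <= (2 * b) ^+ m.
Proof.
rewrite card_ffun !card_ord natrX -exprMn; apply: lerXn2r; rewrite ?nnegrE.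
- by rewrite mulr_ge0 // ltW.
- by rewrite mulr_ge0 // ltW.
rewrite -[L.+2%:R]natr1 mulrDl mul1r bE mulr_natl mulr2n lerD2l.
by rewrite ler_pdivrMr // ler_peMr ?ler1n // ltW.
Qed.

End Grids.

(** * Smooth functions and Taylor polynomials *)

Lemma real_mvt (R : realType) (phi dphi : R -> R) (a b : R) :
  (forall s, is_derive s (1 : R) phi (dphi s)) ->
  exists2 t, 0 <= t <= 1 & phi b - phi a = (b - a) * dphi (a + t * (b - a)).
Proof.
move=> dphiP; wlog ab : a b / a <= b => [wlog_le|].
  have [/wlog_le//|/ltW/wlog_le[t /andP[t0 t1] phiE]] := leP a b.
  exists (1 - t); first by rewrite subr_ge0 t1 lerBlDr lerDl.
  by rewrite -opprB phiE -mulNr opprB; congr (_ * dphi _); ring.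
have cphi : {within `[a, b], continuous phi}.
  by apply: derivable_within_continuous => s _; case: (dphiP s).
have [c] := MVT_segment ab (fun s _ => dphiP s) cphi.
rewrite in_itv /= => /andP[ac cb] ->; move: ab; rewrite le_eqVlt => /orP[/eqP ab|ab].
  by exists 0; [rewrite lexx ler01|rewrite ab subrr mulr0 mul0r].
exists ((c - a) / (b - a)).
  rewrite divr_ge0 ?subr_ge0 ?(ltW ab) //= ler_pdivrMr ?subr_gt0 // mul1r.
  by rewrite lerD2r.
by rewrite divfK ?subr_eq0 ?gt_eqF // [a + _]addrC subrK mulrC.
Qed.

Section Derivatives.
Context {R : realType} {m : nat}.
Implicit Types (x y v : 'rV[R]_m) (g h : 'rV[R]_m -> R).

Lemma is_derive_translate g x y v : derivable g (x + y) v ->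
  is_derive x v (fun z => g (z + y)) ('D_v g (x + y)).
Proof.
move=> dg.
have E (k : R) : ((fun z => g (z + y)) \o shift x) (k *: v) - g (x + y) =
    (g \o shift (x + y)) (k *: v) - g (x + y) by rewrite /= addrA.
apply: DeriveDef; first by rewrite /derivable; under eq_fun do rewrite E.
by rewrite /derive; under eq_fun do rewrite E.
Qed.

Lemma is_derive_line g x v (s : R) : derivable g (x + s *: v) v ->
  is_derive s (1 : R) (fun s => g (x + s *: v)) ('D_v g (x + s *: v)).
Proof.
move=> dg; pose phi (t : R) := g (x + t *: v).
have E (k : R) : (phi \o shift s) (k *: 1) - phi s =
    (g \o shift (x + s *: v)) (k *: v) - g (x + s *: v).
  by rewrite /phi /=; congr (g _ - _); rewrite [k *: 1]mulr1 scalerDl addrCA.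
apply: DeriveDef; first by rewrite /derivable; under eq_fun do rewrite E.
by rewrite /derive; under eq_fun do rewrite E.
Qed.

Lemma is_derive_coord x v l : is_derive x v (fun z : 'rV[R]_m => z 0 l) (v 0 l).
Proof.
have quotient_cvg : (k : R)^-1 *: (((fun z : 'rV[R]_m => z 0 l) \o shift x) (k *: v) - x 0 l)
    @[k --> 0^'] --> v 0 l.
  apply: cvg_near_cst; near=> k.
  rewrite /= !mxE addrK [_ *: _]mulrA mulVf ?mul1r //.
  by near: k; exact: nbhs_dnbhs_neq.
apply: DeriveDef; first by apply/cvg_ex; exists (v 0 l).
exact: cvg_lim quotient_cvg.
Unshelve. all: by end_near. Qed.

Lemma directional_mvt g x v (d : R) : (forall y, derivable g y v) ->
  exists2 t, 0 <= t <= 1 & g (x + d *: v) - g x = d * 'D_v g (x + (t * d) *: v).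
Proof.
move=> dg; have [t t01] := @real_mvt _ _ _ 0 d (fun s => @is_derive_line g x v s (dg _)).
by rewrite scale0r addr0 subr0 add0r => gE; exists t.
Qed.

Lemma coordwise_mvt g x y : (forall i z, derivable g z (delta_mx 0 i)) ->
  exists2 xi : 'I_m -> 'rV[R]_m, forall i, in_rectangle x y (xi i) &
    g y - g x = \sum_i (y 0 i - x 0 i) * partial i g (xi i).
Proof.
move=> dg; pose h k : 'rV[R]_m := \row_l if (l < k)%N then y 0 l else x 0 l.
have hS (k : 'I_m) : h k.+1 = h k + (y 0 k - x 0 k) *: delta_mx 0 k.
  apply/rowP => l; rewrite !mxE eqxx /= ltnS leq_eqVlt.
  have [->|lk] := eqVneq l k; first by rewrite eqxx ltnn /=; ring.
  by rewrite (negbTE (_ : nat_of_ord l != k)) //= mulr0 addr0.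
have /choice[t tP] : forall k : 'I_m, exists t, 0 <= t <= 1 /\
    g (h k.+1) - g (h k) = (y 0 k - x 0 k) *
      partial k g (h k + (t * (y 0 k - x 0 k)) *: delta_mx 0 k).
  by move=> k; rewrite hS; have [t] := directional_mvt (h k) (y 0 k - x 0 k) (dg k); exists t.
exists (fun k : 'I_m => h k + (t k * (y 0 k - x 0 k)) *: delta_mx 0 k).
  move=> k l; rewrite !mxE eqxx /=; have [->|lk] := eqVneq l k.
    by exists (t k); [case: (tP k)|rewrite ltnn mulr1].
  rewrite mulr0 addr0; case: ifP => _; first by exists 1; [rewrite ler01 lexx|ring].
  by exists 0; [rewrite ler01 lexx|ring].
have -> : y = h m by apply/rowP => l; rewrite mxE ltn_ord.
have -> : x = h 0%N by apply/rowP => l; rewrite mxE.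
rewrite -(telescope_sumr (fun k => g (h k))) // big_mkord.
by apply: eq_bigr => k _; case: (tP k) => _ ->; rewrite !mxE ltn_ord.
Qed.

End Derivatives.

Section SmoothFunctions.
Context {R : realType} {m : nat}.
Implicit Types (x y z : 'rV[R]_m) (g h : 'rV[R]_m -> R) (M e : R).

Lemma continuous_near_bounded g M : continuous g ->
  \forall B \near +oo, forall x, `|x| <= M -> `|g x| <= B.
Proof.
move=> cg; have cgM : {within [set x : 'rV[R]_m | `|x| <= M], continuous g}.
  exact: continuous_subspaceT.
have : [bounded y | y in g @` [set x | `|x| <= M]].
  exact: compact_bounded (continuous_compact cgM (@compact_norm_le R m M)).
by rewrite /bounded_near; apply: filterS => B gB x xM; apply: (gB (g x)); exists x.
Qed.

Lemma continuous_near_uniform g M e : continuous g -> 0 < e ->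
  \forall r \near 0^'+, forall x y, `|x| <= M -> `|x - y| <= r -> `|g x - g y| <= e.
Proof.
move=> cg e0; have e2 : 0 < e / 2 by rewrite divr_gt0.
have /compact_near_coveringP cover := @compact_norm_le R m M.
apply: filterS (cover R 0^'+ (fun r x => forall y, `|x - y| <= r -> `|g x - g y| <= e) _ _).
  by move=> r gr x y /gr; exact.
move=> x _.
have /cvgr_dist_le/(_ _ e2)/nbhs_normP[d /= d0 gd] := cg x.
have d2 : 0 < d / 2 by rewrite divr_gt0.
near=> x' r.
have rd : r <= d / 2 by near: r; exact: nbhs_right_le.
have xx' : `|x - x'| < d / 2 by near: x'; apply: cvgr_dist_lt => //; exact: cvg_id.
move=> y x'y; rewrite -(subrKA (g x)) [leRHS]splitr (le_trans (ler_normD _ _)) // lerD //.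
  by rewrite distrC gd //= (lt_trans xx') // ltr_pdivrMr // mulr_natr mulr2n ltrDl.
apply: gd => /=; rewrite -(subrKA x') (le_lt_trans (ler_normD _ _)) // [ltRHS]splitr.
by rewrite ltr_leD // (le_trans x'y).
Unshelve. all: by end_near. Qed.

Lemma contdiff_continuous k g : contdiff k g -> continuous g.
Proof. by case: k => [//|k []]. Qed.

Lemma contdiff_derivable k g i x : contdiff k.+1 g -> derivable g x (delta_mx 0 i).
Proof. by move=> [_ /(_ i)[]]. Qed.

Lemma contdiff_partial k g i : contdiff k.+1 g -> contdiff k (partial i g).
Proof. by move=> [_ /(_ i)[]]. Qed.

Lemma contdiff_leq k l g : (k <= l)%N -> contdiff l g -> contdiff k g.
Proof.
elim: k l g => [|k IH] [|l] g //=; first by move=> _ [].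
by move=> kl [cg dg]; split=> // i; have [di /(IH _ _ kl)] := dg i.
Qed.

Lemma contdiff_cst k (c : R) : contdiff k (fun _ : 'rV[R]_m => c).
Proof.
elim: k c => [|k IH] c /=; first exact: cst_continuous.
split=> [|i]; first exact: cst_continuous.
split=> [x|]; first exact: derivable_cst.
by rewrite (_ : 'D_ _ _ = fun=> 0) //; apply/funext => x; rewrite derive_cst.
Qed.

Lemma contdiff_coord k i : contdiff k (fun x : 'rV[R]_m => x 0 i).
Proof.
have cx : continuous (fun x : 'rV[R]_m => x 0 i) by exact: coord_continuous.
case: k => [//|k]; split=> // l; split=> [x|]; first by case: (is_derive_coord x (delta_mx 0 l) i).
rewrite (_ : 'D_ _ _ = fun=> (delta_mx 0 l : 'rV[R]_m) 0 i); first exact: contdiff_cst.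
by apply/funext => x; case: (is_derive_coord x (delta_mx 0 l) i).
Qed.

Lemma contdiffD k g h : contdiff k g -> contdiff k h -> contdiff k (fun x => g x + h x).
Proof.
elim: k g h => [|k IH] g h /=; first by move=> cg ch x; exact: cvgD (cg x) (ch x).
move=> [cg dg] [ch dh]; split=> [x|i]; first exact: cvgD (cg x) (ch x).
have [dgi cgi] := dg i; have [dhi chi] := dh i; split=> [x|]; first exact: derivableD.
rewrite (_ : 'D_ _ _ = fun x => partial i g x + partial i h x); first exact: IH.
by apply/funext => x; rewrite -deriveD.
Qed.

Lemma contdiffM k g h : contdiff k g -> contdiff k h -> contdiff k (fun x => g x * h x).
Proof.
elim: k g h => [|k IH] g h cg ch; first exact: continuous_mul.
have [gk hk] := (contdiff_leq (leqnSn k) cg, contdiff_leq (leqnSn k) ch).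
split=> [|i]; first exact: continuous_mul (contdiff_continuous cg) (contdiff_continuous ch).
have dg x : derivable g x (delta_mx 0 i) by exact: contdiff_derivable cg.
have dh x : derivable h x (delta_mx 0 i) by exact: contdiff_derivable ch.
split=> [x|]; first exact: derivableM.
rewrite (_ : 'D_ _ _ = fun x => g x * partial i h x + h x * partial i g x).
  by apply: contdiffD; apply: IH => //; exact: contdiff_partial.
by apply/funext => x; rewrite -[LHS]/('D_(delta_mx 0 i) (g * h) x) deriveM.
Qed.

Lemma contdiffZ k (c : R) g : contdiff k g -> contdiff k (fun x => c * g x).
Proof. by apply: contdiffM; exact: contdiff_cst. Qed.

Lemma contdiff_sum k (I : Type) (r : seq I) (g : I -> 'rV[R]_m -> R) :
  (forall i, contdiff k (g i)) -> contdiff k (fun x => \sum_(i <- r) g i x).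
Proof.
move=> cg; elim: r => [|i r IH].
  by under eq_fun do rewrite big_nil; exact: contdiff_cst.
by under eq_fun do rewrite big_cons; exact: contdiffD.
Qed.

Lemma contdiff1_near_lipschitz g M : contdiff 1 g ->
  \forall L \near +oo, forall x y, `|x| <= M -> `|y| <= M -> `|g y - g x| <= L * `|y - x|.
Proof.
move=> g1; have : \forall B \near +oo, forall i x, `|x| <= M -> `|partial i g x| <= B.
  apply: filter_forall => i; apply: continuous_near_bounded.
  exact: contdiff_continuous (contdiff_partial i g1).
move=> /pinfty_ex_gt0[B B0 gB]; near=> L => x y xM yM.
have [xi xyxi ->] := coordwise_mvt x y (fun i z => @contdiff_derivable 0 g i z g1).
apply: le_trans (ler_norm_sum _ _ _) _.
apply: (@le_trans _ _ (\sum_(i < m) `|y - x| * B)); last first.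
  by rewrite sumr_const card_ord -[leLHS]mulr_natl mulrCA mulrC ler_wpM2r.
apply: ler_sum => i _; rewrite normrM ler_pM // ?ler_coord_distl // gB //.
exact: in_rectangle_norm_le (xyxi i) xM yM.
Unshelve. all: by end_near. Qed.

Lemma contdiff2_near_quadratic g M : contdiff 2 g ->
  \forall L \near +oo, forall x y, `|x| <= M -> `|y| <= M ->
    `|g y - g x - \sum_i partial i g x * (y 0 i - x 0 i)| <= L * `|y - x| ^+ 2.
Proof.
move=> g2; have : \forall B \near +oo, forall i x y, `|x| <= M -> `|y| <= M ->
    `|partial i g y - partial i g x| <= B * `|y - x|.
  by apply: filter_forall => i; apply: contdiff1_near_lipschitz; exact: contdiff_partial.
move=> /pinfty_ex_gt0[B B0 gB]; near=> L => x y xM yM.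
have g1 : contdiff 1 g by exact: contdiff_leq g2.
have [xi xyxi ->] := coordwise_mvt x y (fun i z => @contdiff_derivable 0 g i z g1).
rewrite -sumrB; apply: le_trans (ler_norm_sum _ _ _) _.
apply: (@le_trans _ _ (\sum_(i < m) `|y - x| * (B * `|y - x|))); last first.
  rewrite sumr_const card_ord -[leLHS]mulr_natl.
  have -> : m%:R * (`|y - x| * (B * `|y - x|)) = m%:R * B * `|y - x| ^+ 2 by ring.
  by rewrite ler_wpM2r // sqr_ge0.
apply: ler_sum => i _; rewrite [partial i g x * _]mulrC -mulrBr normrM.
rewrite ler_pM ?ler_coord_distl // (le_trans (gB _ _ _ xM _)) //.
  exact: in_rectangle_norm_le (xyxi i) xM yM.
by rewrite ler_wpM2l ?(ltW B0) //; exact: in_rectangle_dist_le.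
Unshelve. all: by end_near. Qed.

Lemma second_difference_mvt g i l x (s : R) : contdiff 2 g ->
  exists2 z, `|x - z| <= 2 * `|s| &
    g (x + s *: delta_mx 0 i + s *: delta_mx 0 l) - g (x + s *: delta_mx 0 i)
      - (g (x + s *: delta_mx 0 l) - g x) = s * (s * partial l (partial i g) z).
Proof.
move=> g2; have g1 : contdiff 1 g by exact: contdiff_leq g2.
have dg k z : derivable g z (delta_mx 0 k) by exact: contdiff_derivable g1.
pose phi z := g (z + s *: delta_mx 0 l) - g z.
have dphi z : is_derive z (delta_mx 0 i) phi
    (partial i g (z + s *: delta_mx 0 l) - partial i g z).
  by apply: is_deriveB; [exact: is_derive_translate|apply: DeriveDef].
have [|t t01 phiE] := @directional_mvt _ _ phi x (delta_mx 0 i) s.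
  by move=> z; case: (dphi z).
have [|u u01 gE] := @directional_mvt _ _ (partial i g)
  (x + (t * s) *: delta_mx 0 i) (delta_mx 0 l) s.
  by move=> z; exact: contdiff_derivable (contdiff_partial i g2).
exists (x + (t * s) *: delta_mx 0 i + (u * s) *: delta_mx 0 l); last first.
  rewrite -[LHS]/(phi (x + s *: delta_mx 0 i) - phi x) phiE -gE.
  by case: (dphi (x + (t * s) *: delta_mx 0 i)) => _ ->.
have unit_norm (k : 'I_m) : `|delta_mx 0 k : 'rV[R]_m| <= 1.
  apply/rV_norm_leP => // k'; rewrite mxE.
  by case: (_ && _); rewrite ?normr1 ?normr0.
have short (k : 'I_m) (c : R) : 0 <= c <= 1 -> `|(c * s) *: delta_mx 0 k : 'rV[R]_m| <= `|s|.
  move=> /andP[c0 c1]; rewrite normrZ normrM (ger0_norm c0) mulrAC.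
  by rewrite ler_piMl // mulr_ile1.
rewrite -addrA opprD addNKr normrN mulr_natl mulr2n.
by apply: le_trans (ler_normD _ _) _; rewrite lerD // short.
Qed.

Lemma partialC g i l : contdiff 2 g -> partial i (partial l g) = partial l (partial i g).
Proof.
move=> g2; have cg (k k' : 'I_m) : continuous (partial k (partial k' g)).
  exact: contdiff_continuous (contdiff_partial k (contdiff_partial k' g2)).
apply/funext => x; apply/eqP; rewrite -subr_eq0 -normr_le0.
apply/ler_addgt0Pr => e e0; rewrite add0r.
have e2 : 0 < e / 2 by rewrite divr_gt0.
have [r [[gil gli] r0]] := filter_ex (filterI
  (filterI (continuous_near_uniform `|x| (cg i l) e2) (continuous_near_uniform `|x| (cg l i) e2))
  (nbhs_right_gt 0)).
pose s := r / 2; have s0 : s != 0 by rewrite gt_eqF // divr_gt0.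
have sr : 2 * `|s| = r by rewrite gtr0_norm ?divr_gt0 // mulrC divfK.
have [z xz zE] := second_difference_mvt l i x s g2.
have [z' xz' z'E] := second_difference_mvt i l x s g2.
have same : partial i (partial l g) z = partial l (partial i g) z'.
  apply: (mulfI s0); apply: (mulfI s0); apply: (etrans (esym zE) (etrans _ z'E)).
  by rewrite [x + s *: delta_mx 0 l + s *: delta_mx 0 i]addrAC; ring.
rewrite -(subrKA (partial i (partial l g) z)) [leRHS]splitr.
apply: le_trans (ler_normD _ _) _; apply: lerD; first by apply: gil; rewrite ?lexx // -sr.
by rewrite same distrC; apply: gli; rewrite ?lexx // -sr.
Qed.

End SmoothFunctions.

(* A polynomial of degree at most d is stored by its coefficients: c w is the
   coefficient of the noncommutative monomial spelled by the word w. *)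
Section WordPolynomials.
Context {R : realType} {m : nat}.
Implicit Types (c : seq 'I_m -> R) (z : 'I_m -> R) (F G : ('I_m -> R) -> R).

Fixpoint peval (d : nat) c z : R :=
  c [::] + if d is d'.+1 then \sum_l z l * peval d' (fun w => c (l :: w)) z
           else 0.

Definition polyfun (d : nat) F : Prop := exists c, forall z, F z = peval d c z.

Lemma polyfun_cst d (a : R) : polyfun d (fun=> a).
Proof.
exists (fun w => if w is [::] then a else 0) => z.
have peval0 k : peval k (fun=> 0) z = 0.
  elim: k => [|k IH] /=; first by rewrite addr0.
  by rewrite add0r big1 // => l _; rewrite IH mulr0.
case: d => [|d] /=; first by rewrite addr0.
by rewrite big1 ?addr0 // => l _; rewrite peval0 mulr0.
Qed.

Lemma polyfun_form d (F : 'I_m -> ('I_m -> R) -> R) :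
  (forall l, polyfun d (F l)) -> polyfun d.+1 (fun z => \sum_l z l * F l z).
Proof.
move=> /choice[c cF]; exists (fun w => if w is l :: w' then c l w' else 0) => z /=.
by rewrite add0r; apply: eq_bigr => l _; rewrite cF.
Qed.

Lemma polyfunD d F G : polyfun d F -> polyfun d G -> polyfun d (fun z => F z + G z).
Proof.
move=> [c cF] [c' cG]; exists (fun w => c w + c' w) => z; rewrite cF cG.
elim: d c c' {cF cG} => [|d IH] c c' /=; first by rewrite !addr0.
rewrite addrACA -big_split /=; congr (_ + _); apply: eq_bigr => l _.
by rewrite -mulrDr IH.
Qed.

Lemma polyfunZ d (a : R) F : polyfun d F -> polyfun d (fun z => a * F z).
Proof.
move=> [c cF]; exists (fun w => a * c w) => z; rewrite cF.
elim: d c {cF} => [|d IH] c /=; first by rewrite !addr0.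
rewrite mulrDr mulr_sumr; congr (_ + _); apply: eq_bigr => l _.
by rewrite mulrCA IH.
Qed.

Lemma polyfun_leq d d' F : (d <= d')%N -> polyfun d F -> polyfun d' F.
Proof.
elim: d d' F => [|d IH] d' F.
  move=> _ [c cF]; have [c' c'E] := polyfun_cst d' (c [::]).
  by exists c' => z; rewrite cF -c'E /= addr0.
case: d' => // d' dd' [c cF].
have sub l : polyfun d' (peval d (fun w => c (l :: w))).
  by apply: IH => //; exists (fun w => c (l :: w)).
have [c' c'E] := polyfunD (polyfun_cst d'.+1 (c [::])) (polyfun_form sub).
by exists c' => z; rewrite cF -c'E.
Qed.

Lemma polyfun_sum d (I : Type) (r : seq I) (F : I -> ('I_m -> R) -> R) :
  (forall i, polyfun d (F i)) -> polyfun d (fun z => \sum_(i <- r) F i z).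
Proof.
move=> pF; elim: r => [|i r IH].
  by under eq_fun do rewrite big_nil; exact: polyfun_cst.
by under eq_fun do rewrite big_cons; exact: polyfunD.
Qed.

Lemma eq_peval d c c' z : (forall w, (size w <= d)%N -> c w = c' w) ->
  peval d c z = peval d c' z.
Proof.
elim: d c c' => [|d IH] c c' cc' /=; first by rewrite cc'.
rewrite cc' //; congr (_ + _); apply: eq_bigr => l _; congr (_ * _).
by apply: IH => w wd; apply: cc'.
Qed.

Lemma continuous_peval (T : topologicalType) d c (z : T -> 'I_m -> R) :
  (forall i, continuous (fun t => z t i)) -> continuous (fun t => peval d c (z t)).
Proof.
move=> cz; elim: d c => [|d IH] c /= t.
  by apply: cvgD; exact: cvg_cst.
apply: cvgD; first exact: cvg_cst.
by move: t; apply: continuous_sum => l; apply: continuous_mul; [exact: cz|exact: IH].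
Qed.

End WordPolynomials.

Section Taylor.
Context {R : realType} {m : nat}.
Implicit Types (x y z : 'rV[R]_m) (g h : 'rV[R]_m -> R).

Fixpoint taylor_form (s : nat) h x z : R :=
  if s is s'.+1 then \sum_l z 0 l * taylor_form s' (partial l h) x z else h x.

Definition taylor (k : nat) h x z : R :=
  \sum_(s < k.+1) s`!%:R^-1 * taylor_form s h x z.

Lemma contdiff_taylor p k h x : contdiff p (taylor k h x).
Proof.
apply: contdiff_sum => s; apply: contdiffZ; elim: {s}(s : nat) h => [|s IH] h /=.
  exact: contdiff_cst.
by apply: contdiff_sum => l; apply: contdiffM; [exact: contdiff_coord|exact: IH].
Qed.

Lemma polyfun_taylor k h x : polyfun k (fun z : 'I_m -> R => taylor k h x (\row_i z i)).
Proof.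
apply: polyfun_sum => s; apply: polyfunZ; apply: (@polyfun_leq _ _ s).
  by rewrite -ltnS.
elim: {s}(s : nat) h => [|s IH] h /=; first exact: polyfun_cst.
by under eq_fun do under eq_bigr do rewrite mxE; exact: polyfun_form.
Qed.

Lemma taylor0 k h x : taylor k h x 0 = h x.
Proof.
rewrite /taylor big_ord_recl /= invr1 mul1r big1 ?addr0 // => s _ /=.
by rewrite big1 ?mulr0 // => l _; rewrite mxE mul0r.
Qed.

Lemma is_derive_form x v (F : 'I_m -> 'rV[R]_m -> R) (dF : 'I_m -> R) :
  (forall l, is_derive x v (F l) (dF l)) ->
  is_derive x v (fun z => \sum_l z 0 l * F l z)
    (\sum_l (v 0 l * F l x + x 0 l * dF l)).
Proof.
move=> dFP.
have -> : (fun z : 'rV[R]_m => \sum_l z 0 l * F l z) =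
    \sum_l (fun z : 'rV[R]_m => z 0 l) * F l.
  by apply/funext => z; rewrite fct_sumE.
apply: is_derive_sum => l.
have := is_deriveM (is_derive_coord x v l) (dFP l).
by rewrite addrC [F l x *: _]mulrC.
Qed.

Lemma sum_delta_form (A B z : 'I_m -> R) (c : R) i :
  \sum_l ((delta_mx 0 i : 'rV[R]_m) 0 l * A l + z l * (c * B l)) =
  A i + c * \sum_l z l * B l.
Proof.
rewrite big_split /= (bigD1 i) //= mxE !eqxx mul1r big1 ?addr0; last first.
  by move=> l li; rewrite mxE eqxx (negbTE li) mul0r.
by congr (_ + _); rewrite mulr_sumr; apply: eq_bigr => l _; rewrite mulrCA.
Qed.

Lemma is_derive_taylor_form s h x z i : contdiff s.+1 h ->
  is_derive z (delta_mx 0 i) (taylor_form s.+1 h x)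
    (s.+1%:R * taylor_form s (partial i h) x z).
Proof.
elim: s h => [|s IH] h hs.
  have /is_derive_form : forall l, is_derive z (delta_mx 0 i)
      (fun _ : 'rV[R]_m => partial l h x) (0 * 0).
    by move=> l; rewrite mul0r; apply: is_derive_cst.
  by rewrite sum_delta_form mul0r addr0 mul1r.
have := is_derive_form (fun l => IH (partial l h) (contdiff_partial l hs)).
rewrite sum_delta_form.
have -> : \sum_l z 0 l * taylor_form s (partial i (partial l h)) x z =
    taylor_form s.+1 (partial i h) x z.
  have comm l : partial i (partial l h) = partial l (partial i h).
    by apply: partialC; exact: contdiff_leq hs.
  rewrite [RHS]/=; apply: eq_bigr => l _.
  exact: (congr1 (fun F => z 0 l * taylor_form s F x z) (comm l)).
by rewrite [s.+2%:R]mulrS mulrDl mul1r.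
Qed.

Lemma is_derive_taylor k h x z i : contdiff k.+1 h ->
  is_derive z (delta_mx 0 i) (taylor k.+1 h x) (taylor k (partial i h) x z).
Proof.
move=> hk.
have -> : taylor k.+1 h x = \sum_(s < k.+2) s`!%:R^-1 \*: taylor_form s h x.
  by apply/funext => y; rewrite fct_sumE.
have -> : taylor k (partial i h) x z = \sum_(s < k.+2)
    (if s : nat is s'.+1 then s'`!%:R^-1 * taylor_form s' (partial i h) x z else 0).
  by rewrite big_ord_recl add0r.
apply: is_derive_sum => -[[|s] sk] /=.
  have := is_deriveZ (0`!%:R^-1) (is_derive_cst (h x) z (delta_mx 0 i)).
  by rewrite scaler0.
have := is_deriveZ (s.+1`!%:R^-1)
  (is_derive_taylor_form x z i (@contdiff_leq R m s.+1 k.+1 h sk hk)).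
congr is_derive; rewrite -[_ *: _]/(_ * _) mulrA; congr (_ * _).
by rewrite factS natrM invfM mulrAC mulVf ?mul1r ?pnatr_eq0.
Qed.

Lemma near_taylor k h (M e : R) : contdiff k h -> 0 < e ->
  \forall r \near 0^'+, forall x z, `|x| <= M -> `|z| <= r ->
    `|h (z + x) - taylor k h x z| <= e * r ^+ k.
Proof.
elim: k h e => [|k IH] h e hk e0.
  apply: filterS (continuous_near_uniform M hk e0) => r unif x z xM zr.
  rewrite expr0 mulr1 /taylor big_ord_recl big_ord0 /= invr1 mul1r addr0 distrC.
  by apply: unif => //; rewrite opprD addrCA subrr addr0 normrN.
have em0 : 0 < e / m.+1%:R by rewrite divr_gt0.
have : \forall r \near 0^'+, forall i x z, `|x| <= M -> `|z| <= r ->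
    `|partial i h (z + x) - taylor k (partial i h) x z| <= e / m.+1%:R * r ^+ k.
  by apply: filter_forall => i; apply: IH => //; exact: contdiff_partial.
apply: filterS => r bound x z xM zr; have r0 := le_trans (normr_ge0 _) zr.
pose F y := h (y + x) - taylor k.+1 h x y.
have dF i y : is_derive y (delta_mx 0 i) F
    (partial i h (y + x) - taylor k (partial i h) x y).
  have dh := @is_derive_translate _ _ h y x _ (@contdiff_derivable _ _ _ _ i (y + x) hk).
  exact: is_deriveB dh (is_derive_taylor x y i hk).
have [|xi xiP FE] := @coordwise_mvt _ _ F 0 z; first by move=> i y; case: (dF i y).
have F0 : F 0 = 0 by rewrite /F add0r taylor0 subrr.
rewrite -/(F z) -[F z]subr0 -[X in _ - X]F0 FE.
apply: le_trans (ler_norm_sum _ _ _) _.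
apply: (@le_trans _ _ (\sum_(i < m) r * (e / m.+1%:R * r ^+ k))).
  apply: ler_sum => i _; rewrite normrM; have [_ ->] := dF i (xi i).
  rewrite mxE subr0 ler_pM ?(le_trans (ler_coord_norm z i)) // bound //.
  by apply: in_rectangle_norm_le (xiP i) _ zr; rewrite normr0.
rewrite sumr_const card_ord -[leLHS]mulr_natl.
have -> : m%:R * (r * (e / m.+1%:R * r ^+ k)) = m%:R / m.+1%:R * (e * r ^+ k.+1).
  by rewrite exprS; ring.
rewrite ler_piMl ?mulr_ge0 ?exprn_ge0 ?(ltW e0) //.
by rewrite ler_pdivrMr // mul1r ler_nat.
Qed.

End Taylor.

(** * Alternations of definable sets *)

Definition alternations (b : nat -> bool) (K : nat) : nat :=
  count (fun i => b i != b i.+1) (iota 0 K).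

Lemma count_le_predU (T : Type) (a a1 a2 : pred T) (s : seq T) :
  (forall x, a x -> a1 x || a2 x) -> (count a s <= count a1 s + count a2 s)%N.
Proof.
move=> a12; rewrite -count_predUI; apply: leq_trans (leq_addr _ _).
exact: sub_count.
Qed.

Lemma count_exists_le (I : finType) (T : Type) (a : I -> pred T) (s : seq T) :
  (count (fun x => [exists i, a i x]) s <= \sum_i count (a i) s)%N.
Proof.
elim: s => [//|x s IH] /=.
rewrite big_split /= leq_add //; case: existsP => // -[i ai].
by rewrite (bigD1 i) //= ai.
Qed.

Lemma alternations_le_sum (b b1 b2 : nat -> bool) K :
  (forall i j, b i != b j -> (b1 i != b1 j) || (b2 i != b2 j)) ->
  (alternations b K <= alternations b1 K + alternations b2 K)%N.
Proof. by move=> b12; apply: count_le_predU => i; exact: b12. Qed.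

(* Each visited point outside [V] that follows a visited point of [V] costs an
   alternation. *)
Lemma count_le_alternations_interleave (T : Type) (V : pred T) (v w : nat -> T) L :
  (forall k, ~~ V (w k)) ->
  (count (fun k => V (v k)) (iota 0 L)
    <= alternations (fun k => V (if odd k then w k./2 else v k./2)) L.*2)%N.
Proof.
move=> wV; rewrite /alternations; elim: L => [//|L IH].
rewrite doubleS -addn1 iotaD count_cat -[L.*2.+2]addn2 iotaD.
rewrite count_cat leq_add //= !add0n !addn0 odd_double /= doubleK uphalf_double.
by rewrite (negbTE (wV L)); case: (V (v L)).
Qed.

Section SignChanges.
Context {R : rcfType}.
Implicit Type p : {poly R}.

Lemma sgr_change_root p (s t : R) : s <= t -> Num.sg p.[s] != Num.sg p.[t] ->
  exists2 r, s <= r <= t & root p r.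
Proof.
move=> st; have [h _|h sg] := leP (p.[s] * p.[t]) 0.
  by have [r] := polyrcf.poly_ivt st h; rewrite in_itv /=; exists r.
case/eqP: sg; have := gtr0_sg h; rewrite sgrM.
by case: (sgrP p.[s]); case: (sgrP p.[t]) => //; rewrite ?mulr1 ?mul1r ?mulr0 ?mul0r => _ _ /eqP;
  rewrite ?eqNr ?oner_eq0 // eq_sym oner_eq0.
Qed.

Lemma count_root_le_size p (a : pred nat) (r : nat -> R) K : p != 0 ->
  (forall i, a i -> root p (r i)) ->
  (forall i j, a i -> a j -> (i < j)%N -> r i < r j) ->
  (count a (iota 0 K) <= size p)%N.
Proof.
move=> p0 rootr rlt; rewrite -size_filter -(size_map r).
apply/ltnW/max_poly_roots => //.
  by apply/allP => _ /mapP[i + ->]; rewrite mem_filter => /andP[/rootr].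
rewrite map_inj_in_uniq ?filter_uniq ?iota_uniq // => i j.
rewrite !mem_filter => /andP[ai _] /andP[aj _] rij.
by have [/(rlt _ _ ai aj)|/(rlt _ _ aj ai)|//] := ltngtP i j; rewrite rij ltxx.
Qed.

(* Sign changes at indices of equal parity come from roots in disjoint
   intervals. *)
Lemma count_sgr_changes p (v : nat -> R) K :
  {homo v : i j / (i < j)%N >-> i < j} ->
  (count (fun i => Num.sg p.[v i] != Num.sg p.[v i.+1]) (iota 0 K)
    <= (size p).*2)%N.
Proof.
move=> vhomo; have [->|p0] := eqVneq p 0.
  by rewrite (eq_count (a2 := pred0)) ?count_pred0 // => i; rewrite /= !horner0 eqxx.
set change := fun i : nat => _.
have /choice[r rP] : forall i, exists r, change i -> v i <= r <= v i.+1 /\ root p r.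
  move=> i; case: (boolP (change i)) => [ch|]; last by exists 0.
  have [|r ? ?] := sgr_change_root _ ch; last by exists r.
  by rewrite ltW // vhomo.
have parity (e : bool) :
    (count (fun i => change i && (odd i == e)) (iota 0 K) <= size p)%N.
  apply: (@count_root_le_size _ _ r) => // [i /andP[/rP[]//]|i j].
  move=> /andP[/rP[/andP[_ ri] _] /eqP oi] /andP[/rP[/andP[rj _] _] /eqP oj] ij.
  apply: le_lt_trans ri (lt_le_trans _ rj); apply: vhomo.
  rewrite ltn_neqAle ij andbT; apply/eqP => ij1.
  by move: oj; rewrite -ij1 /= oi; case: (e).
rewrite -addnn; apply: leq_trans (leq_add (parity true) (parity false)).
by apply: count_le_predU => i ci; rewrite ci /=; case: (odd i).
Qed.

End SignChanges.

Section Definable.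
Variable R : rcfType.
Implicit Types (env u : nat -> R) (e : seq R) (A B : (nat -> R) -> Prop).
Implicit Types (s t : (nat -> R) -> R).

Definition definable A : Prop :=
  exists phi : ord.formula R, forall e, ord.holds e phi <-> A (nth 0 e).

Definition definable_fun t : Prop :=
  exists T : GRing.term R, forall e, GRing.eval e T = t (nth 0 e).

Definition upd env (i : nat) (x : R) : nat -> R :=
  fun j => if j == i then x else env j.

Definition upd_block env (b q : nat) u : nat -> R :=
  fun j => if (b <= j < b + q)%N then u (j - b)%N else env j.

Lemma nth_set_nthE e i x : nth 0 (set_nth 0 e i x) = upd (nth 0 e) i x.
Proof. by apply/funext => j; rewrite nth_set_nth. Qed.

Lemma upd_blockS env b q u :
  upd_block env b q.+1 u = upd_block (upd env (b + q)%N (u q)) b q u.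
Proof.
apply/funext => j; rewrite /upd_block /upd addnS ltnS.
have [bj|jb] := leqP b j; rewrite /=; last first.
  by case: eqP => // jE; move: jb; rewrite jE ltnNge leq_addr.
rewrite leq_eqVlt.
by have [->|jb] := eqVneq j (b + q)%N; rewrite ?ltnn ?orbT //= addKn.
Qed.

Lemma eq_upd_block env b q u u' : (forall i, (i < q)%N -> u i = u' i) ->
  upd_block env b q u = upd_block env b q u'.
Proof.
move=> uu; apply/funext => j; rewrite /upd_block.
by case: ifP => // /andP[bj jb]; apply: uu; rewrite ltn_subLR.
Qed.

Lemma upd_block_lt env b q u i : (i < b)%N -> upd_block env b q u i = env i.
Proof. by move=> ib; rewrite /upd_block leqNgt ib. Qed.

Lemma upd_block_shift env b q u i : (i < q)%N ->
  upd_block env b q u (b + i)%N = u i.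
Proof. by move=> iq; rewrite /upd_block leq_addr ltn_add2l iq addKn. Qed.

Lemma definable_fun_var i : definable_fun (fun env => env i).
Proof. by exists (GRing.Var _ i). Qed.

Lemma definable_fun_nat k : definable_fun (fun _ => k%:R).
Proof. by exists (GRing.NatConst _ k). Qed.

Lemma definable_funD s t : definable_fun s -> definable_fun t ->
  definable_fun (fun env => s env + t env).
Proof. by move=> [S hS] [T hT]; exists (GRing.Add S T) => e /=; rewrite hS hT. Qed.

Lemma definable_funM s t : definable_fun s -> definable_fun t ->
  definable_fun (fun env => s env * t env).
Proof. by move=> [S hS] [T hT]; exists (GRing.Mul S T) => e /=; rewrite hS hT. Qed.

Lemma definable_funN s : definable_fun s -> definable_fun (fun env => - s env).
Proof. by move=> [S hS]; exists (GRing.Opp S) => e /=; rewrite hS. Qed.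

Lemma definable_funB s t : definable_fun s -> definable_fun t ->
  definable_fun (fun env => s env - t env).
Proof. by move=> hs ht; apply: definable_funD => //; apply: definable_funN. Qed.

Lemma definable_fun_sum (I : Type) (r : seq I) (t : I -> (nat -> R) -> R) :
  (forall i, definable_fun (t i)) ->
  definable_fun (fun env => \sum_(i <- r) t i env).
Proof.
move=> ht; elim: r => [|i r [T hT]].
  by exists (GRing.NatConst _ 0) => e; rewrite big_nil.
by have [S hS] := ht i; exists (GRing.Add S T) => e /=; rewrite hS hT big_cons.
Qed.

Lemma definable_ext A B : (forall env, A env <-> B env) ->
  definable A -> definable B.
Proof. by move=> AB [phi h]; exists phi => e; rewrite h AB. Qed.

Lemma definable_le s t : definable_fun s -> definable_fun t ->
  definable (fun env => s env <= t env).
Proof. by move=> [S hS] [T hT]; exists (ord.Le S T) => e /=; rewrite hS hT. Qed.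

Lemma definable_eq s t : definable_fun s -> definable_fun t ->
  definable (fun env => s env = t env).
Proof. by move=> [S hS] [T hT]; exists (ord.Equal S T) => e /=; rewrite hS hT. Qed.

Lemma definable_true : definable (fun=> True).
Proof. by exists (ord.Bool true). Qed.

Lemma definable_not A : definable A -> definable (fun env => ~ A env).
Proof. by move=> [S hS]; exists (ord.Not S) => e /=; rewrite hS. Qed.

Lemma definable_and A B : definable A -> definable B ->
  definable (fun env => A env /\ B env).
Proof. by move=> [S hS] [T hT]; exists (ord.And S T) => e /=; rewrite hS hT. Qed.

Lemma definable_imply A B : definable A -> definable B ->
  definable (fun env => A env -> B env).
Proof. by move=> [S hS] [T hT]; exists (ord.Implies S T) => e /=; rewrite hS hT. Qed.

Lemma definable_exists A i : definable A ->
  definable (fun env => exists x, A (upd env i x)).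
Proof.
move=> [S hS]; exists (ord.Exists i S) => e /=.
by split=> -[x hx]; exists x; move: hx; rewrite hS nth_set_nthE.
Qed.

Lemma definable_norm_le s t : definable_fun s -> definable_fun t ->
  definable (fun env => `|s env| <= t env).
Proof.
move=> hs ht.
apply: definable_ext (definable_and (definable_le (definable_funN ht) hs)
  (definable_le hs ht)) => env.
by rewrite ler_norml; split=> [[-> ->]|/andP[]].
Qed.

Lemma definable_forall (I : finType) (A : I -> (nat -> R) -> Prop) :
  (forall i, definable (A i)) -> definable (fun env => forall i, A i env).
Proof.
move=> hA.
have hseq (r : seq I) : definable (fun env => forall i, i \in r -> A i env).
  elim: r => [|i r IH]; first by apply: definable_ext definable_true.
  apply: definable_ext (definable_and (hA i) IH) => env; split=> [[Ai Ar] j|Ar].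
    by rewrite inE => /orP[/eqP->//|]; exact: Ar.
  by split=> [|j jr]; apply: Ar; rewrite inE ?eqxx // jr orbT.
apply: definable_ext (hseq (enum I)) => env.
by split=> AI i; [apply: AI; rewrite mem_enum|].
Qed.

Lemma definable_exists_block A b q : definable A ->
  definable (fun env => exists u, A (upd_block env b q u)).
Proof.
move=> hA; elim: q => [|q IH].
  apply: definable_ext hA => env; have E u : upd_block env b 0 u = env.
    apply/funext => j; rewrite /upd_block addn0.
    by case: ifP => // /andP[bj]; rewrite ltnNge bj.
  by split=> [h|[u]]; [exists (fun=> 0); rewrite E|rewrite E].
apply: definable_ext (definable_exists (b + q)%N IH) => env.
split=> [[x [u Au]]|[u Au]]; last by exists (u q), u; rewrite -upd_blockS.
exists (fun i => if i == q then x else u i); rewrite upd_blockS eqxx.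
rewrite (@eq_upd_block _ _ _ _ u) // => i iq.
by case: eqP => // iE; rewrite iE ltnn in iq.
Qed.

Lemma definable_forall_block A b q : definable A ->
  definable (fun env => forall u, A (upd_block env b q u)).
Proof.
move=> /definable_not/(definable_exists_block b q)/definable_not.
apply: definable_ext => env; split=> [nAu u|Au [u]]; last by apply.
by apply: contrapT => nA; apply: nAu; exists u.
Qed.

Definition bounded_alternations (b : seq R -> R -> bool) : Prop :=
  exists N, forall e (v : nat -> R) K, {homo v : i j / (i < j)%N >-> i < j} ->
    (alternations (fun i => b e (v i)) K <= N)%N.

Lemma bounded_alternations_combine (b b1 b2 : seq R -> R -> bool) :
  (forall e x y, b e x != b e y -> (b1 e x != b1 e y) || (b2 e x != b2 e y)) ->
  bounded_alternations b1 -> bounded_alternations b2 -> bounded_alternations b.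
Proof.
move=> b12 [N1 bN1] [N2 bN2]; exists (N1 + N2)%N => e v K vhomo.
apply: leq_trans (leq_add (bN1 e v K vhomo) (bN2 e v K vhomo)).
by apply: alternations_le_sum => i j; exact: b12.
Qed.

Lemma bounded_alternations_cst (c : bool) : bounded_alternations (fun _ _ => c).
Proof.
exists 0%N => e v K _; rewrite /alternations (eq_count (a2 := pred0)) ?count_pred0 //.
by move=> i /=; rewrite eqxx.
Qed.

Lemma bounded_alternations_atom (t1 t2 : GRing.term R) (op : R -> R -> bool) :
  (forall x y x' y', Num.sg (x - y) = Num.sg (x' - y') -> op x y = op x' y') ->
  GRing.rterm t1 -> GRing.rterm t2 ->
  bounded_alternations (fun e x => op (GRing.eval (set_nth 0 e 0%N x) t1)
                                      (GRing.eval (set_nth 0 e 0%N x) t2)).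
Proof.
move=> op_sg rt1 rt2; pose t := GRing.Add t1 (GRing.Opp t2).
have rt : GRing.rterm t by rewrite /= rt1.
pose p := qe_rcf.abstrX 0%N (qe_rcf.to_rterm t).
exists (size p).*2 => e v K vhomo.
have evalE x : GRing.eval (set_nth 0 e 0%N x) t1 - GRing.eval (set_nth 0 e 0%N x) t2
    = (qe_rcf.eval_poly e p).[x].
  by rewrite qe_rcf.abstrXP qe_rcf.evalE qe_rcf.to_rtermE.
have size_p : (size (qe_rcf.eval_poly e p) <= size p)%N.
  by rewrite qe_rcf.eval_polyP (leq_trans (size_Poly _)) // size_map.
apply: leq_trans (_ : (size (qe_rcf.eval_poly e p)).*2 <= _)%N; last by rewrite leq_double.
apply: leq_trans (count_sgr_changes (qe_rcf.eval_poly e p) K vhomo).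
by apply: sub_count => i; apply: contraNneq => sgE; apply/eqP/op_sg; rewrite !evalE.
Qed.

Lemma bounded_alternations_qf_eval (phi : ord.formula R) :
  ord.qf_form phi && ord.rformula phi ->
  bounded_alternations (fun e x => ord.qf_eval (set_nth 0 e 0%N x) phi).
Proof.
elim: phi => //=.
- by move=> b _; exact: bounded_alternations_cst.
- move=> t1 t2 /andP[rt1 rt2].
  apply: (bounded_alternations_atom (op := fun x y => x == y)) => // x y x' y' sgE.
  by rewrite -subr_eq0 -[RHS]subr_eq0 -sgr_eq0 sgE sgr_eq0.
- move=> t1 t2 /andP[rt1 rt2].
  apply: (bounded_alternations_atom (op := <%R)) => // x y x' y' sgE.
  by rewrite -subr_lt0 -[RHS]subr_lt0 -sgr_lt0 sgE sgr_lt0.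
- move=> t1 t2 /andP[rt1 rt2].
  apply: (bounded_alternations_atom (op := <=%R)) => // x y x' y' sgE.
  by rewrite -subr_le0 -[RHS]subr_le0 -sgr_le0 sgE sgr_le0.
4: move=> f IH /IH bf.
4: by apply: (bounded_alternations_combine _ bf bf) => e x y; do !case: (ord.qf_eval _ _).
all: move=> f1 IH1 f2 IH2; rewrite andbACA => /andP[/IH1 b1 /IH2 b2].
all: by apply: bounded_alternations_combine b1 b2 => e x y; do !case: (ord.qf_eval _ _).
Qed.

(* Quantifier elimination makes the bound uniform in the parameters [e]. *)
Lemma definable_bounded_alternations A : definable A ->
  bounded_alternations (fun e x => `[< A (upd (nth 0 e) 0 x) >]).
Proof.
move=> [phi phiP].
pose psi := ord.quantifier_elim
  (fun i cl => qe_rcf.qfr_to_formula (@qe_rcf.wproj R i cl)) (ord.to_rform phi).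
have psi_wf := ord.quantifier_elim_wf (@qe_rcf.wf_QE_wproj R)
  (ord.to_rform_rformula phi).
have [N bN] := bounded_alternations_qf_eval psi_wf.
exists N => e v K vhomo; apply: leq_trans (bN e v K vhomo).
suff AE x : `[< A (upd (nth 0 e) 0 x) >] = ord.qf_eval (set_nth 0 e 0%N x) psi.
  by rewrite (eq_leq (eq_count _ _)) // => i; rewrite !AE.
by rewrite -nth_set_nthE; apply/asboolP/idP => [/phiP/qe_rcf.rcf_satP|/qe_rcf.rcf_satP/phiP].
Qed.

End Definable.

(** * Near critical values of polynomials *)

Section Lexicographic.
Context {R : realType} (q : nat).
Implicit Types (u : nat -> R) (A : set 'rV[R]_q) (x y : 'rV[R]_q).

Definition lexle u u' : Prop :=
  forall i : 'I_q, (forall k : 'I_q, (k < i)%N -> u k = u' k) -> u i <= u' i.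

Definition lexmin (Q : (nat -> R) -> Prop) u : Prop :=
  Q u /\ forall u', Q u' -> lexle u u'.

Lemma lexle_anti u u' : lexle u u' -> lexle u' u -> forall i : 'I_q, u i = u' i.
Proof.
move=> uu' u'u; suff agree n (i : 'I_q) : (i < n)%N -> u i = u' i.
  by move=> i; exact: (agree i.+1).
elim: n i => // n IH i; rewrite ltnS => ni; apply/eqP.
rewrite eq_le uu' ?u'u // => k ki; last by apply: IH; exact: leq_trans ki ni.
by apply/esym/IH; exact: leq_trans ki ni.
Qed.

Definition row_fun x (i : nat) : R := if insub i is Some k then x 0 k else 0.

Lemma row_funE x (i : 'I_q) : row_fun x i = x 0 i.
Proof. by rewrite /row_fun valK. Qed.

Lemma row_fun_row u (i : nat) : (i < q)%N -> row_fun (\row_k u k) i = u i.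
Proof. by move=> iq; rewrite /row_fun insubT /= mxE. Qed.

Lemma continuous_row_fun i : continuous (fun x : 'rV[R]_q => row_fun x i).
Proof.
rewrite /row_fun; case: insub => [k|]; last exact: cst_continuous.
exact: coord_continuous.
Qed.

Fixpoint lexmin_stage A (k : nat) : set 'rV[R]_q :=
  if k is k'.+1 then
    [set x | lexmin_stage A k' x /\
             forall y, lexmin_stage A k' y -> row_fun x k' <= row_fun y k']
  else A.

Lemma lexmin_stage_compact A k : compact A -> A !=set0 ->
  compact (lexmin_stage A k) /\ lexmin_stage A k !=set0.
Proof.
move=> cA A0; elim: k => [//|k [cAk Ak0]].
have cont := @continuous_row_fun k.
have [c /set_mem Akc cmin] := EVT_min_rV Ak0 cAk (continuous_subspaceT cont).
have -> : lexmin_stage A k.+1 =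
    lexmin_stage A k `&` [set x | row_fun x k <= row_fun c k].
  apply/seteqP; split=> x [Akx xmin]; split=> //; first exact: xmin.
  by move=> y Aky; apply: le_trans xmin (cmin _ (mem_set Aky)).
split; last by exists c; split=> /=.
by apply: compact_closedI => //; apply: closed_le_continuous => //; exact: cst_continuous.
Qed.

Lemma lexmin_exists (Q : (nat -> R) -> Prop) :
  (forall u u', (forall i, (i < q)%N -> u i = u' i) -> Q u -> Q u') ->
  compact [set x | Q (row_fun x)] -> (exists u, Q u) -> exists u, lexmin Q u.
Proof.
move=> Qext cQ [u0 Qu0]; pose A := [set x : 'rV[R]_q | Q (row_fun x)].
have Arow u : Q u -> A (\row_i u i).
  by apply: Qext => i iq; rewrite row_fun_row.
have A0 : A !=set0 by exists (\row_i u0 i); exact: Arow.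
have [_ [x xmin]] := lexmin_stage_compact q cQ A0.
have stageW j k y : (j <= k)%N -> lexmin_stage A k y -> lexmin_stage A j y.
  by move=> /subnK <-; elim: (k - j)%N => // n IH [/IH].
exists (row_fun x); split=> [|u' Qu' i agree]; first exact: (stageW 0 q x).
have stage_u' j : (j <= i)%N -> lexmin_stage A j (\row_i u' i).
  elim: j => [_|j IH ji]; first exact: Arow.
  have jq : (j < q)%N by exact: ltn_trans ji (ltn_ord i).
  split=> [|y Ajy]; first exact/IH/ltnW.
  rewrite row_fun_row // -(agree (Ordinal jq)) //.
  by have [_] := stageW j.+1 q x jq xmin; apply.
have [_ /(_ _ (stage_u' i (leqnn i)))] := stageW i.+1 q x (ltn_ord i) xmin.
by rewrite row_fun_row.
Qed.

End Lexicographic.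

Lemma grid_separation (R : realType) (lo hi a b : R) (M : nat) : (0 < M)%N ->
  lo <= a <= hi -> lo <= b <= hi ->
  (forall k, (k <= M)%N -> (a <= subdivision lo hi M k) = (b <= subdivision lo hi M k)) ->
  `|a - b| <= (hi - lo) / M%:R.
Proof.
move=> M0; wlog ab : a b / a <= b => [wlog_le|].
  move=> ahi bhi same; have [ab|/ltW ba] := leP a b; first exact: wlog_le.
  by rewrite distrC; apply: wlog_le => // k kM; rewrite same.
move=> /andP[la ah] /andP[lb bh] same.
pose y := subdivision lo hi M; have yM : y M = hi by exact: subdivision_last.
have some_k : exists k, a <= y k by exists M; rewrite yM.
case: (ex_minnP some_k) => k ak kmin.
have kM : (k <= M)%N by apply: kmin; rewrite yM.
have bk : b <= y k by rewrite -same.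
rewrite distrC ger0_norm ?subr_ge0 //; case: k ak kmin kM bk => [|k] ak kmin kM bk.
  have -> : b = a.
    by apply/eqP; rewrite eq_le ab andbT (le_trans bk) // /y subdivision0.
  by rewrite subrr divr_ge0 // subr_ge0 (le_trans la).
have yk : y k < a by rewrite ltNge; apply/negP => /kmin; rewrite ltnn.
have -> : (hi - lo) / M%:R = y k.+1 - y k by rewrite /y subdivisionS [RHS]addrC addKr.
by apply: lerB => //; apply: ltW.
Qed.

Section DefinableFamilies.
Context {R : realType} (q B : nat).
Implicit Types (env u p v : nat -> R).

Definition drop_env (b : nat) env : nat -> R := fun i => env (b + i)%N.

Lemma definable_lexle b b' :
  definable (fun env => lexle q (drop_env b env) (drop_env b' env)).
Proof.
apply: definable_forall => i; apply: definable_imply; last first.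
  by apply: definable_le; exact: definable_fun_var.
apply: definable_forall => k; case: (boolP (k < i)%N) => ki.
  apply: definable_ext (definable_eq (definable_fun_var R (b + k))
    (definable_fun_var R (b' + k))) => env.
  by split=> [agree _ //|]; apply.
by apply: definable_ext (definable_true R).
Qed.

(* A family of subsets of R^q, definable uniformly in parameters stored below
   the index B. *)
Record definable_family (A : (nat -> R) -> (nat -> R) -> Prop) : Prop :=
  DefinableFamily {
    definable_slice : forall b, definable (fun env => A env (drop_env b env));
    definable_family_ext : forall env env' u u',
      (forall i, (i < B)%N -> env i = env' i) ->
      (forall i, (i < q)%N -> u i = u' i) -> A env u -> A env' u' }.

Variable A : (nat -> R) -> (nat -> R) -> Prop.
Hypothesis dA : definable_family A.

Lemma definable_family_upd_block env b k u u' : (B <= b)%N ->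
  A (upd_block env b k u) u' <-> A env u'.
Proof.
by move=> Bb; split; apply: (definable_family_ext dA) => // i iB;
  rewrite upd_block_lt // (leq_trans iB).
Qed.

Lemma eq_lexmin env env' u : (forall i, (i < B)%N -> env i = env' i) ->
  lexmin q (A env) u -> lexmin q (A env') u.
Proof.
move=> ee' [Au umin]; split=> [|u' Au']; first exact: (definable_family_ext dA) ee' _ Au.
by apply: umin; apply: (definable_family_ext dA) Au' => // i iB; rewrite ee'.
Qed.

Lemma definable_family_nonempty : definable (fun env => exists u, A env u).
Proof.
apply: definable_ext (definable_exists_block B q (definable_slice dA B)) => env.
split=> -[u Au]; exists u; first apply/(definable_family_upd_block env q u u (leqnn B)).
  by apply: (definable_family_ext dA) Au => // i iq; rewrite /drop_env upd_block_shift.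
apply/(definable_family_upd_block _ _ _ _ (leqnn B)).
by apply: (definable_family_ext dA) Au => // i iq; rewrite /drop_env upd_block_shift.
Qed.

Lemma definable_lexmin b : (B <= b)%N ->
  definable (fun env => lexmin q (A env) (drop_env b env)).
Proof.
move=> Bb; apply: definable_and; first exact: definable_slice.
apply: definable_ext (definable_forall_block (b + q) q (definable_imply
  (definable_slice dA (b + q)) (definable_lexle b (b + q)))) => env.
have Bbq : (B <= b + q)%N by rewrite (leq_trans Bb) ?leq_addr.
have low u (i : 'I_q) : drop_env b (upd_block env (b + q) q u) i = drop_env b env i.
  by rewrite /drop_env upd_block_lt // ltn_add2l.
have high u i : (i < q)%N -> drop_env (b + q) (upd_block env (b + q) q u) i = u i.
  by move=> iq; rewrite /drop_env upd_block_shift.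
have AE u : A (upd_block env (b + q) q u) (drop_env (b + q) (upd_block env (b + q) q u)) <->
    A env u.
  rewrite definable_family_upd_block //.
  by split; apply: (definable_family_ext dA) => // i iq; rewrite high.
have lexleE u : lexle q (drop_env b (upd_block env (b + q) q u))
    (drop_env (b + q) (upd_block env (b + q) q u)) <-> lexle q (drop_env b env) u.
  split=> le_u i agree; last first.
    by rewrite low high //; apply: le_u => k ki; have := agree k ki; rewrite low high.
  by have := le_u i; rewrite low high //; apply=> k ki; rewrite low high // agree.
by split=> umin u Au; [apply/lexleE/umin/AE|apply/lexleE/umin/AE].
Qed.

Lemma definable_lexmin_le (c : 'I_q) :
  definable (fun env => exists u, lexmin q (A env) u /\ u c <= env B).
Proof.
apply: definable_ext (definable_exists_block B.+1 q (definable_and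
  (definable_lexmin (leqnSn B)) (definable_le (definable_fun_var R (B.+1 + c))
  (definable_fun_var R B)))) => env.
have shift u i : (i < q)%N -> drop_env B.+1 (upd_block env B.+1 q u) i = u i.
  by move=> iq; rewrite /drop_env upd_block_shift.
have lexminE u : lexmin q (A (upd_block env B.+1 q u))
    (drop_env B.+1 (upd_block env B.+1 q u)) <-> lexmin q (A env) u.
  split=> -[Au umin]; split.
  - by apply: (definable_family_ext dA) Au => i iB; rewrite ?shift // upd_block_lt // ltnW.
  - move=> u' Au' i agree; have := umin u'; rewrite definable_family_upd_block //.
    by move=> /(_ Au' i); rewrite shift //; apply=> k ki; rewrite shift // agree.
  - by apply: (definable_family_ext dA) Au => i iB; rewrite ?shift // upd_block_lt // ltnW.
  move=> u' /(definable_family_upd_block _ _ _ _ (leqnSn B)) Au' i agree.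
  by rewrite shift //; apply: umin => // k ki; rewrite -agree // shift.
split=> -[u [umin uc]]; exists u; last first.
  by rewrite upd_block_shift // upd_block_lt //; split=> //; apply/lexminE.
by move: uc; rewrite upd_block_shift // upd_block_lt //; split=> //; apply/lexminE.
Qed.

Hypothesis B_gt0 : (0 < B)%N.

Lemma nonempty_alternations : exists N, forall p v K,
  {homo v : i j / (i < j)%N >-> i < j} ->
  (alternations (fun k => `[< exists u, A (upd p 0 (v k)) u >]) K <= N)%N.
Proof.
have [N bN] := definable_bounded_alternations definable_family_nonempty.
exists N => p v K vhomo; apply: leq_trans (bN (mkseq p B) v K vhomo).
have sameE t : `[< exists u, A (upd p 0 t) u >] =
    `[< exists u, A (upd (nth 0 (mkseq p B)) 0 t) u >].
  apply/asboolP/asboolP => -[u Au]; exists u;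
  by apply: (definable_family_ext dA) Au => // i iB; rewrite /upd nth_mkseq.
by rewrite (eq_leq (eq_count _ _)) // => k; rewrite !sameE.
Qed.

Lemma lexmin_alternations : exists N, forall p (c : 'I_q) (y : R) v K,
  {homo v : i j / (i < j)%N >-> i < j} ->
  (alternations (fun k =>
     `[< exists u, lexmin q (A (upd p 0 (v k))) u /\ (u c <= y)%R >]) K <= N)%N.
Proof.
have /choice[N bN] := fun c => definable_bounded_alternations (definable_lexmin_le c).
exists (\sum_c N c)%N => p c y v K vhomo.
apply: leq_trans (_ : N c <= _)%N; last by rewrite (bigD1 c) //= leq_addr.
apply: leq_trans (bN c (rcons (mkseq p B) y) v K vhomo).
have updB t : upd (nth 0 (rcons (mkseq p B) y)) 0 t B = y.
  by rewrite /upd gtn_eqF // nth_rcons size_mkseq ltnn eqxx.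
have updE t i : (i < B)%N -> upd p 0 t i = upd (nth 0 (rcons (mkseq p B) y)) 0 t i.
  by move=> iB; rewrite /upd nth_rcons size_mkseq iB nth_mkseq.
have sameE t : `[< exists u, lexmin q (A (upd p 0 t)) u /\ u c <= y >] =
    `[< exists u, lexmin q (A (upd (nth 0 (rcons (mkseq p B) y)) 0 t)) u /\
        u c <= upd (nth 0 (rcons (mkseq p B) y)) 0 t B >].
  rewrite updB; apply/asboolP/asboolP => -[u [umin uc]]; exists u; split=> //.
    by apply: eq_lexmin umin; exact: updE.
  by apply: eq_lexmin umin => i iB; rewrite updE.
by rewrite (eq_leq (eq_count _ _)) // => k; rewrite !sameE.
Qed.

(* Pigeonhole: the thresholds of an M-fold subdivision of [lo, hi] are crossed
   by the lexicographically minimal selection a bounded number of times. *)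
Lemma definable_family_slow : exists N, forall p (lo hi : nat -> R) v K M,
  (0 < M)%N -> {homo v : i j / (i < j)%N >-> i < j} -> (q * M.+1 * N < K)%N ->
  (forall k, (k <= K)%N -> exists u, lexmin q (A (upd p 0 (v k))) u) ->
  (forall k u, A (upd p 0 (v k)) u ->
    forall c, (c < q)%N -> lo c <= u c <= hi c) ->
  exists k u u', [/\ (k < K)%N, A (upd p 0 (v k)) u, A (upd p 0 (v k.+1)) u' &
    forall c, (c < q)%N -> `|u' c - u c| <= (hi c - lo c) / M%:R].
Proof.
have [N bN] := lexmin_alternations; exists N => p lo hi v K M M0 vhomo KN umin_ex box.
have /choice[u uP] : forall k, exists u, (k <= K)%N -> lexmin q (A (upd p 0 (v k))) u.
  move=> k; have [/umin_ex[u]|] := leqP k K; first by exists u.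
  by exists (fun=> 0).
pose y (c : 'I_q) (k : 'I_M.+1) : R := subdivision (lo c) (hi c) M k.
pose below (ck : 'I_q * 'I_M.+1) k :=
  `[< exists u, lexmin q (A (upd p 0 (v k))) u /\ u ck.1 <= y ck.1 ck.2 >].
have belowE ck k : (k <= K)%N -> below ck k = (u k ck.1 <= y ck.1 ck.2).
  move=> kK; apply/asboolP/idP => [[w [[Aw wmin]]]|uy]; last by exists (u k); split=> //; exact: uP.
  have [Auk ukmin] := uP k kK.
  by rewrite (lexle_anti (wmin _ Auk) (ukmin _ Aw)).
have [k kK same] : exists2 k, (k < K)%N & forall ck, below ck k = below ck k.+1.
  have : (count (fun k => [exists ck, below ck k != below ck k.+1]) (iota 0 K) < K)%N.
    apply: leq_ltn_trans (count_exists_le _ _) _; apply: leq_ltn_trans KN.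
    apply: leq_trans (_ : \sum_(ck : 'I_q * 'I_M.+1) N <= _)%N.
      by apply: leq_sum => -[c k] _; exact: (bN p c (y c k) v K vhomo).
    by rewrite sum_nat_const card_prod !card_ord.
  rewrite -[X in (_ < X)%N](size_iota 0 K) ltn_neqAle -all_count => /andP[+ _].
  rewrite -has_predC => /hasP[k]; rewrite mem_iota add0n /= => kK.
  by rewrite negb_exists => /forallP no; exists k => // ck; apply/eqP; rewrite -[_ == _]negbK.
have [Auk _] := uP k (ltnW kK); have [Auk1 _] := uP k.+1 kK.
exists k, (u k), (u k.+1); split=> // c cq; rewrite distrC.
apply: grid_separation => // [||i iM]; [exact: box Auk _ cq|exact: box Auk1 _ cq|].
have := same (Ordinal cq, Ordinal (iM : (i < M.+1)%N)).
by rewrite !belowE // ltnW.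
Qed.

End DefinableFamilies.

Definition convex_weights (R : numDomainType) (J : finType) (l : J -> R) : Prop :=
  (forall j, 0 <= l j) /\ \sum_j l j = 1.

Lemma convex_weights_le1 (R : numDomainType) (J : finType) (l : J -> R) j :
  convex_weights l -> l j <= 1.
Proof. by move=> [l0 <-]; rewrite (bigD1 j) //= lerDl sumr_ge0. Qed.

Section NearCritical.
Context {R : realType} {m : nat} {J : finType} (S : {set J}).
Local Notation q := (m + #|J|)%N.
Implicit Types (P : J -> ('I_m -> R) -> R) (G : J -> 'I_m -> ('I_m -> R) -> R).
Implicit Types (z : 'I_m -> R) (l : J -> R) (u env : nat -> R).

(* The gradient G_j of P_j is kept separate, so that P and G may be truncated
   independently. *)
Definition near_crit (v eps delta : R) P G z l : Prop :=
  [/\ forall i, `|z i| <= eps, convex_weights l, forall j, j \notin S -> l j = 0 &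
  [/\ v = \sum_j l j * P j z, forall j, j \in S -> `|P j z - v| <= delta * eps &
      forall i, `|\sum_j l j * G j i z| <= delta]].

Definition quadratic_remainder (eps K : R) P G : Prop := forall j z z' a, 0 <= a ->
  (forall i, `|z i| <= eps) -> (forall i, `|z' i| <= eps) ->
  (forall i, `|z' i - z i| <= a) ->
  `|P j z' - P j z - \sum_i G j i z * (z' i - z i)| <= K * a ^+ 2.

(* The exact first order expansion of sum_j l_j P_j(z): near criticality of
   both ends makes each first order term small. *)
Lemma near_crit_increment (v v' eps delta K a b : R) P G z z' l l' :
  0 <= a -> 0 <= eps -> 0 <= delta -> quadratic_remainder eps K P G ->
  near_crit v eps delta P G z l -> near_crit v' eps delta P G z' l' ->
  (forall i, `|z' i - z i| <= a) -> (forall j, `|l' j - l j| <= b) ->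
  v' - v <= m%:R * (delta * a) + K * a ^+ 2 + #|J|%:R * (b * (delta * eps)).
Proof.
move=> a0 e0 d0 rem [zeps [l0 l1] lS [vE Pv Gd]] [zeps' [l0' l1'] lS' [vE' Pv' _]] dz dl.
have -> : v' - v = \sum_j l j * (P j z' - P j z) + \sum_j (l' j - l j) * (P j z' - v').
  have -> : \sum_j (l' j - l j) * (P j z' - v') = \sum_j (l' j - l j) * P j z'.
    under eq_bigr do rewrite mulrBr; rewrite sumrB -[X in _ - X]mulr_suml sumrB.
    by rewrite l1 l1' subrr mul0r subr0.
  by rewrite -big_split /= {1}vE {1}vE' -sumrB; apply: eq_bigr => j _; ring.
apply: lerD.
  have -> : K * a ^+ 2 = \sum_j l j * (K * a ^+ 2) by rewrite -mulr_suml l1 mul1r.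
  apply: (@le_trans _ _ (\sum_j (l j * (\sum_i G j i z * (z' i - z i)) + l j * (K * a ^+ 2)))).
    apply: ler_sum => j _; rewrite -mulrDr ler_wpM2l // -lerBlDl.
    exact: le_trans (ler_norm _) (rem j z z' a a0 zeps zeps' dz).
  rewrite big_split /= lerD2r; under eq_bigr do rewrite mulr_sumr.
  rewrite exchange_big /= mulr_natl -[X in _ *+ X]card_ord -sumr_const.
  apply: ler_sum => i _; under eq_bigr do rewrite mulrA; rewrite -mulr_suml.
  by rewrite (le_trans (ler_norm _)) // normrM ler_pM.
rewrite mulr_natl -sumr_const; apply: ler_sum => j _.
have [jS|jS] := boolP (j \in S); last first.
  have b0 := le_trans (normr_ge0 _) (dl j).
  by rewrite lS // lS' // subrr mul0r !mulr_ge0.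
by rewrite (le_trans (ler_norm _)) // normrM ler_pM // Pv'.
Qed.

Definition code_z u : 'I_m -> R := fun i => u i.
Definition code_weights u : J -> R := fun j => u (m + enum_rank j)%N.
Definition near_crit_code v eps delta P G u :=
  near_crit v eps delta P G (code_z u) (code_weights u).

Lemma near_crit_encode v eps delta P G z l : near_crit v eps delta P G z l ->
  exists u, near_crit_code v eps delta P G u.
Proof.
pose w : 'rV[R]_q := \row_(k < q)
  match fintype.split k with inl i => z i | inr j => l (enum_val j) end.
have zE : code_z (row_fun w) = z.
  apply/funext => i; rewrite /code_z -[nat_of_ord i]/(nat_of_ord (lshift #|J| i)).
  by rewrite row_funE mxE (unsplitK (inl i)).
have lE : code_weights (row_fun w) = l.
  apply/funext => j; rewrite /code_weights.
  rewrite -[(m + enum_rank j)%N]/(nat_of_ord (rshift m (enum_rank j))).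
  by rewrite row_funE mxE (unsplitK (inr (enum_rank j))) enum_rankK.
by exists (row_fun w); rewrite /near_crit_code zE lE.
Qed.

Lemma near_crit_code_ext v eps delta P G u u' :
  (forall i, (i < q)%N -> u i = u' i) ->
  near_crit_code v eps delta P G u -> near_crit_code v eps delta P G u'.
Proof.
move=> uu; rewrite /near_crit_code.
have -> : code_z u = code_z u'.
  by apply/funext => i; apply: uu; rewrite (leq_trans (ltn_ord i)) ?leq_addr.
have -> // : code_weights u = code_weights u'.
by apply/funext => j; apply: uu; rewrite ltn_add2l.
Qed.

Lemma near_crit_code_bounds v eps delta P G u : near_crit_code v eps delta P G u ->
  forall i, (i < q)%N ->
    (if (i < m)%N then - eps else 0) <= u i <= (if (i < m)%N then eps else 1).
Proof.
move=> [zeps lw _ _] i iq; case: ifP => im.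
  by rewrite -ler_norml; exact: zeps (Ordinal im).
have mi : (m <= i)%N by rewrite leqNgt im.
have jJ : (i - m < #|J|)%N by rewrite ltn_subLR.
have -> : u i = code_weights u (enum_val (Ordinal jJ)).
  by rewrite /code_weights enum_valK /= subnKC.
by rewrite (convex_weights_le1 _ lw) andbT; case: lw.
Qed.

Lemma closed_near_crit v eps delta (cP : J -> seq 'I_m -> R)
    (cG : J -> 'I_m -> seq 'I_m -> R) d :
  closed [set x : 'rV[R]_q | near_crit_code v eps delta (fun j => peval d (cP j))
                                (fun j i => peval d (cG j i)) (row_fun x)].
Proof.
pose P j := peval d (cP j); pose G j i := peval d (cG j i).
have cz i : continuous (fun x : 'rV[R]_q => code_z (row_fun x) i).
  exact: continuous_row_fun.
have cl j : continuous (fun x : 'rV[R]_q => code_weights (row_fun x) j).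
  exact: continuous_row_fun.
have cPz j : continuous (fun x : 'rV[R]_q => P j (code_z (row_fun x))).
  exact: continuous_peval.
have ccst (c : R) : continuous (fun _ : 'rV[R]_q => c) by exact: cst_continuous.
have csum (F : J -> ('I_m -> R) -> R) :
    (forall j, continuous (fun x : 'rV[R]_q => F j (code_z (row_fun x)))) ->
    continuous (fun x : 'rV[R]_q => \sum_j code_weights (row_fun x) j * F j (code_z (row_fun x))).
  by move=> cF; apply: continuous_sum => j; apply: continuous_mul; [exact: cl|exact: cF].
have cnorm (f : 'rV[R]_q -> R) : continuous f -> continuous (fun x => `|f x|).
  by move=> cf x; exact: cvg_norm (cf x).
have cG0 i : continuous (fun x : 'rV[R]_q =>
    \sum_j code_weights (row_fun x) j * G j i (code_z (row_fun x))).
  by apply: (csum (fun j => G j i)) => j; exact: continuous_peval.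
pose closed_conditions : seq (set 'rV[R]_q) := [::
  [set x | forall i, `|code_z (row_fun x) i| <= eps];
  [set x | forall j, 0 <= code_weights (row_fun x) j];
  [set x | \sum_j code_weights (row_fun x) j = 1];
  [set x | forall j, j \notin S -> code_weights (row_fun x) j = 0];
  [set x | v = \sum_j code_weights (row_fun x) j * P j (code_z (row_fun x))];
  [set x | forall j, j \in S -> `|P j (code_z (row_fun x)) - v| <= delta * eps];
  [set x | forall i, `|\sum_j code_weights (row_fun x) j * G j i (code_z (row_fun x))| <= delta]].
have nearE : [set x | near_crit_code v eps delta P G (row_fun x)] =
    \big[setI/setT]_(A <- closed_conditions) A.
  rewrite !big_cons big_nil setIT; apply/seteqP; split=> x.
    by move=> [? [? ?] ? []].
  by move=> [? [? [? [? [? [? ?]]]]]].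
rewrite -[X in closed X]/[set x | near_crit_code v eps delta P G (row_fun x)] nearE.
rewrite !big_cons big_nil setIT; do ?apply: closedI; do ?apply: closed_forall => ?.
- by apply: closed_le_continuous => //; exact: cnorm.
- exact: closed_le_continuous.
- by apply: closed_eq_continuous => //; exact: continuous_sum.
- exact: closed_eq_continuous.
- by apply: closed_eq_continuous => //; exact: csum.
- apply: closed_le_continuous => //; apply: cnorm; exact: continuous_sub.
by apply: closed_le_continuous => //; exact: cnorm.
Qed.

Lemma compact_near_crit v eps delta (cP : J -> seq 'I_m -> R)
    (cG : J -> 'I_m -> seq 'I_m -> R) d :
  compact [set x : 'rV[R]_q | near_crit_code v eps delta (fun j => peval d (cP j))
                                (fun j i => peval d (cG j i)) (row_fun x)].
Proof.
apply: (subclosed_compact _ (@compact_norm_le R q (`|eps| + 1))).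
  exact: closed_near_crit.
move=> x /near_crit_code_bounds bnd; apply/rV_norm_leP => [|i]; first by rewrite addr_ge0.
have := bnd i (ltn_ord i); rewrite row_funE ler_norml.
by case: ifP => _ /andP[]; have := ler_norm eps; have := normr_ge0 eps; lra.
Qed.

End NearCritical.

Arguments code_weights {R} m {J} u j.

Lemma words_bounded (T : finType) (F : seq T -> nat) k :
  exists N, forall w, (size w <= k)%N -> (F w < N)%N.
Proof.
elim: k F => [|k IH] F; first by exists (F [::]).+1 => -[|x w].
have /choice[N FN] : forall x, exists N, forall w, (size w <= k)%N -> (F (x :: w) < N)%N.
  by move=> x; apply: IH.
exists (F [::] + \sum_x N x).+1 => -[|x w] /=; first by rewrite ltnS leq_addr.
move=> kw; rewrite ltnS (leq_trans (ltnW (FN x w kw))) //.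
by rewrite (bigD1 x) //= addnCA leq_addr.
Qed.

Section NearCriticalFamily.
Context {R : realType} {m : nat} {J : finType} (S : {set J}) (d : nat).
Local Notation q := (m + #|J|)%N.
Local Notation nc v eps delta cP cG := (near_crit_code S v eps delta
  (fun j : J => peval d (cP j)) (fun (j : J) (i : 'I_m) => peval d (cG j i))).
Implicit Types (env u : nat -> R).
Implicit Types (cP : J -> seq 'I_m -> R) (cG : J -> 'I_m -> seq 'I_m -> R).

(* The environment stores v, eps and delta at the indices 0, 1 and 2, followed
   by the coefficients of the polynomials. *)
Let index : countType := ((J + J * 'I_m) * seq 'I_m)%type.
Let code (k : index) : nat := (3 + pickle k)%N.

Definition coded_P env (j : J) (w : seq 'I_m) : R := env (code (inl j, w)).
Definition coded_G env (j : J) (i : 'I_m) (w : seq 'I_m) : R := env (code (inr (j, i), w)).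

Definition coded_near_crit env u : Prop :=
  nc (env 0%N) (env 1%N) (env 2%N) (coded_P env) (coded_G env) u.

Definition coefficient_env eps delta cP cG (k : nat) : R :=
  if k is k'.+3 then
    match unpickle k' : option index with
    | Some (inl j, w) => cP j w
    | Some (inr (j, i), w) => cG j i w
    | None => 0
    end
  else nth 0 [:: 0; eps; delta] k.

Lemma coded_near_critE eps delta cP cG v :
  coded_near_crit (upd (coefficient_env eps delta cP cG) 0 v) = nc v eps delta cP cG.
Proof.
have env_code k : upd (coefficient_env eps delta cP cG) 0 v (code k) =
    match k with (inl j, w) => cP j w | (inr (j, i), w) => cG j i w end.
  by rewrite /upd /code /= pickleK.
have PE : coded_P (upd (coefficient_env eps delta cP cG) 0 v) = cP.
  by apply/funext => j; apply/funext => w; rewrite /coded_P env_code.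
have GE : coded_G (upd (coefficient_env eps delta cP cG) 0 v) = cG.
  by apply/funext => j; apply/funext => i; apply/funext => w; rewrite /coded_G env_code.
by apply/funext => u; rewrite /coded_near_crit PE GE.
Qed.

Lemma definable_peval k (c : seq 'I_m -> nat) (b : nat) :
  definable_fun (fun env => peval k (fun w => env (c w)) (code_z (drop_env b env))).
Proof.
elim: k c => [|k IH] c.
  by apply: definable_funD (definable_fun_var R (c [::])) (definable_fun_nat R 0).
apply: definable_funD (definable_fun_var R (c [::])) (definable_fun_sum _ _) => l.
exact: definable_funM (definable_fun_var R (b + l)) (IH (fun w => c (l :: w))).
Qed.

Lemma definable_coded_near_crit b :
  definable (fun env => coded_near_crit env (drop_env b env)).
Proof.
have dweight (j : J) : definable_fun (fun env => code_weights m (drop_env b env) j).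
  exact: (definable_fun_var R (b + (m + enum_rank j))).
have d0 := definable_fun_nat R 0; have d1 := definable_fun_nat R 1.
have dv i := @definable_fun_var R i.
have dsum (c : J -> seq 'I_m -> nat) : definable_fun (fun env =>
    \sum_(j : J) code_weights m (drop_env b env) j *
      peval d (fun w => env (c j w)) (code_z (drop_env b env))).
  apply: definable_fun_sum => j.
  exact: (definable_funM (dweight j) (definable_peval d (c j) b)).
have dz : definable (fun env => forall i : 'I_m, `|code_z (drop_env b env) i| <= env 1%N).
  apply: definable_forall => i; apply: definable_norm_le => //.
  exact: (definable_fun_var R (b + i)).
have dw : definable (fun env =>
    convex_weights (code_weights m (drop_env b env) : J -> R)).
  apply: definable_and; first by apply: definable_forall => j; exact: definable_le.
  by apply: definable_eq => //; exact: definable_fun_sum.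
have dS : definable (fun env => forall j : J, j \notin S ->
    code_weights m (drop_env b env) j = 0).
  apply: definable_forall => j; case: (boolP (j \in S)) => jS.
    by apply: definable_ext (definable_true R).
  by apply: definable_ext (definable_eq (dweight j) d0) => env; split=> [-> //|]; apply.
have dP : definable (fun env => forall j, j \in S ->
    `|peval d (coded_P env j) (code_z (drop_env b env)) - env 0%N|
      <= env 2%N * env 1%N).
  apply: definable_forall => j; case: (boolP (j \in S)) => jS; last first.
    by apply: definable_ext (definable_true R).
  apply: definable_ext (definable_norm_le (definable_funB
    (definable_peval d (fun w => code (inl j, w)) b) (dv 0%N))
    (definable_funM (dv 2%N) (dv 1%N))) => env; split=> [le_env _|]; [exact: le_env|exact].
have dG : definable (fun env => forall i : 'I_m, `|\sum_j code_weights m (drop_env b env) j *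
    peval d (coded_G env j i) (code_z (drop_env b env))| <= env 2%N).
  apply: definable_forall => i; apply: definable_norm_le => //.
  exact: (dsum (fun j w => code (inr (j, i), w))).
have dvE := definable_eq (dv 0%N) (dsum (fun j w => code (inl j, w))).
apply: definable_ext (definable_and dz (definable_and dw (definable_and dS
  (definable_and dvE (definable_and dP dG))))) => env.
by split=> [[? [? [? [? [? ?]]]]]|[? ? ? []]].
Qed.

Lemma coded_near_crit_family :
  exists2 B, (0 < B)%N & definable_family q B coded_near_crit.
Proof.
have /choice[N codeN] : forall f, exists N, forall w, (size w <= d)%N ->
  (code (f, w) < N)%N by move=> f; apply: words_bounded.
pose B := (3 + \sum_f N f)%N; exists B => //.
split=> [b|env env' u u' ee' uu' crit]; first exact: definable_coded_near_crit.
have lt3 i : (i < 3)%N -> env i = env' i.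
  by move=> i3; rewrite ee' // (leq_trans i3) ?leq_addr.
have codeB f w : (size w <= d)%N -> env (code (f, w)) = env' (code (f, w)).
  move=> wd; apply: ee'; rewrite /B (bigD1 f) //= addnCA.
  by rewrite (leq_trans (codeN f w wd)) // leq_addr.
have PE : (fun j => peval d (coded_P env j)) = (fun j => peval d (coded_P env' j)).
  by apply/funext => j; apply/funext => z; apply: eq_peval => w; exact: codeB.
have GE : (fun j i => peval d (coded_G env j i)) = (fun j i => peval d (coded_G env' j i)).
  apply/funext => j; apply/funext => i; apply/funext => z.
  by apply: eq_peval => w; exact: codeB.
by have := near_crit_code_ext uu' crit; rewrite /coded_near_crit PE GE !lt3.
Qed.

End NearCriticalFamily.

Arguments coded_near_crit {R} m {J} S d env u.

Lemma ler_of_natSinv (R : realType) (x y D : R) :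
  (forall n : nat, x <= y + D / n.+1%:R) -> x <= y.
Proof.
move=> xy; have [D0|D0] := leP D 0.
  by apply: le_trans (xy 0%N) _; rewrite gerDl divr1.
apply/ler_addgt0Pr => e e0.
have [n _ nD] := near_infty_natSinv_lt (PosNum (divr_gt0 e0 D0)).
apply: le_trans (xy n) _; rewrite lerD2l mulrC -ler_pdivlMr // ltW //.
exact: nD (leqnn n).
Qed.

Section Packing.
Context {R : realType} {m : nat} {J : finType} (S : {set J}) (d : nat).
Local Notation q := (m + #|J|)%N.
Local Notation near_crit_peval v eps delta cP cG := (near_crit S v eps delta
  (fun j : J => peval d (cP j)) (fun (j : J) (i : 'I_m) => peval d (cG j i))).
Local Notation remainder_peval eps K cP cG := (quadratic_remainder eps K
  (fun j : J => peval d (cP j)) (fun (j : J) (i : 'I_m) => peval d (cG j i))).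
Implicit Types (cP : J -> seq 'I_m -> R) (cG : J -> 'I_m -> seq 'I_m -> R).

Lemma near_crit_slow : exists N, forall cP cG (eps delta s t : R) M, (0 < M)%N -> s < t ->
  (forall v, s <= v <= t -> exists z l, near_crit_peval v eps delta cP cG z l) ->
  let n := (q * M.+1 * N).+1 in exists v z l z' l',
    [/\ near_crit_peval v eps delta cP cG z l,
        near_crit_peval (v + (t - s) / n%:R) eps delta cP cG z' l',
        forall i, `|z' i - z i| <= 2 * eps / M%:R & forall j, `|l' j - l j| <= M%:R^-1].
Proof.
have [B B0 dA] := @coded_near_crit_family R m J S d.
have [N slow] := definable_family_slow dA B0.
exists N => cP cG eps delta s t M M0 st crit n.
have vhomo := subdivision_lt (ltn0Sn _ : (0 < n)%N) st.
have [||k [u [u' []]]] := slow (coefficient_env eps delta cP cG)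
  (fun i => if (i < m)%N then - eps else 0) (fun i => if (i < m)%N then eps else 1)
  (subdivision s t n) n M M0 vhomo (leqnn n).
- move=> k kn; rewrite coded_near_critE.
  have [z [l zl]] := crit _ (subdivision_itv (ltn0Sn _) (ltW st) kn).
  apply: lexmin_exists (near_crit_encode zl); last exact: compact_near_crit.
  exact: near_crit_code_ext.
- by move=> k u; rewrite coded_near_critE; exact: near_crit_code_bounds.
rewrite !coded_near_critE subdivisionS => kn critk critk1 close.
exists (subdivision s t n k), (code_z u), (code_weights m u), (code_z u'), (code_weights m u').
split=> // [i|j].
  have := close i (leq_trans (ltn_ord i) (leq_addr _ _)).
  by rewrite ltn_ord opprK -mulr2n mulr_natl.
have := close (m + enum_rank j)%N; rewrite ltn_add2l ltn_ord ltnNge leq_addr /=.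
by rewrite subr0 mul1r; apply.
Qed.

Lemma near_crit_interval : exists2 C, 0 <= C & forall cP cG (eps delta K : R),
  0 <= eps -> 0 <= delta -> remainder_peval eps K cP cG -> forall s t, s <= t ->
  (forall v, s <= v <= t -> exists z l, near_crit_peval v eps delta cP cG z l) ->
  t - s <= C * (delta * eps).
Proof.
have [N slow] := near_crit_slow.
pose A : R := ((q * 2 * N).+1)%:R; exists (A * (m%:R * 2 + #|J|%:R)).
  by rewrite mulr_ge0 // addr_ge0 // mulr_ge0.
move=> cP cG eps delta K eps0 delta0 rem s t; rewrite le_eqVlt => /orP[/eqP -> _|st crit].
  by rewrite subrr !mulr_ge0 // addr_ge0 // mulr_ge0.
apply: (@ler_of_natSinv _ _ _ (A * (`|K| * (2 * eps) ^+ 2))) => M'; set M := M'.+1.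
have [v [z [l [z' [l' [crit_v crit_v' dz dl]]]]]] := slow cP cG eps delta s t M isT st crit.
have Mp : 0 < M%:R :> R by rewrite ltr0n.
have a0 : 0 <= 2 * eps / M%:R by rewrite divr_ge0 // mulr_ge0.
have := near_crit_increment a0 eps0 delta0 rem crit_v crit_v' dz dl.
rewrite addrC addKr; set n := _.+1; rewrite ler_pdivrMr ?ltr0n // => /le_trans; apply.
pose D := (m%:R * 2 + #|J|%:R) * (delta * eps) + `|K| * (2 * eps) ^+ 2 / M%:R.
have D0 : 0 <= D by rewrite addr_ge0 ?divr_ge0 ?mulr_ge0 ?addr_ge0 ?mulr_ge0 ?exprn_ge0.
have nM : n%:R / M%:R <= A.
  rewrite ler_pdivrMr // -natrM ler_nat /n mulnAC [(q * 2 * N)%N]mulnAC.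
  by move: (q * N)%N => a; rewrite /M; nia.
apply: (@le_trans _ _ (D * (n%:R / M%:R))).
  rewrite [leRHS]mulrA [leRHS]mulrAC ler_wpM2r // /D.
  have -> : (m%:R * 2 + #|J|%:R) * (delta * eps) + `|K| * (2 * eps) ^+ 2 / M%:R =
    (m%:R * (delta * (2 * eps / M%:R)) + `|K| * (2 * eps / M%:R) ^+ 2 +
     #|J|%:R * (M%:R^-1 * (delta * eps))) * M%:R by field; rewrite gt_eqF.
  rewrite mulfK ?gt_eqF // lerD2r lerD2l ler_wpM2r ?exprn_ge0 //; exact: ler_norm.
have -> : A * (m%:R * 2 + #|J|%:R) * (delta * eps) + A * (`|K| * (2 * eps) ^+ 2) / M%:R =
  D * A by rewrite /D; ring.
by rewrite ler_wpM2l.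
Qed.

(* Between two values further apart than C delta eps lies a value that is not
   near critical, and the near critical values alternate boundedly often. *)
Lemma near_crit_packing : exists (N : nat) (C : R), 0 <= C /\
  forall cP cG (eps delta K : R), 0 <= eps -> 0 <= delta -> remainder_peval eps K cP cG ->
  forall v : nat -> R, (forall k, v k + C * (delta * eps) < v k.+1) ->
  forall L, (count (fun k => `[< exists z l, near_crit_peval (v k) eps delta cP cG z l >])
               (iota 0 L) <= N)%N.
Proof.
have [C C0 short] := near_crit_interval.
have [B _ dA] := @coded_near_crit_family R m J S d.
have [N alt] := nonempty_alternations dA; exists N, C; split=> //.
move=> cP cG eps delta K eps0 delta0 rem v gap L.
pose V (x : R) := `[< exists z l, near_crit_peval x eps delta cP cG z l >].
have VE x : V x = `[< exists u, coded_near_crit m S d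
    (upd (coefficient_env eps delta cP cG) 0 x) u >].
  apply/asboolP/asboolP => [[z [l /near_crit_encode[u critu]]]|[u]].
    by exists u; rewrite coded_near_critE.
  by rewrite coded_near_critE; exists (code_z u), (code_weights m u).
have Cde0 : 0 <= C * (delta * eps) by rewrite !mulr_ge0.
have /choice[w wP] : forall k, exists w, [/\ v k < w, w < v k.+1 & ~~ V w].
  move=> k; apply: contrapT => allV; pose g := v k.+1 - v k - C * (delta * eps).
  have g0 : 0 < g by rewrite /g; have := gap k; lra.
  have sub : v k + g / 4 <= v k.+1 - g / 4 by rewrite /g in g0 *; lra.
  suff : v k.+1 - g / 4 - (v k + g / 4) <= C * (delta * eps) by rewrite /g in g0 *; lra.
  apply: short rem _ _ sub _ => // x /andP[x1 x2]; apply/asboolP; apply: contrapT => /negP nVx.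
  by apply: allV; exists x; split=> //; lra.
have Vw k : ~~ V (w k) by case: (wP k).
apply: leq_trans (count_le_alternations_interleave v L Vw) _.
under [X in (alternations X _ <= _)%N]eq_fun do rewrite VE.
apply: alt; apply: homo_ltn; first exact: lt_trans.
move=> i /=; rewrite uphalf_half; case: (odd i) => /=.
  by have [_ + _] := wP i./2; rewrite add1n.
by have [+ _ _] := wP i./2; rewrite add0n.
Qed.

End Packing.

(** * Sard's theorem *)

(* Pigeonhole over the points of an equal subdivision of [a, b]. *)
Lemma packed_cover_length (R : realType) (K : finType) (V : K -> R -> Prop) (N : nat)
    (a b D rho : R) : 0 <= rho -> a <= b ->
  (forall k (v : nat -> R), (forall i, v i + D < v i.+1) ->
    forall L, (count (fun i => `[< V k (v i) >]) (iota 0 L) <= N)%N) ->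
  (forall w, a <= w <= b -> exists k, exists2 v, V k v & `|v - w| <= rho) ->
  b - a <= (#|K| * N).+1%:R * (D + 2 * rho).
Proof.
move=> rho0 ab pack cover; set L := (#|K| * N).+1.
rewrite leNgt; apply/negP => long; pose w := subdivision a b L.
have gap : D + 2 * rho < (b - a) / L%:R by rewrite ltr_pdivlMr // mulrC.
have /choice[v vP] : forall ki : K * nat, exists v, `|v - w ki.2| <= rho /\
    ((exists2 v', V ki.1 v' & `|v' - w ki.2| <= rho) -> V ki.1 v).
  move=> [k i]; case: (pselect (exists2 v', V k v' & `|v' - w i| <= rho)).
    by move=> [v' Vv' v'w]; exists v'.
  by move=> none; exists (w i); split=> //; rewrite subrr normr0.
have sparse k : (count (fun i => `[< V k (v (k, i)) >]) (iota 0 L) <= N)%N.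
  apply: (pack k (fun i => v (k, i))) => i; have [vi _] := vP (k, i).
  have [vi1 _] := vP (k, i.+1); move: vi vi1 gap.
  rewrite /= /w subdivisionS !ler_norml => /andP[_ vi] /andP[vi1 _].
  by move: ((b - a) / L%:R) (subdivision _ _ _ _) vi vi1 => h u; lra.
have : (L <= \sum_(k : K) N)%N; last by rewrite sum_nat_const ltnn.
suff : (L <= \sum_(k : K) count (fun i => `[< V k (v (k, i)) >]) (iota 0 L))%N.
  by move=> /leq_trans; apply; apply: leq_sum => k _; exact: sparse.
apply: leq_trans _ (count_exists_le _ _).
rewrite -{1}(size_iota 0 L) -{1}(count_predT (iota 0 L)) (eq_leq (eq_in_count _ )) //.
move=> i; rewrite mem_iota add0n /= => iL; apply/esym.
have [k Vk] := cover _ (subdivision_itv (ltn0Sn _ : (0 < L)%N) ab (ltnW iL)).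
by apply/existsP; exists k; apply/asboolP; have [_] := vP (k, i); apply.
Qed.

Section Sard.
Context {R : realType} {m' : nat} {J : finType}.
Local Notation m := m'.+1.
Variable g : J -> 'rV[R]_m -> R.
Implicit Types (x : 'rV[R]_m) (S : {set J}) (l : J -> R).

Definition crit_value (M v : R) : Prop :=
  exists x l, [/\ `|x| <= M, convex_weights l, forall j, l j != 0 -> g j x = v
    & forall i, \sum_j l j * partial i (g j) x = 0].

Definition taylor_near_crit S x (eps eta v : R) : Prop := exists z l,
  near_crit S v eps (2 * eta * eps ^+ m')
    (fun j (z : 'I_m -> R) => taylor m (g j) x (\row_i z i))
    (fun j i z => taylor m' (partial i (g j)) x (\row_i z i)) z l.

Lemma taylor_quadratic_remainder x (eps : R) : (forall j, contdiff m (g j)) -> 0 <= eps ->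
  exists K, quadratic_remainder eps K (fun j (z : 'I_m -> R) => taylor m (g j) x (\row_i z i))
    (fun j i z => taylor m' (partial i (g j)) x (\row_i z i)).
Proof.
move=> gm eps0; pose T j := taylor m (g j) x.
have : \forall K \near +oo, forall j y y', `|y| <= eps -> `|y'| <= eps ->
    `|T j y' - T j y - \sum_i partial i (T j) y * (y' 0 i - y 0 i)| <= K * `|y' - y| ^+ 2.
  by apply: filter_forall => j; apply: contdiff2_near_quadratic; exact: contdiff_taylor.
move=> /pinfty_ex_gt0[K K0 TK]; exists K => j z z' a a0 zeps zeps' dz.
have row_eps (u : 'I_m -> R) : (forall i, `|u i| <= eps) -> `|\row_i u i| <= eps.
  by move=> ueps; apply/rV_norm_leP => // i; rewrite mxE.
have := TK j _ _ (row_eps _ zeps) (row_eps _ zeps').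
under [X in `|_ - X|]eq_bigr => i _.
  rewrite !mxE; have [_ ->] := is_derive_taylor x (\row_i z i) i (gm j); over.
move=> /le_trans; apply; apply: ler_wpM2l; first exact: ltW.
rewrite ler_sqr ?nnegrE //; apply/rV_norm_leP => // i.
by rewrite !mxE.
Qed.

Lemma taylor_packing : (forall j, contdiff m (g j)) ->
  exists (N : nat) (C : R), 0 <= C /\ forall S x (eps eta : R), 0 <= eps -> 0 <= eta ->
  forall v : nat -> R, (forall k, v k + C * (2 * eta * eps ^+ m) < v k.+1) ->
  forall L, (count (fun k => `[< taylor_near_crit S x eps eta (v k) >]) (iota 0 L) <= N)%N.
Proof.
move=> gm; have /choice[N /choice[C NC]] := fun S => @near_crit_packing R m J S m.
have C0 S : 0 <= C S by case: (NC S).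
exists (\sum_S N S)%N, (\sum_S C S); split=> [|S x eps eta eps0 eta0 v gap L].
  by apply: sumr_ge0.
apply: leq_trans (_ : N S <= _)%N; last by rewrite (bigD1 S) //= leq_addr.
have /choice[cP cPE] : forall j, exists c, forall z : 'I_m -> R,
    taylor m (g j) x (\row_i z i) = peval m c z.
  by move=> j; exact: polyfun_taylor.
have /choice[cG cGE] : forall ji : J * 'I_m, exists c, forall z : 'I_m -> R,
    taylor m' (partial ji.2 (g ji.1)) x (\row_i z i) = peval m c z.
  by move=> ji; apply: (@polyfun_leq _ _ m' m) => //; exact: polyfun_taylor.
have PE : (fun j (z : 'I_m -> R) => taylor m (g j) x (\row_i z i)) = fun j => peval m (cP j).
  by apply/funext => j; apply/funext => z; exact: cPE.
have GE : (fun j i (z : 'I_m -> R) => taylor m' (partial i (g j)) x (\row_i z i)) =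
    fun j i => peval m (cG (j, i)).
  by apply/funext => j; apply/funext => i; apply/funext => z; exact: (cGE (j, i)).
have [K] := taylor_quadratic_remainder x gm eps0; rewrite /taylor_near_crit PE GE => rem.
have [_ pack] := NC S.
apply: (pack cP (fun j i => cG (j, i)) eps _ K eps0 _ rem) => [|k].
  by rewrite !mulr_ge0 // exprn_ge0.
apply: le_lt_trans (gap k); rewrite lerD2l -[_ * eps]mulrA -exprSr ler_wpM2r //.
  by rewrite !mulr_ge0 // exprn_ge0.
by rewrite (bigD1 S) //= lerDl sumr_ge0.
Qed.

Definition taylor_error_le (M eta r : R) : Prop :=
  (forall j x z, `|x| <= M -> `|z| <= r ->
     `|g j (z + x) - taylor m (g j) x z| <= eta * r ^+ m) /\
  (forall j i x z, `|x| <= M -> `|z| <= r ->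
     `|partial i (g j) (z + x) - taylor m' (partial i (g j)) x z| <= eta * r ^+ m').

Lemma near_taylor_error_le (M eta : R) : (forall j, contdiff m (g j)) -> 0 < eta ->
  \forall r \near 0^'+, taylor_error_le M eta r.
Proof.
move=> gm eta0; near=> r; split; near: r.
  by apply: filter_forall => j; exact: near_taylor.
by do 2!apply: filter_forall => ?; apply: near_taylor => //; exact: contdiff_partial.
Unshelve. all: by end_near. Qed.

Lemma crit_value_taylor (M eps eta v : R) x0 x l : 0 <= eps -> 0 <= eta ->
  taylor_error_le M eta eps -> `|x0| <= M ->
  convex_weights l -> (forall j, l j != 0 -> g j x = v) ->
  (forall i, \sum_j l j * partial i (g j) x = 0) -> `|x - x0| <= eps ->
  exists2 v', taylor_near_crit [set j | l j != 0]%SET x0 eps eta v' & `|v' - v| <= eta * eps ^+ m.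
Proof.
move=> eps0 eta0 [Tg TG] x0M [l0 l1] lv lG xx0; pose z := x - x0.
have zx : z + x0 = x by rewrite /z subrK.
have rowz : \row_i z 0 i = z by apply/rowP => i; rewrite mxE.
have Tv j : l j != 0 -> `|taylor m (g j) x0 z - v| <= eta * eps ^+ m.
  by move=> lj; rewrite distrC -(lv j lj) -{1}zx; exact: Tg.
have average (F : J -> R) (B : R) : (forall j, l j != 0 -> `|F j| <= B) ->
    `|\sum_j l j * F j| <= B.
  move=> FB; apply: le_trans (ler_norm_sum _ _ _) _; rewrite -[leRHS]mul1r -l1 mulr_suml.
  apply: ler_sum => j _; rewrite normrM (ger0_norm (l0 j)).
  by have [->|/FB] := eqVneq (l j) 0; [rewrite !mul0r|exact: ler_wpM2l].
pose v' := \sum_j l j * taylor m (g j) x0 z.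
have v'v : `|v' - v| <= eta * eps ^+ m.
  have -> : v' - v = \sum_j l j * (taylor m (g j) x0 z - v).
    by under eq_bigr do rewrite mulrBr; rewrite sumrB -mulr_suml l1 mul1r.
  exact: average.
exists v' => //; exists (fun i => z 0 i), l; split=> [i||j|].
- exact: le_trans (ler_coord_norm _ _) xx0.
- by [].
- by rewrite finset.in_set negbK => /eqP.
rewrite rowz; split=> // [j|i].
  rewrite finset.in_set => lj; rewrite -[_ - v'](subrKA v).
  rewrite -[_ * eps]mulrA -exprSr -mulrA mulr_natl mulr2n.
  by rewrite (le_trans (ler_normD _ _)) // lerD ?Tv // distrC.
have -> : \sum_j l j * taylor m' (partial i (g j)) x0 z =
    \sum_j l j * (taylor m' (partial i (g j)) x0 z - partial i (g j) x).
  by under [RHS]eq_bigr do rewrite mulrBr; rewrite sumrB lG subr0.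
apply: average => j _; rewrite distrC -{1}zx (le_trans (TG _ _ _ _ x0M xx0)) //.
by rewrite -mulrA ler_peMl ?mulr_ge0 ?exprn_ge0 // ler1n.
Qed.

Lemma grid_count (K : finType) (N L : nat) (b : R) : 0 < b ->
  (#|{: {ffun 'I_m -> 'I_L.+2} * K}| * N).+1%:R * (b / L.+1%:R) ^+ m <=
  (#|K| * N).+1%:R * (2 * b) ^+ m.
Proof.
move=> b0; apply: (@le_trans _ _ ((#|K| * N).+1%:R *
    (#|{: {ffun 'I_m -> 'I_L.+2}}|%:R * (b / L.+1%:R) ^+ m))).
  rewrite mulrA ler_wpM2r ?exprn_ge0 ?divr_ge0 ?(ltW b0) // -natrM ler_nat.
  rewrite card_prod -mulnA mulSn mulnC.
  by apply: (@leq_add 1) => //; rewrite card_ffun card_ord expn_gt0.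
by rewrite ler_wpM2l // grid_volume.
Qed.

(* The grid of mesh eps has O(eps^-m) cells, whereas Taylor expansion leaves an
   error o(eps^m) on each of them. *)
Lemma sard (M a b : R) : (forall j, contdiff m (g j)) -> 0 < M -> a < b ->
  exists2 v, a <= v <= b & ~ crit_value M v.
Proof.
move=> gm M0 ab; apply: contrapT => allcrit.
have crit v : a <= v <= b -> crit_value M v.
  by move=> vab; apply: contrapT => ncrit; apply: allcrit; exists v.
have [N [C [C0 pack]]] := taylor_packing gm.
pose Q : R := (#|{: {set J}}| * N).+1%:R * (2 * M) ^+ m * (2 * (C + 1)).
have Q0 : 0 < Q by rewrite !mulr_gt0 ?exprn_gt0 ?mulr_gt0 // ltr_wpDl.
pose eta := (b - a) / (2 * Q).
have eta0 : 0 < eta by rewrite /eta divr_gt0 ?subr_gt0 // mulr_gt0.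
have [L error_le] : exists L : nat, taylor_error_le (2 * M) eta (M / L.+1%:R).
  have [e /= e0 eP] := near_taylor_error_le (2 * M) gm eta0.
  have [L _ LP] := near_infty_natSinv_lt (PosNum (divr_gt0 e0 M0)).
  have Le : M / L.+1%:R < e by rewrite mulrC -ltr_pdivlMr //; exact: LP (leqnn L).
  by exists L; apply: eP; rewrite /= ?sub0r ?normrN ?gtr0_norm ?divr_gt0.
pose eps := M / L.+1%:R; have eps0 : 0 <= eps by rewrite divr_ge0 // ltW.
have rho0 : 0 <= eta * eps ^+ m by rewrite mulr_ge0 ?exprn_ge0 // ltW.
have long : b - a <= (#|{: {ffun 'I_m -> 'I_L.+2} * {set J}}| * N).+1%:R *
    (C * (2 * eta * eps ^+ m) + 2 * (eta * eps ^+ m)).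
  apply: (@packed_cover_length R _
    (fun kS v => taylor_near_crit kS.2 (grid_center M kS.1) eps eta v)) => //.
  - exact: ltW.
  - by move=> [k S] v gap K; exact: (pack S (grid_center M k) eps eta eps0 (ltW eta0) v gap K).
  move=> w /crit[x [l [xM lw lv lG]]]; have [k xk] := grid_cover L M0 xM.
  exists (k, [set j | l j != 0]%SET).
  apply: (crit_value_taylor eps0 (ltW eta0) error_le _ lw lv lG xk).
  exact: grid_center_norm.
move: long; apply/negP; rewrite -ltNge.
have count := grid_count {set J} N L M0.
apply: (@le_lt_trans _ _ (Q * eta)).
  have -> : Q * eta = (#|{: {set J}}| * N).+1%:R * (2 * M) ^+ m * (2 * (C + 1) * eta).
    by rewrite /Q !mulrA.
  have -> : C * (2 * eta * eps ^+ m) + 2 * (eta * eps ^+ m) =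
    eps ^+ m * (2 * (C + 1) * eta) by ring.
  rewrite mulrA ler_wpM2r // mulr_ge0 //; last exact: ltW.
  by rewrite mulr_ge0 // addr_ge0.
have -> : Q * eta = (b - a) / 2 by rewrite /eta; field; rewrite gt_eqF.
by move: ab; lra.
Qed.

End Sard.

(** * Descent along limit curves *)

Section LipschitzPaths.
Context {R : realType}.
Local Notation mu := (@lebesgue_measure R).
Implicit Types (Z : set R) (psi : R -> R).

Lemma lipschitz_continuous psi (L : R) :
  (forall s t, `|psi t - psi s| <= L * `|t - s|) -> continuous psi.
Proof.
move=> psiL x; have Lx : L * `|x - y| @[y --> x] --> 0.
  rewrite -(mulr0 L) -[X in _ --> L * X](normr0 R) -(subrr x).
  by apply: cvgM; [exact: cvg_cst|apply: cvg_norm; apply: cvgB => //; exact: cvg_cst].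
apply/cvgrPdist_le => e e0; near=> y; apply: le_trans (psiL y x) _; apply: ltW.
by near: y; apply: (cvgr_lt 0 Lx).
Unshelve. all: by end_near. Qed.

Lemma closed_segment_extrema Z (s t : R) : closed Z ->
  (exists2 u, s <= u <= t & Z u) ->
  exists a b, [/\ s <= a <= t, s <= b <= t, Z a, Z b &
    forall u, s <= u <= t -> Z u -> a <= u <= b].
Proof.
move=> cZ [u0 u0st Zu0]; pose A := `[s, t]%classic `&` Z.
have cA : compact A by apply: compact_closedI => //; exact: segment_compact.
have A0 : A !=set0 by exists u0; split=> //=; rewrite in_itv.
have cid : {within A, continuous (@idfun R)} by apply: continuous_subspaceT => x; exact: cvg_id.
have [a /set_mem[ast Za] amin] := compact_EVT_min A0 cA cid.
have [b /set_mem[bst Zb] bmax] := compact_EVT_max A0 cA cid.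
exists a, b; split=> //.
move=> u ust Zu; have Au : u \in A by apply/mem_set; split=> //=; rewrite in_itv.
by rewrite [a <= _]amin // [_ <= b]bmax.
Qed.

(* The Lipschitz bound from s propagates beyond any time u: a single member of
   the family agrees with phi at u and at times decreasing to u. *)
Lemma lipschitz_selection (J : finType) (phi : R -> R) (phis : J -> R -> R) (L : R) :
  continuous phi -> (forall j s t, `|phis j t - phis j s| <= L * `|t - s|) ->
  (forall t, exists j, phi t = phis j t) ->
  forall s t, `|phi t - phi s| <= L * `|t - s|.
Proof.
move=> cphi phisL sel s t; wlog st : s t / s <= t => [wlog_st|].
  have [/wlog_st//|/ltW/wlog_st] := leP s t.
  by rewrite distrC [`|t - s|]distrC.
pose Z := [set u | `|phi u - phi s| <= L * (u - s)].
have cZ : closed Z.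
  apply: closed_le_continuous => u; last first.
    by apply: cvgM; [exact: cvg_cst|apply: cvgB => //; exact: cvg_cst].
  by apply: cvg_norm; apply: cvgB; [exact: cphi|exact: cvg_cst].
have [|a [u [_ /andP[su ut] _ Zu ext]]] := @closed_segment_extrema Z s t cZ.
  by exists s; rewrite ?lexx //= /Z /= !subrr normr0 mulr0.
rewrite [`|t - s|]ger0_norm ?subr_ge0 //; move: ut; rewrite le_eqVlt => /orP[/eqP<-//|ut].
pose v k := u + (t - u) / k.+1%:R.
have uv k : u < v k by rewrite /v ltrDl divr_gt0 ?subr_gt0.
have vt k : v k <= t by rewrite /v -lerBrDl ler_pdivrMr // ler_peMr ?subr_ge0 ?ler1n // ltW.
have [U UU] := free_ultrafilter_exists.
have vu : v k @[k --> U] --> u.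
  apply: cvg_free_ultrafilter; rewrite -[X in _ --> X]addr0 -(mulr0 (t - u)).
  by apply: cvgD; [exact: cvg_cst|apply: cvgM; [exact: cvg_cst|exact: cvg_harmonic]].
have /choice[c cE] := fun k => sel (v k); have [j cj] := ultra_constant c.
have phiu : phi u = phis j u.
  apply: (cvg_unique _ (cvg_comp _ _ vu (cphi u))) => //.
  apply: cvg_trans (cvg_comp _ _ vu (lipschitz_continuous (phisL j) (x := u))).
  by apply: near_eq_cvg; apply: filterS cj => k /= <-.
have [k ckj] := filter_ex cj; suff : Z (v k).
  by move=> /ext; rewrite (ltW (le_lt_trans su (uv k))) vt => /(_ isT)/andP[_]; rewrite leNgt uv.
have := phisL j u (v k); rewrite -phiu -ckj -cE [`|v k - u|]gtr0_norm ?subr_gt0 // => phiv.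
rewrite /Z /= -(subrKA (phi u)) (le_trans (ler_normD _ _)) //.
have -> : L * (v k - s) = L * (v k - u) + L * (u - s) by ring.
exact: lerD.
Qed.

Definition punctured_thickening Z (d : R) : set R := (\bigcup_(z in Z) ball z d) `\` Z.

Lemma measurable_punctured_thickening Z d : closed Z -> measurable (punctured_thickening Z d).
Proof.
move=> cZ; apply: measurableD; last exact: closed_measurable.
by apply: open_measurable; apply: bigcup_open => z _; exact: ball_open.
Qed.

Lemma punctured_thickening_cvg0 Z (T : R) : closed Z ->
  mu (`[0, T[%classic `&` punctured_thickening Z k.+1%:R^-1) @[k --> \oo] --> 0%E.
Proof.
move=> cZ; pose B k := `[0, T[%classic `&` punctured_thickening Z k.+1%:R^-1.
have mB k : measurable (B k).
  by apply: measurableI => //; exact: measurable_punctured_thickening.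
suff B0 : \bigcap_k B k = set0.
  rewrite -(measure0 mu) -B0; apply: nonincreasing_cvg_mu => //.
  - apply: (@le_lt_trans _ _ (mu `[0, T[%classic)).
      by apply: le_measure; rewrite ?inE; [exact: mB| |exact: subIsetl].
    by rewrite lebesgue_measure_itv /=; case: ifP => // _; rewrite -EFinB ltry.
  - exact: bigcapT_measurable.
  move=> k l kl; apply/subsetPset => u [Tu [[z Zz zu] nZ]]; split=> //; split=> //.
  by exists z => //; apply: le_ball zu; rewrite lef_pV2 ?posrE // ler_nat ltnS.
apply/seteqP; split=> // u Bu; have [_ [_ nZ]] := Bu 0%N Logic.I.
apply: nZ; apply: cZ => A /nbhs_ballP[r /= r0 rA].
have [k _ kr] := near_infty_natSinv_lt (PosNum r0).
have [_ [[z Zz zu] _]] := Bu k Logic.I; exists z; split=> //; apply: rA.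
by apply: le_ball (ball_sym zu); exact: ltW (kr k (leqnn k)).
Qed.

Definition zero_increment psi (s t : R) : R :=
  if `[< exists2 u, s <= u <= t & psi u = 0 >] then `|psi t - psi s| else 0.

Lemma zero_increment_ge0 psi s t : 0 <= zero_increment psi s t.
Proof. by rewrite /zero_increment; case: ifP. Qed.

Section ZeroIncrements.
Variables (psi : R -> R) (L : R).
Hypothesis L_ge0 : 0 <= L.
Hypothesis psi_lipschitz : forall s t, `|psi t - psi s| <= L * `|t - s|.
Let Z := [set u | psi u = 0].

Let closed_zeros : closed Z.
Proof.
apply: closed_eq_continuous; last exact: cst_continuous.
exact: lipschitz_continuous psi_lipschitz.
Qed.

(* Outside the extreme zeros a and b, psi has no zero in [s, t]. *)
Lemma zero_increment_le (d s t : R) : s <= t -> t - s < d ->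
  ((zero_increment psi s t)%:E <= L%:E * mu (`[s, t[%classic `&` punctured_thickening Z d))%E.
Proof.
move=> st std; rewrite /zero_increment; case: asboolP => [zero|_]; last by rewrite mule_ge0.
have [a [b [/andP[sa at_] /andP[sb bt] Za Zb ab]]] := closed_segment_extrema closed_zeros zero.
have /andP[_ ab_le] : a <= a <= b by apply: ab; rewrite ?sa.
have near_zero u z : s <= u <= t -> s <= z <= t -> Z z -> ~ Z u -> punctured_thickening Z d u.
  move=> /andP[su ut] /andP[sz zt] Zz nZ; split=> //; exists z => //=.
  rewrite -ball_normE /=; apply: le_lt_trans std; rewrite ler_norml.
  by apply/andP; split; lra.
have sub : `[s, a[%classic `|` `]b, t[%classic `<=` `[s, t[%classic `&` punctured_thickening Z d.
  move=> u [] /=; rewrite !in_itv /= => /andP[lo hi].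
    have ust : s <= u <= t by rewrite lo (ltW (lt_le_trans hi at_)).
    rewrite lo (lt_le_trans hi at_); split=> //; apply: (near_zero u a ust) => //.
      by rewrite sa.
    by move=> /(ab u ust)/andP[]; rewrite leNgt hi.
  have ust : s <= u <= t by rewrite (ltW hi) (ltW (le_lt_trans sb lo)).
  rewrite hi (ltW (le_lt_trans sb lo)); split=> //; apply: (near_zero u b ust) => //.
    by rewrite sb.
  by move=> /(ab u ust)/andP[_]; rewrite leNgt lo.
apply: (@le_trans _ _ (L%:E * ((a - s)%:E + (t - b)%:E))%E).
  rewrite -EFinD -EFinM lee_fin -(subrKA (psi b)) Zb sub0r.
  rewrite -[- psi s]add0r -[X in X - psi s]Za mulrDr addrC.
  apply: le_trans (ler_normD _ _) _; rewrite -[a - s]ger0_norm ?subr_ge0 //.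
  rewrite -[t - b]ger0_norm ?subr_ge0 //; apply: lerD; first exact: psi_lipschitz.
  by have := psi_lipschitz b t; rewrite Zb.
apply: lee_wpmul2l => //.
have itv_length (l r : R) bl br : l <= r ->
    mu [set` Interval (BSide bl l) (BSide br r)] = (r - l)%:E.
  rewrite lebesgue_measure_itv /= lte_fin le_eqVlt => /orP[/eqP->|->] //.
  by rewrite ltxx subrr.
rewrite -(itv_length s a true true sa) -(itv_length b t false true bt) -measureU //.
  apply: le_measure => //; rewrite inE; first exact: measurableU.
  by apply: measurableI => //; exact: measurable_punctured_thickening.
apply/seteqP; split=> // u []; rewrite /= !in_itv /= => /andP[_ ua] /andP[bu _].
by have := lt_trans (le_lt_trans ab_le bu) ua; rewrite ltxx.
Qed.

Lemma zero_increments_le (T d : R) (n : nat) : 0 <= T -> (0 < n)%N -> T / n%:R < d ->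
  ((\sum_(i < n) zero_increment psi (subdivision 0 T n i) (subdivision 0 T n i.+1))%:E
    <= L%:E * mu (`[0%R, T[%classic `&` punctured_thickening Z d))%E.
Proof.
move=> T0 n0 nd; pose c := subdivision 0 T n; rewrite -/c.
pose B t := `[0, t[%classic `&` punctured_thickening Z d.
have mB (i : interval R) : measurable ([set` i] `&` punctured_thickening Z d).
  by apply: measurableI => //; exact: measurable_punctured_thickening.
have cS i : c i.+1 = c i + T / n%:R by rewrite /c subdivisionS subr0.
have c0 i : 0 <= c i by rewrite /c /subdivision add0r subr0 mulr_ge0 ?divr_ge0.
have cT : c n = T by exact: subdivision_last.
suff partial_sum k : ((\sum_(i < k) zero_increment psi (c i) (c i.+1))%:E
    <= L%:E * mu (B (c k)))%E by have := partial_sum n; rewrite cT.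
elim: k => [|k IH]; first by rewrite big_ord0 mule_ge0.
rewrite big_ord_recr /= EFinD; have cc : c k <= c k.+1 by rewrite cS lerDl divr_ge0.
have cd : c k.+1 - c k < d by rewrite cS addrC addKr.
apply: le_trans (leeD IH (zero_increment_le cc cd)) _.
rewrite -ge0_muleDr // -measureU //; try exact: mB.
  apply: lee_wpmul2l => //; apply: le_measure; rewrite ?inE; try exact: mB.
    by apply: measurableU; exact: mB.
  move=> u [] [] /=; rewrite !in_itv /= => /andP[lo hi] Bu; split=> //=.
    by rewrite in_itv /= lo (lt_le_trans hi).
  by rewrite in_itv /= hi (le_trans (c0 k)).
apply/seteqP; split=> // u [[+ _] [+ _]]; rewrite /= !in_itv /=.
by move=> /andP[_ uc] /andP[cu _]; have := lt_le_trans uc cu; rewrite ltxx.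
Qed.

Lemma zero_increments_cvg0 (T : R) : 0 < T ->
  \sum_(i < n) zero_increment psi (subdivision 0 T n i) (subdivision 0 T n i.+1)
    @[n --> \oo] --> 0.
Proof.
move=> T0; have /fine_cvgP[mu_fin mu0] := punctured_thickening_cvg0 T closed_zeros.
have Lmu0 : L * fine (mu (`[0, T[%classic `&` punctured_thickening Z k.+1%:R^-1))
    @[k --> \oo] --> 0.
  by rewrite -[X in _ --> X](mulr0 L); apply: cvgM; [exact: cvg_cst|exact: mu0].
apply/cvgrPdist_le => e e0; near \oo => k.
have muk : mu (`[0, T[%classic `&` punctured_thickening Z k.+1%:R^-1) \is a fin_num by near: k.
near=> n; have n0 : (0 < n)%N by near: n; exact: nbhs_infty_gt.
have nk : T / n%:R < k.+1%:R^-1.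
  rewrite ltr_pdivrMr ?ltr0n // mulrC ltr_pdivlMr //.
  by near: n; exact: nbhs_infty_gtr.
rewrite sub0r normrN ger0_norm ?sumr_ge0 // => [|i _]; last exact: zero_increment_ge0.
rewrite -lee_fin; apply: le_trans (zero_increments_le (ltW T0) n0 nk) _.
rewrite -(fineK muk) -EFinM lee_fin ltW //.
by near: k; exact: (cvgr_lt 0 Lmu0).
Unshelve. all: by end_near. Qed.

End ZeroIncrements.
End LipschitzPaths.

Section CurveDescent.
Context {R : realType} {m : nat} {J : finType}.
Variables (C : J -> set 'rV[R]_m) (g : J -> 'rV[R]_m -> R) (f : 'rV[R]_m -> R).

(* gam solves gam' in - conv {grad (g j) (gam) : C j (gam)} in integrated form;
   Lam j t is the time spent up to t on the piece j. *)
Record limit_curve (M V E : R) (gam : R -> 'rV[R]_m) (Lam : J -> R -> R) : Prop :=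
  LimitCurve {
    curve_bounded : forall t, `|gam t| <= M;
    curve_lipschitz : forall s t, `|gam t - gam s| <= V * `|t - s|;
    curve_mono : forall j s t, s <= t -> Lam j s <= Lam j t;
    curve_total : forall s t, 0 <= s -> s <= t -> \sum_j (Lam j t - Lam j s) = t - s;
    curve_inclusion : forall s t i, 0 <= s -> s <= t ->
      `|gam t 0 i - gam s 0 i + \sum_j (Lam j t - Lam j s) * partial i (g j) (gam s)|
        <= E * (t - s) ^+ 2;
    curve_visit : forall j s t, 0 <= s -> s <= t -> Lam j s < Lam j t ->
      exists2 u, s <= u <= t & C j (gam u);
    curve_covered : forall t, exists j, C j (gam t) }.

Hypothesis g2 : forall j, contdiff 2 (g j).
Hypothesis f_continuous : continuous f.
Hypothesis f_piece : forall j x, C j x -> f x = g j x.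
Variables (M V E : R) (gam : R -> 'rV[R]_m) (Lam : J -> R -> R).
Hypothesis gam_curve : limit_curve M V E gam Lam.
Implicit Types (s t T : R) (w : 'I_m -> R).

Lemma curve_speed_ge0 : 0 <= V.
Proof.
by have := curve_lipschitz gam_curve 0 1; rewrite subr0 normr1 mulr1; apply: le_trans.
Qed.

Lemma curve_coord_lipschitz i s t : `|gam t 0 i - gam s 0 i| <= V * `|t - s|.
Proof. exact: le_trans (ler_coord_distl _ _ _) (curve_lipschitz gam_curve s t). Qed.

Lemma curve_continuous : continuous gam.
Proof.
move=> t; apply: cvg_rV => i.
by apply: (@lipschitz_continuous _ (fun u => gam u 0 i) V) => s u; exact: curve_coord_lipschitz.
Qed.

Lemma curve_pieces_lipschitz : exists2 L, 0 <= L &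
  (forall j s t, `|g j (gam t) - g j (gam s)| <= L * `|t - s|) /\
  (forall s t, `|f (gam t) - f (gam s)| <= L * `|t - s|).
Proof.
have : \forall L \near +oo, forall j x y, `|x| <= M -> `|y| <= M ->
    `|g j y - g j x| <= L * `|y - x|.
  apply: filter_forall => j; apply: contdiff1_near_lipschitz.
  exact: (contdiff_leq _ (g2 j)).
move=> /pinfty_ex_gt0[L L0 gL].
have gamL j s t : `|g j (gam t) - g j (gam s)| <= (L * V) * `|t - s|.
  apply: le_trans (gL j _ _ (curve_bounded gam_curve s) (curve_bounded gam_curve t)) _.
  by rewrite -mulrA ler_pM2l //; exact: curve_lipschitz gam_curve s t.
exists (L * V); first by rewrite mulr_ge0 ?curve_speed_ge0 // ltW.
split=> //; apply: (@lipschitz_selection R J (fun t => f (gam t)) (fun j t => g j (gam t))) => //.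
  by move=> t; apply: (@continuous_comp _ _ _ gam f); [exact: curve_continuous|exact: f_continuous].
by move=> t; have [j Cj] := curve_covered gam_curve t; exists j; exact: f_piece.
Qed.

Let gap j t := f (gam t) - g j (gam t).

Lemma curve_gap_lipschitz : exists2 L, 0 <= L &
  forall j s t, `|gap j t - gap j s| <= L * `|t - s|.
Proof.
have [L L0 [gL fL]] := curve_pieces_lipschitz; exists (L + L); first exact: addr_ge0.
move=> j s t; have -> : gap j t - gap j s = (f (gam t) - f (gam s)) - (g j (gam t) - g j (gam s)).
  by rewrite /gap; ring.
by rewrite mulrDl (le_trans (ler_normB _ _)) // lerD.
Qed.

Section OneStep.
Variables s t : R.
Hypotheses (s_ge0 : 0 <= s) (s_le_t : s <= t).
Let dwell j := Lam j t - Lam j s.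
Let move i := gam t 0 i - gam s 0 i.

Let dwell_ge0 j : 0 <= dwell j.
Proof. by rewrite subr_ge0; exact: curve_mono gam_curve _ _ _ s_le_t. Qed.

Let dwell_total : \sum_j dwell j = t - s.
Proof. exact: curve_total gam_curve _ _ s_ge0 s_le_t. Qed.

Lemma curve_drift : \sum_j dwell j * (\sum_i partial i (g j) (gam s) * move i) <=
  - (\sum_i move i ^+ 2) + m%:R * (E * V) * (t - s) ^+ 3.
Proof.
have -> : \sum_j dwell j * (\sum_i partial i (g j) (gam s) * move i) =
    \sum_i (\sum_j dwell j * partial i (g j) (gam s)) * move i.
  under eq_bigr do rewrite mulr_sumr.
  rewrite exchange_big /=; apply: eq_bigr => i _; rewrite mulr_suml.
  by apply: eq_bigr => j _; rewrite mulrA.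
have -> : m%:R * (E * V) * (t - s) ^+ 3 = \sum_(i < m) (E * (t - s) ^+ 2) * (V * (t - s)).
  by rewrite sumr_const card_ord -[RHS]mulr_natl; ring.
rewrite -sumrN -big_split /=; apply: ler_sum => i _.
have := curve_inclusion gam_curve i s_ge0 s_le_t; rewrite -/(move i).
set drift := \sum_j _ => move_drift.
have -> : drift * move i = - move i ^+ 2 + (move i + drift) * move i by ring.
rewrite lerD2l; apply: le_trans (ler_norm _) _; rewrite normrM ler_pM //.
by have := curve_coord_lipschitz i s t; rewrite [`|t - s|]ger0_norm // subr_ge0.
Qed.

(* A piece spends time only around the zeros of its gap. *)
Lemma curve_switching : \sum_j dwell j * (gap j t - gap j s) <=
  (t - s) * \sum_j zero_increment (gap j) s t.
Proof.
rewrite mulr_sumr; apply: ler_sum => j _.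
have dwell_le : dwell j <= t - s.
  by rewrite -dwell_total (bigD1 j) //= lerDl; apply: sumr_ge0.
rewrite /zero_increment; case: asboolP => [_|nozero].
  apply: le_trans (ler_norm _) _; rewrite normrM (ger0_norm (dwell_ge0 j)).
  exact: ler_wpM2r.
suff -> : dwell j = 0 by rewrite mul0r mulr0.
apply/eqP; rewrite eq_le dwell_ge0 andbT leNgt subr_gt0; apply/negP => spent.
have [u stu Cu] := curve_visit gam_curve s_ge0 s_le_t spent; apply: nozero; exists u => //.
by rewrite /gap (f_piece Cu) subrr.
Qed.

Lemma curve_step (Q : R) :
  (forall j x y, `|x| <= M -> `|y| <= M ->
    `|g j y - g j x - \sum_i partial i (g j) x * (y 0 i - x 0 i)| <= Q * `|y - x| ^+ 2) ->
  0 <= Q ->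
  (t - s) * (f (gam t) - f (gam s)) <= - (\sum_i move i ^+ 2) +
    (m%:R * (E * V) + Q * V ^+ 2) * (t - s) ^+ 3 + (t - s) * \sum_j zero_increment (gap j) s t.
Proof.
move=> gQ Q0.
have -> : (t - s) * (f (gam t) - f (gam s)) =
    \sum_j dwell j * (g j (gam t) - g j (gam s)) + \sum_j dwell j * (gap j t - gap j s).
  rewrite -dwell_total mulr_suml -big_split /=; apply: eq_bigr => j _.
  by rewrite /gap; ring.
apply: lerD curve_switching.
have taylor_piece j : dwell j * (g j (gam t) - g j (gam s)) <=
    dwell j * (\sum_i partial i (g j) (gam s) * move i) + dwell j * (Q * V ^+ 2 * (t - s) ^+ 2).
  rewrite -mulrDr ler_wpM2l // -lerBlDl.
  apply: le_trans (ler_norm _) _.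
  apply: le_trans (gQ j _ _ (curve_bounded gam_curve s) (curve_bounded gam_curve t)) _.
  rewrite -mulrA -exprMn ler_wpM2l // lerXn2r ?nnegrE ?mulr_ge0 ?curve_speed_ge0 ?subr_ge0 //.
  by have := curve_lipschitz gam_curve s t; rewrite [`|t - s|]ger0_norm // subr_ge0.
apply: le_trans (ler_sum _ (fun j _ => taylor_piece j)) _.
rewrite big_split /= -mulr_suml dwell_total.
apply: le_trans (lerD curve_drift (lexx _)) _.
by rewrite le_eqVlt; apply/orP; left; apply/eqP; ring.
Qed.

End OneStep.

Lemma curve_increment : exists K, forall w s t, 0 <= s -> s < t ->
  f (gam t) - f (gam s) <=
    \sum_i (w i ^+ 2 * (t - s) - 2 * w i * (gam t 0 i - gam s 0 i)) + K * (t - s) ^+ 2 +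
    \sum_j zero_increment (gap j) s t.
Proof.
have : \forall Q \near +oo, forall j x y, `|x| <= M -> `|y| <= M ->
    `|g j y - g j x - \sum_i partial i (g j) x * (y 0 i - x 0 i)| <= Q * `|y - x| ^+ 2.
  by apply: filter_forall => j; exact: contdiff2_near_quadratic.
move=> /pinfty_ex_gt0[Q Q0 gQ]; exists (m%:R * (E * V) + Q * V ^+ 2) => w s t s0 st.
have h0 : 0 < t - s by rewrite subr_gt0.
rewrite -(ler_pM2l h0); apply: le_trans (curve_step s0 (ltW st) gQ (ltW Q0)) _.
rewrite [leRHS]mulrDr lerD2r mulrDr; apply: lerD; last first.
  by rewrite le_eqVlt; apply/orP; left; apply/eqP; ring.
rewrite mulr_sumr -sumrN; apply: ler_sum => i _; rewrite -subr_ge0.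
(* the square of [w i * (t - s) - (gam t 0 i - gam s 0 i)] *)
move: (t - s) (gam t 0 i - gam s 0 i) => h d.
have -> : h * (w i ^+ 2 * h - 2 * w i * d) - - d ^+ 2 = (w i * h - d) ^+ 2 by ring.
exact: sqr_ge0.
Qed.

Lemma curve_descent_subdivision : exists K, forall T n, 0 < T -> (0 < n)%N ->
  f (gam T) - f (gam 0) <= - (\sum_i (gam T 0 i - gam 0 0 i) ^+ 2) / T + K * T ^+ 2 * n%:R^-1 +
    \sum_j \sum_(i < n) zero_increment (gap j) (subdivision 0 T n i) (subdivision 0 T n i.+1).
Proof.
have [K incr] := curve_increment; exists K => T n T0 n0; pose c := subdivision 0 T n; rewrite -/c.
have np : 0 < n%:R :> R by rewrite ltr0n.
have c_mono i : c i < c i.+1 by exact: subdivision_lt.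
have c_ge0 i : 0 <= c i by rewrite /c /subdivision add0r subr0 mulr_ge0 ?divr_ge0 ?(ltW T0).
have telescope (h : R -> R) : \sum_(i < n) (h (c i.+1) - h (c i)) = h T - h 0.
  by rewrite -(big_mkord xpredT (fun i => h (c i.+1) - h (c i)))
    (telescope_sumr (fun i => h (c i))) // /c subdivision_last // subdivision0.
have -> : f (gam T) - f (gam 0) = \sum_(i < n) (f (gam (c i.+1)) - f (gam (c i))).
  by rewrite (telescope (fun t => f (gam t))).
rewrite [X in _ + X]exchange_big /=.
pose w i := (gam T 0 i - gam 0 0 i) / T.
apply: le_trans.
  by apply: ler_sum => i _; exact: (incr w _ _ (c_ge0 i) (c_mono i)).
rewrite 2!big_split /= lerD2r exchange_big /= lerD // le_eqVlt; apply/orP; left; apply/eqP.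
  rewrite mulNr mulr_suml -sumrN; apply: eq_bigr => l _.
  rewrite sumrB -!mulr_sumr (telescope id) (telescope (fun t => gam t 0 l)) /w /=.
  by field; rewrite gt_eqF.
under eq_bigr do rewrite /c subdivisionS addrC addKr subr0.
by rewrite sumr_const card_ord -[LHS]mulr_natr; field; rewrite gt_eqF.
Qed.

Lemma curve_descent T : 0 < T ->
  f (gam T) - f (gam 0) <= - (\sum_i (gam T 0 i - gam 0 0 i) ^+ 2) / T.
Proof.
move=> T0; have [K bound] := curve_descent_subdivision; have [L L0 gapL] := curve_gap_lipschitz.
have zero_sum : \sum_j \sum_(i < n)
    zero_increment (gap j) (subdivision 0 T n i) (subdivision 0 T n i.+1)
    @[n --> \oo] --> \sum_(j : J) (0 : R).
  by apply: cvg_sum => j; exact: zero_increments_cvg0 L0 (gapL j) T T0.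
have mesh_cvg0 : K * T ^+ 2 * n%:R^-1 @[n --> \oo] --> (0 : R).
  rewrite -(mulr0 (K * T ^+ 2)); apply: cvgM; first exact: cvg_cst.
  by apply/gtr0_cvgV0; [near=> n; rewrite ltr0n; near: n; exact: nbhs_infty_gt|exact: cvgr_idn].
have lim := cvgD (cvgD (cvg_cst (- (\sum_i (gam T 0 i - gam 0 0 i) ^+ 2) / T)) mesh_cvg0) zero_sum.
rewrite big1_eq !addr0 in lim; apply: (cvgr_to_ge (lim _ _ _)); near=> n; apply: bound => //.
by near: n; exact: nbhs_infty_gt.
Unshelve. all: by end_near. Qed.

End CurveDescent.

Section Gordan.
Context {R : realType} {m : nat} {J : finType}.
Variables (S : {set J}) (a : J -> 'I_m -> R).
Implicit Types (l : J -> R).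

Definition supported_weights l : Prop := convex_weights l /\ forall j, j \notin S -> l j = 0.

Let combination l i := \sum_j l j * a j i.
Let sqnorm (p : 'I_m -> R) := \sum_i p i ^+ 2.

Let delta (j : J) : J -> R := fun k => (k == j)%:R.

Let sum_delta j (F : J -> R) : \sum_k delta j k * F k = F j.
Proof.
rewrite (bigD1 j) //= /delta eqxx mul1r big1 ?addr0 // => k /negbTE->.
by rewrite mul0r.
Qed.

Lemma supported_weights_delta j : j \in S -> supported_weights (delta j).
Proof.
move=> jS; split; last first.
  by move=> k; rewrite /delta; case: eqP => // ->; rewrite jS.
split=> [k|]; first exact: ler0n.
by have := sum_delta j (fun=> 1); under eq_bigr do rewrite mulr1.
Qed.

Lemma min_norm_combination : S != finset.set0 -> exists2 l, supported_weights l &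
  forall l', supported_weights l' -> sqnorm (combination l) <= sqnorm (combination l').
Proof.
move=> /finset.set0Pn[j0 j0S]; pose W (u : 'rV[R]_#|J|) j := u 0 (enum_rank j).
have rowW l : W (\row_k l (enum_val k)) = l by apply/funext => j; rewrite /W mxE enum_rankK.
have cW j : continuous (W^~ j) by exact: coord_continuous.
pose A := [set u | supported_weights (W u)].
have A0 : A !=set0.
  by exists (\row_k delta j0 (enum_val k)); rewrite /A /= rowW; exact: supported_weights_delta.
have cA : compact A.
  apply: (subclosed_compact _ (@compact_norm_le R #|J| 1)) => [|u [uw _]]; last first.
    apply/rV_norm_leP => // k; have := convex_weights_le1 (enum_val k) uw.
    rewrite /W enum_valK ger0_norm //; case: uw => + _ => /(_ (enum_val k)).
    by rewrite /W enum_valK.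
  apply: closedI; first apply: closedI.
  - by apply: closed_forall => j; apply: closed_le_continuous => //; exact: cst_continuous.
  - by apply: closed_eq_continuous; [exact: continuous_sum|exact: cst_continuous].
  - apply: closed_forall => j; apply: closed_forall => _.
    by apply: closed_eq_continuous => //; exact: cst_continuous.
have cN : continuous (fun u => sqnorm (combination (W u))).
  apply: continuous_sum => i; have ci : continuous (fun u => combination (W u) i).
    by apply: continuous_sum => j; apply: continuous_mul => //; exact: cst_continuous.
  exact: continuous_mul.
have [u /set_mem Au umin] := EVT_min_rV A0 cA (continuous_subspaceT cN).
exists (W u) => // l' l'w; rewrite -[l']rowW; apply: umin; apply/mem_set.
by rewrite /A /= rowW.
Qed.

Lemma min_norm_supporting l j : supported_weights l ->
  (forall l', supported_weights l' -> sqnorm (combination l) <= sqnorm (combination l')) ->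
  j \in S -> sqnorm (combination l) <= \sum_i a j i * combination l i.
Proof.
move=> [[l0 l1] lS] lmin jS; set p := combination l.
have [[d0 d1] dS] := supported_weights_delta jS.
apply: (@ler_of_natSinv _ _ _ (\sum_i (a j i - p i) ^+ 2 / 2)) => n; set t : R := n.+1%:R^-1.
have t0 : 0 < t by rewrite invr_gt0.
have t1 : t <= 1 by rewrite invf_le1 // ler1n.
pose l' k := (1 - t) * l k + t * delta j k.
have l'w : supported_weights l'.
  split; last by move=> k kS; rewrite /l' lS // dS // !mulr0 addr0.
  split=> [k|]; first by rewrite addr_ge0 // mulr_ge0 ?subr_ge0 // ltW.
  by rewrite big_split /= -!mulr_sumr l1 d1 !mulr1 subrK.
have pE i : combination l' i = p i + t * (a j i - p i).
  rewrite -[a j i](sum_delta j (a^~ i)) /p /combination -sumrB mulr_sumr -big_split /=.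
  by apply: eq_bigr => k _; rewrite /l'; ring.
have := lmin _ l'w.
have -> : sqnorm (combination l') =
    sqnorm p + 2 * t * (\sum_i a j i * p i - sqnorm p + t * (\sum_i (a j i - p i) ^+ 2 / 2)).
  rewrite /sqnorm -sumrB !mulr_sumr -big_split /= mulr_sumr -big_split /=.
  by apply: eq_bigr => i _; rewrite pE; field.
by rewrite lerDl pmulr_rge0 ?mulr_gt0 // addrAC subr_ge0 mulrC.
Qed.

Lemma gordan : (exists2 l, supported_weights l & forall i, \sum_j l j * a j i = 0) \/
  (exists (w : 'I_m -> R) (c : R), 0 < c /\ forall j, j \in S -> c <= \sum_i a j i * w i).
Proof.
have [S0|] := eqVneq S finset.set0.
  by right; exists (fun=> 0), 1; split=> // j; rewrite S0 finset.in_set0.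
move=> /min_norm_combination[l lw lmin]; have [N0|N0] := eqVneq (sqnorm (combination l)) 0.
  left; exists l => // i; move/eqP: N0; rewrite psumr_eq0 => [|k _]; last exact: sqr_ge0.
  by move=> /allP /(_ i); rewrite mem_index_enum sqrf_eq0 => /(_ isT) /eqP.
right; exists (combination l), (sqnorm (combination l)); split.
  by rewrite lt_neqAle eq_sym N0 sumr_ge0 // => i _; exact: sqr_ge0.
by move=> j jS; exact: min_norm_supporting.
Qed.

End Gordan.

Section StrictDescent.
Context {R : realType} {m : nat} {J : finType}.
Variables (C : J -> set 'rV[R]_m) (g : J -> 'rV[R]_m -> R).

Definition crit_point (x : 'rV[R]_m) : Prop :=
  exists l, [/\ convex_weights l, forall j, l j != 0 -> C j x
    & forall i, \sum_j l j * partial i (g j) x = 0].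

Hypothesis C_closed : forall j, closed (C j).
Variables (M V E : R) (gam : R -> 'rV[R]_m) (Lam : J -> R -> R).
Hypothesis gam_curve : limit_curve C g M V E gam Lam.

Lemma curve_inactive_pieces :
  \forall T \near 0^'+, forall j, ~ C j (gam 0) -> Lam j T = Lam j 0.
Proof.
apply: filter_forall => j; have [Cj|nC] := pselect (C j (gam 0)); first by near=> T.
have nearC : nbhs (gam 0) (~` C j) by apply: open_nbhs_nbhs; split=> //; rewrite openC.
have : \forall u \near (0 : R), ~ C j (gam u) := curve_continuous gam_curve nearC.
move=> [d /= d0 dC]; near=> T; have T0 : 0 <= T by near: T; exact: nbhs_right_ge.
move=> _; apply/eqP; rewrite eq_le (curve_mono gam_curve j T0) andbT leNgt; apply/negP => spent.
have [u /andP[u0 uT]] := curve_visit gam_curve (lexx 0) T0 spent; apply: dC.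
rewrite /= sub0r normrN ger0_norm //; apply: le_lt_trans uT _.
by near: T; exact: nbhs_right_lt.
Unshelve. all: by end_near. Qed.

Lemma curve_moves (w : 'I_m -> R) (c : R) : 0 < c ->
  (forall j, C j (gam 0) -> c <= \sum_i partial i (g j) (gam 0) * w i) ->
  \forall T \near 0^'+, \sum_i w i * (gam T 0 i - gam 0 0 i) < 0.
Proof.
move=> c0 slope; pose W := \sum_i `|w i|; near=> T.
have inactive : forall j, ~ C j (gam 0) -> Lam j T = Lam j 0.
  by near: T; exact: curve_inactive_pieces.
have T0 : 0 < T by near: T; exact: nbhs_right_gt.
have TW : T * (`|W * E| + 1) < c.
  rewrite -ltr_pdivlMr ?ltr_wpDl //; near: T; apply: nbhs_right_lt.
  by rewrite divr_gt0 // ltr_wpDl.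
pose dwell j := Lam j T - Lam j 0.
have dwell_total : \sum_j dwell j = T by rewrite (curve_total gam_curve) ?subr0 // ltW.
have coord i : w i * (gam T 0 i - gam 0 0 i) <=
    `|w i| * (E * T ^+ 2) - \sum_j dwell j * (partial i (g j) (gam 0) * w i).
  have := curve_inclusion gam_curve i (lexx 0) (ltW T0); rewrite subr0.
  set drift := \sum_j _ => drift_le.
  have -> : \sum_j dwell j * (partial i (g j) (gam 0) * w i) = drift * w i.
    by rewrite mulr_suml; apply: eq_bigr => j _; rewrite mulrA.
  rewrite lerBrDr [drift * w i]mulrC -mulrDr; apply: le_trans (ler_norm _) _.
  by rewrite normrM ler_wpM2l.
apply: le_lt_trans (ler_sum _ (fun i _ => coord i)) _.
rewrite sumrB -mulr_suml -/W exchange_big /= subr_lt0.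
apply: (@lt_le_trans _ _ (c * T)).
  have -> : W * (E * T ^+ 2) = T * (W * E) * T by ring.
  rewrite ltr_pM2r //; apply: le_lt_trans TW; rewrite ler_pM2l //.
  by rewrite (le_trans (ler_norm _)) // lerDl.
rewrite -dwell_total mulr_sumr; apply: ler_sum => j _; rewrite -mulr_sumr mulrC.
have [Cj|/inactive same] := pselect (C j (gam 0)); last by rewrite /dwell same subrr !mul0r.
rewrite ler_wpM2l ?slope // subr_ge0; exact: curve_mono gam_curve _ _ _ (ltW T0).
Unshelve. all: by end_near. Qed.

Lemma curve_strict_descent (f : 'rV[R]_m -> R) :
  (forall j, contdiff 2 (g j)) -> continuous f -> (forall j x, C j x -> f x = g j x) ->
  ~ crit_point (gam 0) -> exists2 T, 0 < T & f (gam T) < f (gam 0).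
Proof.
move=> g2 cf fg ncrit; pose S := [set j | `[< C j (gam 0) >]]%SET.
have [[l [lw lS] lg]|[w [c [c0 slope]]]] := gordan S (fun j i => partial i (g j) (gam 0)).
  exfalso; apply: ncrit; exists l; split=> // j; apply: contraNP => nC.
  by apply/eqP/lS; rewrite finset.in_set; apply/asboolP.
have : \forall T \near 0^'+, 0 < T /\ \sum_i w i * (gam T 0 i - gam 0 0 i) < 0.
  near=> T; split; first by near: T; exact: nbhs_right_gt.
  near: T; apply: curve_moves c0 _ => j Cj.
  by apply: slope; rewrite finset.in_set; apply/asboolP.
move=> /filter_ex[T [T0 moves]]; exists T => //.
rewrite -subr_lt0; apply: le_lt_trans (curve_descent g2 cf fg gam_curve T0) _.
rewrite mulNr oppr_lt0 divr_gt0 // lt_neqAle eq_sym.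
rewrite sumr_ge0 ?andbT; last by move=> i _; exact: sqr_ge0.
apply: contraTneq moves => /eqP; rewrite psumr_eq0 => [/allP still|i _]; last exact: sqr_ge0.
rewrite big1 ?ltxx // => i _.
by have := still i; rewrite mem_index_enum sqrf_eq0 => /(_ isT) /eqP ->; rewrite mulr0.
Unshelve. all: by end_near. Qed.

End StrictDescent.

(** * Limits of bounded iterates *)

Section Clock.
Context {R : realType}.
Variable a : nat -> R.
Hypothesis a_gt0 : forall k, 0 < a k.
Hypothesis a_divergent : forall k (t : R), exists l, t <= \sum_(k <= i < l) a i.
Implicit Types (k l n : nat) (s t : R).

Definition clock k l : R := \sum_(k <= i < l) a i.

Lemma clock_ge0 k l : 0 <= clock k l.
Proof. by apply: sumr_ge0 => i _; exact: ltW. Qed.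

Lemma clockD k l n : (k <= l)%N -> (l <= n)%N -> clock k n = clock k l + clock l n.
Proof. by move=> kl ln; rewrite /clock (big_cat_nat kl ln). Qed.

Lemma clock_id k : clock k k = 0. Proof. by rewrite /clock big_geq. Qed.

Lemma clock1 k : clock k k.+1 = a k. Proof. by rewrite /clock big_nat1. Qed.

Lemma clock_le k l n : (k <= l)%N -> (l <= n)%N -> clock k l <= clock k n.
Proof. by move=> kl ln; rewrite (clockD kl ln) lerDl clock_ge0. Qed.

Lemma stop_subproof k t : exists l, (k <= l)%N && (t <= clock k l).
Proof.
have [l tl] := a_divergent k t; exists (maxn k l); rewrite leq_maxl /=.
apply: le_trans tl _; case: (leqP k l) => [//|lk].
by rewrite big_geq ?clock_ge0 // ltnW.
Qed.

Definition stop k t : nat := ex_minn (stop_subproof k t).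

Lemma stop_ge k t : (k <= stop k t)%N.
Proof. by rewrite /stop; case: ex_minnP => l /andP[]. Qed.

Lemma clock_stop_ge k t : t <= clock k (stop k t).
Proof. by rewrite /stop; case: ex_minnP => l /andP[]. Qed.

Lemma stop_le k t l : (k <= l)%N -> t <= clock k l -> (stop k t <= l)%N.
Proof. by rewrite /stop; case: ex_minnP => n _ nmin kl tl; apply: nmin; rewrite kl. Qed.

Lemma clock_lt_stop k t l : (k <= l)%N -> (l < stop k t)%N -> clock k l < t.
Proof. by move=> kl; apply: contraTT; rewrite -leNgt -leqNgt; exact: stop_le. Qed.

Lemma stop_mono k s t : s <= t -> (stop k s <= stop k t)%N.
Proof.
move=> st; apply: stop_le; first exact: stop_ge.
exact: le_trans st (clock_stop_ge k t).
Qed.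

Lemma clock_stop_dist k t A : (forall i, (k <= i)%N -> a i <= A) ->
  `|clock k (stop k t) - Num.max t 0| <= A.
Proof.
move=> aA; have A0 : 0 <= A by apply: le_trans (ltW (a_gt0 k)) (aA k (leqnn k)).
have [t0|t0] := leP t 0.
  have -> : stop k t = k.
    by apply/eqP; rewrite eqn_leq stop_ge stop_le // clock_id.
  by rewrite clock_id subrr normr0.
rewrite ger0_norm ?subr_ge0 ?clock_stop_ge // lerBlDl.
have := @clock_lt_stop k t; have := clock_stop_ge k t; have := stop_ge k t.
case: (stop k t) => [|l]; first by rewrite leqn0 => /eqP ->; rewrite clock_id leNgt t0.
rewrite leq_eqVlt => /orP[/eqP<-|]; first by rewrite clock_id leNgt t0.
rewrite ltnS => kl _ /(_ l kl (ltnSn l)) /ltW lt.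
by rewrite (clockD kl (leqnSn l)) clock1 lerD // aA.
Qed.

Hypothesis a_cvg0 : a k @[k --> \oo] --> 0.

Lemma clock_stop_cvg t : clock k (stop k t) @[k --> \oo] --> Num.max t 0.
Proof.
apply/cvgrPdist_le => e e0; move/cvgrPdist_le : a_cvg0 => /(_ e e0)[N _ aN].
exists N => // k /= Nk; rewrite distrC; apply: clock_stop_dist => i ki.
by have := aN i (leq_trans Nk ki); rewrite sub0r normrN gtr0_norm.
Qed.

Lemma cvg0_bounded : exists2 A, 0 < A & forall k, a k <= A.
Proof.
have /cvg_seq_bounded/pinfty_ex_gt0[A A0 aA] : cvgn a by apply/cvg_ex; exists 0.
by exists A => // k; apply: le_trans (ler_norm _) (aA k Logic.I).
Qed.

End Clock.

Section LimitPath.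
Context {R : realType} {m : nat} {J : finType}.
Variables (C : J -> set 'rV[R]_m) (g : J -> 'rV[R]_m -> R).
Hypothesis C_closed : forall j, closed (C j).
Hypothesis g2 : forall j, contdiff 2 (g j).
Variables (a : nat -> R) (x : nat -> 'rV[R]_m) (c : nat -> J) (M V : R).
Hypothesis a_gt0 : forall k, 0 < a k.
Hypothesis a_cvg0 : a k @[k --> \oo] --> 0.
Hypothesis a_divergent : forall k (t : R), exists l, t <= \sum_(k <= i < l) a i.
Hypothesis x_piece : forall k, C (c k) (x k).
Hypothesis x_bounded : forall k, `|x k| <= M.
Hypothesis x_step : forall k, `|x k.+1 - x k| <= V * a k.
Local Notation clock := (clock a).
Local Notation stop := (stop a_gt0 a_divergent).
Implicit Types (s t u : R).

Definition noise (k : nat) : 'rV[R]_m :=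
  x k.+1 - x k + a k *: gradient (g (c k)) (x k).

Hypothesis noise_cvg0 : forall t,
  \sum_(k <= i < stop k t) noise i @[k --> \oo] --> (0 : 'rV[R]_m).

Let V_ge0 : 0 <= V.
Proof. by have := le_trans (normr_ge0 _) (x_step 0); rewrite pmulr_lge0. Qed.

Lemma path_length k l : (k <= l)%N -> `|x l - x k| <= V * clock k l.
Proof.
move=> kl; rewrite -(telescope_sumr x kl) mulr_sumr.
by apply: le_trans (ler_norm_sum _ _ _) _; apply: ler_sum.
Qed.

Lemma path_dist k l n : (k <= l)%N -> (k <= n)%N ->
  `|x l - x n| <= V * `|clock k l - clock k n|.
Proof.
move=> kl kn; wlog nl : l n kl kn / (n <= l)%N => [wlog_nl|].
  have [nl|/ltnW ln] := leqP n l; first exact: wlog_nl.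
  by rewrite distrC [`|clock k l - _|]distrC; exact: wlog_nl.
rewrite (clockD a kn nl) [clock k n + _]addrC addrK (ger0_norm (clock_ge0 a_gt0 _ _)).
exact: path_length.
Qed.

Definition occupation j (k l : nat) : R := \sum_(k <= i < l | c i == j) a i.

Lemma occupation_ge0 j k l : 0 <= occupation j k l.
Proof. by apply: sumr_ge0 => i _; exact: ltW. Qed.

Lemma occupationD j k l n : (k <= l)%N -> (l <= n)%N ->
  occupation j k n = occupation j k l + occupation j l n.
Proof. by move=> kl ln; rewrite /occupation (big_cat_nat kl ln). Qed.

Lemma sum_occupation k l (F : J -> R) :
  \sum_j occupation j k l * F j = \sum_(k <= i < l) a i * F (c i).
Proof.
under eq_bigr do rewrite mulr_suml.
rewrite (exchange_big_dep xpredT) //=; apply: eq_bigr => i _.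
by rewrite (big_pred1 (c i)) // => j; rewrite eq_sym.
Qed.

Lemma clock_occupation k l : \sum_j occupation j k l = clock k l.
Proof.
have := sum_occupation k l (fun=> 1); under eq_bigr do rewrite mulr1.
by under [RHS]eq_bigr do rewrite mulr1.
Qed.

Variables (U : set_system nat) (UU : free_ultrafilter U).

Definition limit_path t : 'rV[R]_m := lim (x (stop k t) @[k --> U]).

Definition limit_occupation j t : R := lim (occupation j k (stop k t) @[k --> U]).

Lemma cvg_stop t : x (stop k t) @[k --> U] --> limit_path t.
Proof.
have [l xl] := @ultra_cvg_rV _ U _ R m (fun k => x (stop k t)) M (fun k => x_bounded _).
by apply/cvg_ex; exists l.
Qed.

Lemma cvg_clock_stop t : clock k (stop k t) @[k --> U] --> Num.max t 0.
Proof. by apply: cvg_free_ultrafilter; exact: clock_stop_cvg. Qed.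

Lemma cvg_occupation j t : occupation j k (stop k t) @[k --> U] --> limit_occupation j t.
Proof.
have [A A0 aA] := cvg0_bounded a_cvg0.
have [k|l occl] := @ultra_cvg_real _ U _ R (fun k => occupation j k (stop k t)) 0 (Num.max t 0 + A).
  rewrite occupation_ge0 /=; apply: (@le_trans _ _ (clock k (stop k t))).
    by rewrite -clock_occupation (bigD1 j) //= lerDl sumr_ge0 // => i _; exact: occupation_ge0.
  by rewrite -lerBlDl (le_trans (ler_norm _)) // clock_stop_dist.
by apply/cvg_ex; exists l.
Qed.

Lemma cvg_limit_path (i : nat -> nat) t : (forall k, (k <= i k)%N) ->
  clock k (i k) @[k --> U] --> t -> x (i k) @[k --> U] --> limit_path t.
Proof.
move=> ki clock_i.
have t0 : 0 <= t by apply: (cvgr_to_ge clock_i); apply: filterE => k; exact: clock_ge0.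
apply: cvg_sub0 (@cvg_stop t); apply/norm_cvg0P.
have bound : V * `|clock k (i k) - clock k (stop k t)| @[k --> U] --> V * `|t - Num.max t 0|.
  apply: cvgM; first exact: cvg_cst.
  by apply: cvg_norm; apply: cvgB; [exact: clock_i|exact: cvg_clock_stop].
rewrite max_l // subrr normr0 mulr0 in bound.
apply: (squeeze_cvgr _ (cvg_cst 0) bound); apply: filterE => k.
by rewrite normr_ge0 path_dist // stop_ge.
Qed.

Lemma limit_path_bounded t : `|limit_path t| <= M.
Proof. by apply: (cvgr_to_le (cvg_norm (@cvg_stop t))); exact: filterE. Qed.

Lemma limit_path_lipschitz s t : `|limit_path t - limit_path s| <= V * `|t - s|.
Proof.
have bound : V * `|clock k (stop k t) - clock k (stop k s)| @[k --> U] -->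
    V * `|Num.max t 0 - Num.max s 0|.
  by apply: cvgM; [exact: cvg_cst|apply: cvg_norm; apply: cvgB; exact: cvg_clock_stop].
apply: (@le_trans _ _ (V * `|Num.max t 0 - Num.max s 0|)).
  apply: ler_cvg_to (cvg_norm (cvgB (@cvg_stop t) (@cvg_stop s))) bound _.
  by apply: filterE => k; rewrite path_dist // stop_ge.
apply: ler_wpM2l => //; rewrite !maxEle ler_norml.
by have := ler_norm (t - s); have := ler_norm (- (t - s)); rewrite normrN;
  case: (leP t 0); case: (leP s 0); lra.
Qed.

Lemma limit_occupation_le j s t : s <= t -> limit_occupation j s <= limit_occupation j t.
Proof.
move=> st; apply: ler_cvg_to (@cvg_occupation j s) (@cvg_occupation j t) _.
apply: filterE => k; rewrite (occupationD j (stop_ge _ _ k s) (stop_mono _ _ k st)).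
by rewrite lerDl occupation_ge0.
Qed.

Lemma limit_occupation_total t : 0 <= t -> \sum_j limit_occupation j t = t.
Proof.
move=> t0; have occ : \sum_j occupation j k (stop k t) @[k --> U] --> \sum_j limit_occupation j t.
  by apply: cvg_sum => j; exact: cvg_occupation.
apply: (cvg_unique _ occ) => //.
rewrite /=; under eq_cvg do rewrite clock_occupation.
by have := @cvg_clock_stop t; rewrite max_l.
Qed.

Lemma path_increment : exists2 G, 0 <= G & forall i p q, (p <= q)%N ->
  `|x q 0 i - x p 0 i + \sum_j occupation j p q * partial i (g j) (x p)|
    <= `|(\sum_(p <= l < q) noise l) 0 i| + G * clock p q ^+ 2.
Proof.
have : \forall L \near +oo, forall (j : J) (i : 'I_m) y z, `|y| <= M -> `|z| <= M ->
    `|partial i (g j) z - partial i (g j) y| <= L * `|z - y|.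
  by do 2!apply: filter_forall => ?; apply: contdiff1_near_lipschitz; exact: contdiff_partial.
move=> /pinfty_ex_gt0[L L0 gL]; exists (L * V) => [|i p q pq]; first by rewrite mulr_ge0 // ltW.
rewrite sum_occupation.
have -> : x q 0 i - x p 0 i = (\sum_(p <= l < q) noise l) 0 i
    - \sum_(p <= l < q) a l * partial i (g (c l)) (x l).
  have -> : x q 0 i - x p 0 i = (x q - x p) 0 i by rewrite !mxE.
  rewrite -(telescope_sumr x pq) !summxE -sumrB.
  by apply: eq_bigr => l _; rewrite /noise !mxE addrK.
rewrite -addrA (le_trans (ler_normD _ _)) // lerD2l.
rewrite addrC -sumrB; apply: le_trans (ler_norm_sum _ _ _) _.
rewrite expr2 mulrA [leRHS]mulrC {1}/clock mulr_suml big_seq [leRHS]big_seq.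
apply: ler_sum => l; rewrite mem_index_iota => /andP[pl lq].
rewrite -mulrBr normrM (gtr0_norm (a_gt0 l)) ler_pM2l // distrC.
apply: le_trans (gL _ _ _ _ (x_bounded p) (x_bounded l)) _.
rewrite -mulrA ler_pM2l //; apply: le_trans (path_length pl) _; apply: ler_wpM2l => //.
exact: (clock_le a_gt0 pl (ltnW lq)).
Qed.

Section Windows.
Variables s t : R.
Hypotheses (s_ge0 : 0 <= s) (s_le_t : s <= t).
Let stop_st k := stop_mono a_gt0 a_divergent k s_le_t.

Lemma cvg_clock_window : clock (stop k s) (stop k t) @[k --> U] --> t - s.
Proof.
under eq_cvg => k do rewrite -[clock _ _](addKr (clock k (stop k s))) -clockD ?stop_ge // addrC.
rewrite -{1}(max_l (le_trans s_ge0 s_le_t)) -{1}(max_l s_ge0).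
by apply: cvgB; exact: cvg_clock_stop.
Qed.

Lemma cvg_occupation_window j : occupation j (stop k s) (stop k t) @[k --> U] -->
  limit_occupation j t - limit_occupation j s.
Proof.
under eq_cvg => k do rewrite -[occupation _ _ _](addKr (occupation j k (stop k s)))
  -occupationD ?stop_ge // addrC.
by apply: cvgB; exact: cvg_occupation.
Qed.

Lemma cvg_noise_window : \sum_(stop k s <= l < stop k t) noise l @[k --> U] --> (0 : 'rV[R]_m).
Proof.
have lim : \sum_(k <= l < stop k t) noise l - \sum_(k <= l < stop k s) noise l @[k --> U] -->
    (0 - 0 : 'rV[R]_m).
  by apply: cvgB; apply: cvg_free_ultrafilter; exact: noise_cvg0.
rewrite subrr in lim; apply: cvg_trans lim; apply: near_eq_cvg; apply: filterE => k.
by rewrite (big_cat_nat (stop_ge _ _ k s) (stop_st k)) /= addrAC subrr add0r.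
Qed.

End Windows.

Lemma limit_path_inclusion : exists E, forall s t i, 0 <= s -> s <= t ->
  `|limit_path t 0 i - limit_path s 0 i +
    \sum_j (limit_occupation j t - limit_occupation j s) * partial i (g j) (limit_path s)|
  <= E * (t - s) ^+ 2.
Proof.
have [E E0 incr] := path_increment; exists E => s t i s0 st.
have lhs : `|x (stop k t) 0 i - x (stop k s) 0 i +
      \sum_j occupation j (stop k s) (stop k t) * partial i (g j) (x (stop k s))| @[k --> U] -->
    `|limit_path t 0 i - limit_path s 0 i +
      \sum_j (limit_occupation j t - limit_occupation j s) * partial i (g j) (limit_path s)|.
  apply: cvg_norm; apply: cvgD; first by apply: cvgB; apply: cvg_coord; exact: cvg_stop.
  apply: cvg_sum => j; apply: cvgM; first exact: cvg_occupation_window.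
  have cp : continuous (partial i (g j)) by apply: contdiff_continuous; exact: contdiff_partial.
  exact: (cvg_comp _ _ (@cvg_stop s) (cp _)).
have rhs : `|(\sum_(stop k s <= l < stop k t) noise l) 0 i| +
    E * clock (stop k s) (stop k t) ^+ 2 @[k --> U] --> `|(0 : 'rV[R]_m) 0 i| + E * (t - s) ^+ 2.
  apply: cvgD; first by apply: cvg_norm; apply: cvg_coord; exact: cvg_noise_window.
  by apply: cvgM; [exact: cvg_cst|rewrite expr2; apply: cvgM; exact: cvg_clock_window].
rewrite mxE normr0 add0r in rhs; apply: ler_cvg_to lhs rhs _.
by apply: filterE => k; exact: (incr i _ _ (stop_mono _ _ k st)).
Qed.

Lemma limit_path_covered t : exists j, C j (limit_path t).
Proof.
have [j cj] := @ultra_constant _ U _ J (fun k => c (stop k t)).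
exists j; have Cj : \forall k \near U, C j (x (stop k t)) by apply: filterS cj => k <-.
exact: (@closed_cvg nat 'rV[R]_m U _ (fun k => x (stop k t)) _ (@C_closed j) Cj _ (@cvg_stop t)).
Qed.

Lemma cvg_clock_between (i : nat -> nat) t : (forall k, (k <= i k)%N) ->
  (\forall k \near U, clock k (i k) <= t) ->
  exists2 u, clock k (i k) @[k --> U] --> u & u <= t.
Proof.
move=> ki it; have [u minu] : exists u, Num.min (clock k (i k)) t @[k --> U] --> u.
  apply: (@ultra_cvg_real _ U _ R _ (Num.min 0 t) t) => k.
  by rewrite le_min !ge_min clock_ge0 // !lexx !orbT.
have clocku : clock k (i k) @[k --> U] --> u.
  by apply: cvg_trans minu; apply: near_eq_cvg; apply: filterS it => k kt; rewrite min_l.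
by exists u => //; exact: cvgr_to_le clocku it.
Qed.

Lemma limit_path_visit j s t : 0 <= s -> s <= t ->
  limit_occupation j s < limit_occupation j t ->
  exists2 u, s <= u <= t & C j (limit_path u).
Proof.
move=> s0 st spent.
have visits : \forall k \near U, exists2 l, (stop k s <= l < stop k t)%N & c l = j.
  have occ : occupation j k (stop k t) - occupation j k (stop k s) @[k --> U] -->
      limit_occupation j t - limit_occupation j s by apply: cvgB; exact: cvg_occupation.
  move: spent; rewrite -subr_gt0 => /(cvgr_gt _ occ); apply: filterS => k.
  rewrite subr_gt0 (occupationD j (stop_ge _ _ k s) (stop_mono _ _ k st)) ltrDl => occ0.
  apply: contrapT => novisit; move: occ0; rewrite /occupation big_nat_cond big_pred0 ?ltxx // => l.
  by apply/negP => /andP[lst /eqP cl]; apply: novisit; exists l.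
have /choice[i iP] : forall k, exists l, (stop k s <= l)%N /\
    ((exists2 l, (stop k s <= l < stop k t)%N & c l = j) -> (l < stop k t)%N /\ c l = j).
  move=> k; have [[l /andP[sl lt] cl]|novisit] :=
      pselect (exists2 l, (stop k s <= l < stop k t)%N & c l = j).
    by exists l.
  by exists (stop k s); split=> // /novisit.
have si k : (stop k s <= i k)%N by case: (iP k).
have ki k : (k <= i k)%N by exact: leq_trans (stop_ge _ _ k s) (si k).
have late k : s <= clock k (i k).
  apply: le_trans (clock_stop_ge a_gt0 a_divergent k s) _.
  exact: clock_le (stop_ge a_gt0 a_divergent k s) (si k).
have [u clocku ut] : exists2 u, clock k (i k) @[k --> U] --> u & u <= t.
  apply: cvg_clock_between => //; apply: filterS visits => k /(proj2 (iP k))[it _].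
  exact: ltW (clock_lt_stop (ki k) it).
exists u; first by rewrite ut (cvgr_to_ge clocku) //; exact: filterE.
have Cj : \forall k \near U, C j (x (i k)) by apply: filterS visits => k /(proj2 (iP k))[_ <-].
exact: (@closed_cvg nat 'rV[R]_m U _ (x \o i) _ (@C_closed j) Cj _ (cvg_limit_path ki clocku)).
Qed.

Lemma limit_path_curve : exists E, limit_curve C g M V E limit_path limit_occupation.
Proof.
have [E inclusion] := limit_path_inclusion; exists E; split=> //.
- exact: limit_path_bounded.
- exact: limit_path_lipschitz.
- exact: limit_occupation_le.
- by move=> s t s0 st; rewrite sumrB !limit_occupation_total // (le_trans s0).
- exact: limit_path_visit.
- exact: limit_path_covered.
Qed.

End LimitPath.

Lemma frequently_last_exit (P Q : set nat) : frequently P -> frequently Q ->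
  (forall k, P k -> ~ Q k) ->
  frequently [set k | P k /\ exists l, [/\ (k < l)%N, Q l & forall i, (k < i <= l)%N -> ~ P i]].
Proof.
move=> freqP freqQ PQ N; have [k0 Nk0 Pk0] := freqP N; have [l k0l Ql] := freqQ k0.
have exP : exists k, (k <= l)%N && `[< P k >] by exists k0; rewrite k0l; apply/asboolP.
have boundP k : (k <= l)%N && `[< P k >] -> (k <= l)%N by case/andP.
case: (ex_maxnP exP boundP) => k /andP[kl /asboolP Pk] kmax; exists k.
  by apply: leq_trans Nk0 _; apply: kmax; rewrite k0l; apply/asboolP.
split=> //; exists l; split=> //.
  by rewrite ltn_neqAle kl andbT; apply/eqP => kE; apply: (PQ k) => //; rewrite kE.
move=> i /andP[ki il] Pi; have := kmax i; rewrite il leqNgt ki.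
by move/(_ (introT (asboolP _) Pi)).
Qed.

Lemma cvg_free_ultrafilters (T : topologicalType) (u : nat -> T) (l : T) :
  (forall U, free_ultrafilter U -> u k @[k --> U] --> l) -> u k @[k --> \oo] --> l.
Proof.
move=> ul B lB; apply: contrapT => /not_near_frequently/frequently_free_ultrafilter[U UU UnB].
have UB : U (u @^-1` B) := ul U UU B lB.
by have [k []] := filter_ex (filterI UnB UB).
Qed.

Section Convergence.
Context {R : realType} {m' : nat} {J : finType}.
Local Notation m := m'.+1.
Variables (C : J -> set 'rV[R]_m) (g : J -> 'rV[R]_m -> R) (f : 'rV[R]_m -> R).
Hypothesis C_closed : forall j, closed (C j).
Hypothesis g2 : forall j, contdiff 2 (g j).
Hypothesis gm : forall j, contdiff m (g j).
Hypothesis f_continuous : continuous f.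
Hypothesis f_piece : forall j y, C j y -> f y = g j y.
Variables (a : nat -> R) (x : nat -> 'rV[R]_m) (c : nat -> J) (M V : R).
Hypothesis M_gt0 : 0 < M.
Hypothesis a_gt0 : forall k, 0 < a k.
Hypothesis a_cvg0 : a k @[k --> \oo] --> 0.
Hypothesis a_divergent : forall k (t : R), exists l, t <= \sum_(k <= i < l) a i.
Hypothesis x_piece : forall k, C (c k) (x k).
Hypothesis x_bounded : forall k, `|x k| <= M.
Hypothesis x_step : forall k, `|x k.+1 - x k| <= V * a k.
Hypothesis noise_cvg0 : forall t,
  \sum_(k <= i < stop a_gt0 a_divergent k t) noise g a x c i @[k --> \oo] --> (0 : 'rV[R]_m).
Local Notation clock := (clock a).
Local Notation stop := (stop a_gt0 a_divergent).
Local Notation limit_path := (limit_path x a_gt0 a_divergent).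

Section Ultrafilter.
Variables (U : set_system nat) (UU : free_ultrafilter U).

Let gam_curve := limit_path_curve C_closed g2 a_cvg0 x_piece x_bounded x_step noise_cvg0 UU.

Lemma cvg_limit_path0 : x k @[k --> U] --> limit_path U 0.
Proof.
apply: (cvg_limit_path a_cvg0 x_bounded x_step UU (i := id)) => //.
by apply: cvg_near_cst; apply: filterE => k; rewrite clock_id.
Qed.

Lemma cvg_limit_path0S : x k.+1 @[k --> U] --> limit_path U 0.
Proof.
apply: (cvg_limit_path a_cvg0 x_bounded x_step UU (i := S)) => //.
by under eq_cvg do rewrite clock1; exact: cvg_free_ultrafilter.
Qed.

Lemma cvg_f_path (v : nat -> 'rV[R]_m) y : v k @[k --> U] --> y -> f (v k) @[k --> U] --> f y.
Proof. by move=> vy; exact: (cvg_comp _ _ vy (@f_continuous y)). Qed.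

Lemma limit_path_descent t : 0 <= t -> f (limit_path U t) <= f (limit_path U 0).
Proof.
have [E curve] := gam_curve; rewrite le_eqVlt => /orP[/eqP<-//|t0].
rewrite -subr_le0; apply: le_trans (curve_descent g2 f_continuous f_piece curve t0) _.
by rewrite mulNr oppr_le0 divr_ge0 ?(ltW t0) // sumr_ge0 // => i _; exact: sqr_ge0.
Qed.

Lemma limit_path_strict_descent : ~ crit_point C g (limit_path U 0) ->
  exists2 T, 0 < T & f (limit_path U T) < f (limit_path U 0).
Proof. by have [E curve] := gam_curve; exact: (curve_strict_descent C_closed curve). Qed.

Lemma crit_point_value y : `|y| <= M -> crit_point C g y -> crit_value g M (f y).
Proof.
by move=> yM [l [lw lC lg]]; exists y, l; split=> // j /lC Cj; rewrite (f_piece Cj).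
Qed.

(* After k the values stay above r until they reach r', so the limit path,
   which starts on the level r, can neither pass below r nor reach r'. *)
Lemma no_ultra_upcrossing (r r' : R) (l : nat -> nat) : r < r' -> ~ crit_value g M r ->
  (forall k, (k <= l k)%N) ->
  (\forall k \near U, [/\ f (x k) <= r, (k < l k)%N, r' <= f (x (l k)) &
    forall i, (k < i <= l k)%N -> r < f (x i)]) -> False.
Proof.
move=> rr' ncrit kl upcross; pose gam := limit_path U.
have gam0 : f (gam 0) = r.
  apply/eqP; rewrite eq_le; apply/andP; split.
    by apply: (cvgr_to_le (cvg_f_path cvg_limit_path0)); apply: filterS upcross => k [].
  apply: (cvgr_to_ge (cvg_f_path cvg_limit_path0S)); apply: filterS upcross => k [_ kl' _ above].
  by apply: ltW; apply: above; rewrite ltnSn.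
have gamM : `|gam 0| <= M by exact: limit_path_bounded.
have [|T T0] := limit_path_strict_descent.
  by move/(crit_point_value gamM); rewrite gam0.
have stopT : x (stop k T) @[k --> U] --> gam T by exact: (cvg_stop x_bounded UU).
rewrite -/gam gam0 => /(cvgr_lt _ (cvg_f_path stopT)) below.
have early : \forall k \near U, clock k (l k) <= T.
  apply: filterS2 below upcross => k fT [_ _ _ above].
  rewrite leNgt; apply/negP => Tl; move: fT; rewrite ltNge => /negP; apply; apply: ltW.
  apply: above; rewrite stop_le //; last exact: ltW.
  rewrite ltn_neqAle stop_ge !andbT; apply/eqP => kstop.
  by have := clock_stop_ge a_gt0 a_divergent k T; rewrite -kstop clock_id leNgt T0.
have [u clocku _] := cvg_clock_between a_gt0 UU kl early.
have u0 : 0 <= u by apply: (cvgr_to_ge clocku); apply: filterE => k; exact: clock_ge0.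
have xl : x (l k) @[k --> U] --> gam u.
  exact: (cvg_limit_path a_cvg0 x_bounded x_step UU kl clocku).
have : r' <= f (gam u) by apply: (cvgr_to_ge (cvg_f_path xl)); apply: filterS upcross => k [].
by move=> /le_trans/(_ (limit_path_descent u0)); rewrite gam0 leNgt rr'.
Qed.

End Ultrafilter.

Lemma no_upcrossing (r r' : R) : ~ crit_value g M r -> r < r' ->
  frequently [set k | f (x k) <= r] -> frequently [set k | r' <= f (x k)] -> False.
Proof.
move=> ncrit rr' low high.
have [k /= fr|U UU exits] := frequently_free_ultrafilter (frequently_last_exit low high _).
  by rewrite leNgt => /negP; apply; exact: le_lt_trans fr rr'.
have /choice[l lP] : forall k, exists l, (k <= l)%N /\
    ((exists l, [/\ (k < l)%N, r' <= f (x l) & forall i, (k < i <= l)%N -> ~ f (x i) <= r]) ->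
     [/\ (k < l)%N, r' <= f (x l) & forall i, (k < i <= l)%N -> ~ f (x i) <= r]).
  move=> k; have [[l lP]|none] := pselect (exists l, [/\ (k < l)%N, r' <= f (x l) &
      forall i, (k < i <= l)%N -> ~ f (x i) <= r]).
    by exists l; split=> //; apply: ltnW; case: lP.
  by exists k.
apply: (no_ultra_upcrossing UU rr' ncrit (l := l)) => [k|]; first by case: (lP k).
apply: filterS exits => k [fk /(proj2 (lP k))[kl fl above]]; split=> // i /above.
by move/negP; rewrite -ltNge.
Qed.

Lemma ultra_value_le U1 U2 (l1 l2 : R) : free_ultrafilter U1 -> free_ultrafilter U2 ->
  f (x k) @[k --> U1] --> l1 -> f (x k) @[k --> U2] --> l2 -> l2 <= l1.
Proof.
move=> UU1 UU2 fl1 fl2; rewrite leNgt; apply/negP => l12.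
have gap : l1 + (l2 - l1) / 3 < l2 - (l2 - l1) / 3 by lra.
have [r /andP[r1 r2] ncrit] := sard gm M_gt0 gap.
apply: (@no_upcrossing r (l2 - (l2 - l1) / 4) ncrit); first by lra.
  by apply: (free_ultrafilter_frequently UU1); apply: (cvgr_le _ fl1); lra.
by apply: (free_ultrafilter_frequently UU2); apply: (cvgr_ge _ fl2); lra.
Qed.

Lemma values_cvg : exists l : R, f (x k) @[k --> \oo] --> l.
Proof.
have /pinfty_ex_gt0[B B0 fB] := continuous_near_bounded M f_continuous.
have value U : free_ultrafilter U -> exists l, f (x k) @[k --> U] --> (l : R).
  move=> UU; apply: (@ultra_cvg_real _ U _ R _ (- B) B) => k.
  by rewrite -ler_norml; exact: fB.
have [U0 UU0] := free_ultrafilter_exists; have [l fl] := value U0 UU0; exists l.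
apply: cvg_free_ultrafilters => U UU; have [l' fl'] := value U UU.
suff -> : l = l' by [].
by apply/eqP; rewrite eq_le (ultra_value_le UU UU0 fl') // (ultra_value_le UU0 UU fl).
Qed.

Lemma ultra_limit_crit U y : free_ultrafilter U -> x k @[k --> U] --> y -> crit_point C g y.
Proof.
move=> UU xy; apply: contrapT => ncrit; have [l fl] := values_cvg.
have y0 : y = limit_path U 0 by exact: (cvg_unique _ xy (cvg_limit_path0 UU)).
rewrite y0 in ncrit; have [T T0] := limit_path_strict_descent UU ncrit.
have value v t : (forall k, (k <= v k)%N) -> x (v k) @[k --> U] --> limit_path U t ->
    f (limit_path U t) = l.
  move=> kv /cvg_f_path xt; apply: (cvg_unique _ xt) => //.
  apply: cvg_free_ultrafilter; move=> A /fl[N _ NA]; exists N => // k /= Nk.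
  by apply: NA; exact: leq_trans (kv k).
rewrite (value id 0) ?(value (stop^~ T) T) ?ltxx // => [k||]; first exact: stop_ge.
- exact: cvg_stop.
- exact: cvg_limit_path0.
Qed.

End Convergence.

Section LimitPoints.
Context {R : realType} {m : nat}.
Variable x : nat -> 'rV[R]_m.
Implicit Types (y : 'rV[R]_m) (U : set_system nat).

Lemma enorm_le y : enorm y <= m%:R * `|y|.
Proof.
rewrite /enorm -[leRHS]ger0_norm ?mulr_ge0 // -sqrtr_sqr ler_wsqrtr // exprMn.
apply: (@le_trans _ _ (\sum_(i < m) `|y| ^+ 2)).
  apply: ler_sum => i _; rewrite -real_normK ?num_real // ler_sqr ?nnegrE //.
  exact: ler_coord_norm.
rewrite sumr_const card_ord -[leLHS]mulr_natl ler_wpM2r ?sqr_ge0 //.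
by rewrite -natrX ler_nat; case: (m) => // k; rewrite expnS leq_pmulr.
Qed.

Lemma norm_le_enorm y : `|y| <= enorm y.
Proof.
apply/rV_norm_leP; first exact: sqrtr_ge0.
move=> i; rewrite -sqrtr_sqr ler_wsqrtr // (bigD1 i) //= lerDl.
by apply: sumr_ge0 => j _; exact: sqr_ge0.
Qed.

Lemma limit_points_frequently y :
  (forall e, 0 < e -> frequently [set k | `|x k - y| < e]) -> limit_points x y.
Proof.
move=> freq; have /choice[h hP] : forall Nn : nat * nat,
    exists k, (Nn.1 <= k)%N /\ `|x k - y| < Nn.2.+1%:R^-1.
  by move=> [N n]; have [|k ? ?] := freq n.+1%:R^-1 _ N; [rewrite invr_gt0|exists k].
pose phi := fix phi n := if n is n'.+1 then h ((phi n').+1, n) else h (0%N, 0%N).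
exists phi; split.
  apply: homo_ltn => [? ? ?|k]; first exact: ltn_trans.
  by have [] := hP ((phi k).+1, k.+1).
have phiP n : `|x (phi n) - y| < n.+1%:R^-1.
  by case: n => [|n] /=; [have [] := hP (0%N, 0%N)|have [] := hP ((phi n).+1, n.+1)].
apply/cvgrPdist_lt => e e0; near=> n; rewrite distrC; apply: lt_trans (phiP n) _.
by near: n; exact: near_infty_natSinv_lt (PosNum e0).
Unshelve. all: by end_near. Qed.

Lemma limit_pointsP y :
  limit_points x y <-> exists2 U, free_ultrafilter U & x k @[k --> U] --> y.
Proof.
split=> [[phi [phi_mono xy]]|[U UU xy]]; last first.
  apply: limit_points_frequently => e e0; apply: (free_ultrafilter_frequently UU).
  by move/cvgrPdist_lt: xy => /(_ e e0); apply: filterS => k; rewrite distrC.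
have [U [UU phiU]] := ultraFilterLemma (fmap_proper_filter phi (F := \oo) _).
exists U => [|B yB]; last by apply: phiU; exact: xy.
split=> // B [N _ NB]; apply: phiU; exists N => // k /= Nk; apply: NB => /=.
apply: leq_trans Nk _; elim: k => [//|k IH]; apply: leq_ltn_trans IH _.
exact: phi_mono.
Qed.

Lemma closed_limit_points : closed (limit_points x).
Proof.
move=> y cly; apply: limit_points_frequently => e e0 N.
have e2 : 0 < e / 2 by rewrite divr_gt0.
have [z [/limit_pointsP[U UU /cvgrPdist_lt/(_ _ e2) xz] yz]] := cly _ (nbhsx_ballx y _ e2).
have [k Nk /= xkz] := free_ultrafilter_frequently UU xz N; exists k => //=.
rewrite -(subrKA z) (le_lt_trans (ler_normD _ _)) // [ltRHS]splitr ltrD // distrC //.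
by move: yz; rewrite -ball_normE.
Qed.

Variable M : R.
Hypothesis x_bounded : forall k, `|x k| <= M.

Lemma dist_to_cvg0 (S : set 'rV[R]_m) :
  (forall U y, free_ultrafilter U -> x k @[k --> U] --> y -> S y) ->
  dist_to (x k) S @[k --> \oo] --> 0%E.
Proof.
move=> limS; apply: cvg_free_ultrafilters => U UU.
have [y xy] := @ultra_cvg_rV _ U _ R m x M x_bounded.
have Sy : S y by exact: limS UU xy.
apply: (@squeeze_cvge _ _ _ _ (cst 0%E) _ (fun k => (m%:R * `|x k - y|)%:E)).
- apply: filterE => k; apply/andP; split.
    by apply: le_ereal_inf_tmp => _ [z Sz <-]; rewrite lee_fin sqrtr_ge0.
  apply: (@le_trans _ _ (enorm (x k - y))%:E); last by rewrite lee_fin enorm_le.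
  by apply: ereal_inf_lbound; exists y.
- exact: cvg_cst.
apply: cvg_EFin; first exact: filterE.
have lim : m%:R * `|x k - y| @[k --> U] --> m%:R * `|y - y|.
  by apply: cvgM; [exact: cvg_cst|apply: cvg_norm; apply: cvgB => //; exact: cvg_cst].
by rewrite subrr normr0 mulr0 in lim.
Qed.

Hypothesis x_step_cvg0 : x k.+1 - x k @[k --> \oo] --> (0 : 'rV[R]_m).

Lemma connected_limit_points : connected (limit_points x).
Proof.
set L := limit_points x; move=> B [y By] [G opG BG] [F clF BF].
apply/seteqP; split=> z; first by rewrite BG => -[].
move=> Lz; apply: contrapT => nBz; pose K := L `&` ~` G.
have Bz k : B k -> L k /\ F k by rewrite BF.
have sepBK : @uniform_separator 'rV[R]_m B K.
  apply: normal_uniform_separator.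
  - exact: pseudometric_normal.
  - by rewrite BF; apply: closedI => //; exact: closed_limit_points.
  - by apply: closedI; [exact: closed_limit_points|rewrite closedC].
  - by rewrite /K BG; apply/seteqP; split=> // k [[_ Gk] [_]].
pose h := @Urysohn _ R B K; have ch : continuous h by exact: Urysohn_continuous.
have hB k : B k -> h k = 0 by move=> Bk; apply: (Urysohn_sub0 sepBK); exists k.
have hK k : K k -> h k = 1 by move=> Kk; apply: (Urysohn_sub1 sepBK); exists k.
have hx U k : free_ultrafilter U -> x k @[k --> U] --> k -> h (x k) @[k --> U] --> h k.
  by move=> UU xk; exact: (cvg_comp _ _ xk (ch k)).
have [U0 UU0 /(hx _ _ UU0)] := (limit_pointsP y).1 (Bz y By).1; rewrite hB // => h0.
have Kz : K z by split=> // Gz; apply: nBz; rewrite BG.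
have [U1 UU1 /(hx _ _ UU1)] := (limit_pointsP z).1 Lz; rewrite hK // => h1.
have low : frequently [set k | h (x k) < 1 / 2].
  by apply: (free_ultrafilter_frequently UU0); apply: (cvgr_lt _ h0); lra.
have high : frequently [set k | 1 / 2 <= h (x k)].
  by apply: (free_ultrafilter_frequently UU1); apply: (cvgr_ge _ h1); lra.
have [k /= lowk|U UU cross] := frequently_free_ultrafilter (frequently_last_exit low high _).
  by rewrite leNgt lowk.
have [l xl] := @ultra_cvg_rV _ U _ R m x M x_bounded.
have xSl : x k.+1 @[k --> U] --> l.
  by apply: cvg_sub0 xl; exact: cvg_free_ultrafilter.
have hl : h l = 1 / 2.
  apply/eqP; rewrite eq_le; apply/andP; split.
    by apply: (cvgr_to_le (hx U l UU xl)); apply: filterS cross => k [/ltW].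
  have hSl : h (x k.+1) @[k --> U] --> h l by exact: (cvg_comp _ _ xSl (ch l)).
  apply: (cvgr_to_ge hSl); apply: filterS cross => k [_ [n [kn _ /(_ k.+1)]]].
  by rewrite ltnSn kn => /(_ isT)/negP; rewrite -leNgt.
have Ll : L l by apply/limit_pointsP; exists U.
have [Gl|nGl] := pselect (G l); move: hl.
  by rewrite hB ?BG // => /eqP; rewrite lt_eqF ?divr_gt0.
by rewrite hK // => /eqP; rewrite gt_eqF // ltr_pdivrMr // mul1r ltr1n.
Qed.

End LimitPoints.

(** * Null sets and step sizes *)

Lemma esum_finType (R : realType) (T : finType) (v : T -> \bar R) : (forall t, 0 <= v t)%E ->
  (\esum_(t in [set: T]) v t = \sum_t v t)%E.
Proof.
move=> v0; rewrite esum_fset //; last exact: finite_finset.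
rewrite (fsbigE (index_enum T)) ?index_enum_uniq // => [|t _]; last by rewrite mem_index_enum.
by apply: eq_bigl => t; apply/mem_set.
Qed.

Section CubeCovers.
Context {R : realType} {m : nat}.
Implicit Types (A B : set 'rV[R]_m) (x : 'rV[R]_m) (e : R).

(* Balls of the sup norm are cubes; the factor 2 ^ m of their volume is dropped. *)
Definition cube_cover A e : Prop := exists (c : nat -> 'rV[R]_m) (r : nat -> R),
  [/\ forall k, 0 <= r k, forall x, A x -> exists k, `|x - c k| <= r k &
      (\esum_(k in [set: nat]) (r k ^+ m)%:E <= e%:E)%E].

Definition cube_null A : Prop := forall e, 0 < e -> cube_cover A e.

Lemma sub_cube_cover A B e : A `<=` B -> cube_cover B e -> cube_cover A e.
Proof. by move=> AB [c [r [r0 cov vol]]]; exists c, r; split=> // x /AB/cov. Qed.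

Lemma cube_cover_le A e e' : e <= e' -> cube_cover A e -> cube_cover A e'.
Proof.
move=> ee [c [r [r0 cov vol]]]; exists c, r; split=> //.
by apply: le_trans vol _; rewrite lee_fin.
Qed.

Lemma sub_cube_null A B : A `<=` B -> cube_null B -> cube_null A.
Proof. by move=> AB nB e /nB; exact: sub_cube_cover. Qed.

End CubeCovers.

Section PositiveDimension.
Context {R : realType} {m' : nat}.
Local Notation m := m'.+1.
Implicit Types (A B : set 'rV[R]_m) (x : 'rV[R]_m) (e : R).

Lemma cube_cover_countable (T : countType) A e (c : T -> 'rV[R]_m) (r : T -> R) :
  (forall t, 0 <= r t) -> (forall x, A x -> exists t, `|x - c t| <= r t) ->
  (\esum_(t in [set: T]) (r t ^+ m)%:E <= e%:E)%E -> cube_cover A e.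
Proof.
move=> r0 cov vol; pose r' n := odflt 0 (omap r (pickle_inv n)).
exists (fun n => odflt 0 (omap c (pickle_inv n))), r'.
split=> [n|x /cov[t xt]|]; first by rewrite /r'; case: pickle_inv => [t|] /=; rewrite ?r0.
  by exists (pickle t); rewrite /r' pickleK_inv.
apply: le_trans vol; rewrite le_eqVlt; apply/orP; left; apply/eqP.
transitivity (\esum_(n in pickle @` [set: T]) (r' n ^+ m)%:E)%E.
  rewrite [RHS]esum_mkcond; apply: eq_esum => n _; case: ifPn => // /negP nT.
  rewrite /r'; case En: (pickle_inv n) => [t|] /=; last by rewrite expr0n.
  exfalso; apply: nT; apply/mem_set; exists t => //.
  by have := @pickle_invK T n; rewrite En.
rewrite esum_image => [|t u _ _]; last exact: (pcan_inj (@pickleK T)).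
by apply: eq_esum => t _; rewrite /r' pickleK_inv.
Qed.

Lemma cube_cover_finite (T : finType) A e (c : T -> 'rV[R]_m) (r : T -> R) :
  (forall t, 0 <= r t) -> (forall x, A x -> exists t, `|x - c t| <= r t) ->
  \sum_t r t ^+ m <= e -> cube_cover A e.
Proof.
move=> r0 cov vol; apply: (cube_cover_countable r0 cov).
rewrite esum_finType => [|t]; last by rewrite lee_fin exprn_ge0.
by rewrite sumEFin lee_fin.
Qed.

Lemma cube_cover_bigcup (F : nat -> set 'rV[R]_m) (v : nat -> R) e :
  (forall n, cube_cover (F n) (v n)) ->
  (\esum_(n in [set: nat]) (v n)%:E <= e%:E)%E -> cube_cover (\bigcup_n F n) e.
Proof.
move=> /choice[c /choice[r cover]] sum_v.
have r0 n k : 0 <= r n k by case: (cover n).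
apply: (@cube_cover_countable (nat * nat)%type _ _ (fun p => c p.1 p.2) (fun p => r p.1 p.2)) => //.
  by move=> x [n _ Fn]; have [_ /(_ x Fn)[k xk] _] := cover n; exists (n, k).
apply: le_trans sum_v; rewrite (_ : [set: nat * nat] = setT `*`` (fun=> setT)); last first.
  by apply/seteqP; split.
rewrite -(esum_esum (a := fun n k => (r n k ^+ m)%:E)) => [|n k _ _]; last first.
  by rewrite lee_fin exprn_ge0.
by apply: le_esum => n _; case: (cover n).
Qed.

Lemma cube_null_bigcup (F : nat -> set 'rV[R]_m) :
  (forall n, cube_null (F n)) -> cube_null (\bigcup_n F n).
Proof.
move=> nF e e0; apply: (@cube_cover_bigcup F (fun n => e / (2 ^ n.+1)%:R)).
  by move=> n; apply: nF; rewrite divr_gt0 // ltr0n expn_gt0.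
rewrite -nneseries_esumT => [|n]; last by rewrite lee_fin divr_ge0 // ltW.
exact: epsilon_trick0 (ltW e0).
Qed.

Lemma cube_null_exists (T : countType) (F : T -> set 'rV[R]_m) :
  (forall t, cube_null (F t)) -> cube_null [set x | exists t, F t x].
Proof.
move=> nF; pose F' n := if pickle_inv n is Some t then F t else set0.
apply: (@sub_cube_null _ _ _ (\bigcup_n F' n)) => [x [t Ft]|].
  by exists (pickle t) => //; rewrite /F' pickleK_inv.
apply: cube_null_bigcup => n; rewrite /F'; case: pickle_inv => [t|]; first exact: nF.
move=> e e0; apply: (@cube_cover_finite void _ _ (fun=> 0) (fun=> 0)) => //.
by rewrite big1 ?ltW // => -[].
Qed.

Lemma cube_nullU A B : cube_null A -> cube_null B -> cube_null (A `|` B).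
Proof.
move=> nA nB; apply: (@sub_cube_null _ _ _ [set x | exists b : bool, (if b then A else B) x]).
  by move=> x [Ax|Bx]; [exists true|exists false].
by apply: cube_null_exists => -[].
Qed.

Lemma near_prod_thicken (s : 'I_m -> R) e : 0 < e ->
  \forall d \near 0^'+, \prod_i (s i + d) < \prod_i s i + e.
Proof.
move=> e0; have : \prod_i (s i + d) @[d --> 0^'+] --> \prod_i (s i + 0).
  apply: cvg_big => [|i _]; first exact: mul_continuous.
  by apply: cvgD; [exact: cvg_cst|apply: cvg_at_right_filter; exact: cvg_id].
under [X in _ --> X]eq_bigr do rewrite addr0.
by move=> /cvgr_lt; apply; rewrite ltrDl.
Qed.

(* Cubes of radius h, thickening every side of the box by 2 * h. *)
Lemma cube_cover_box (a b : 'rV[R]_m) e : (forall i, a 0 i <= b 0 i) -> 0 < e ->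
  cube_cover (box a b) (\prod_i (b 0 i - a 0 i) + e).
Proof.
move=> ab e0; have thin := near_prod_thicken (fun i => b 0 i - a 0 i) e0.
have [d [/= d0 thick]] := filter_ex (filterI (nbhs_right_gt 0) thin).
pose h := d / 2; have h0 : 0 < h by rewrite divr_gt0.
pose S i := b 0 i - a 0 i + d.
pose K i := (Num.truncn (S i / (2 * h))).+1.
have dE : d = 2 * h by rewrite mulrC divfK.
have Sd i : d <= S i by rewrite lerDr subr_ge0.
apply: (@cube_cover_finite {dffun forall i : 'I_m, 'I_(K i)} _ _
  (fun z => \row_i (a 0 i + (2 * (z i)%:R + 1) * h)) (fun=> h)).
- by move=> z; exact: ltW.
- move=> x xab; have kK (i : 'I_m) : (Num.truncn ((x 0 i - a 0 i) / (2 * h))%R < K i)%N.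
    rewrite ltnS le_truncn // ler_pM2r ?invr_gt0 -?dE //.
    by rewrite /S; have /andP[_] := xab i; lra.
  exists [ffun i => Ordinal (kK i)]; apply/rV_norm_leP => [|i]; first exact: ltW.
  by rewrite !mxE ffunE cell_truncn //; case/andP: (xab i).
rewrite sumr_const -mulr_natl; apply: le_trans (ltW thick).
have -> : #|{: {dffun forall i : 'I_m, 'I_(K i)}}|%:R * h ^+ m = \prod_i ((K i)%:R * h).
  rewrite card_dep_ffun big_split /= prodr_const card_ord foldrE big_map big_enum /= natr_prod.
  by congr (_ * _); apply: eq_bigr => i _; rewrite card_ord.
apply: ler_prod => i _; rewrite mulr_ge0 ?(ltW h0) //=.
have q0 : 0 <= S i / (2 * h) by rewrite divr_ge0 -?dE ?(ltW d0) // (le_trans (ltW d0)).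
have -> : (K i)%:R = (Num.truncn (S i / (2 * h)))%:R + 1 :> R by rewrite natr1.
have /andP[+ _] := truncn_itv q0; rewrite ler_pdivlMr -?dE // -/(S i).
by move: (Sd i); rewrite dE; lra.
Qed.

Lemma lebesgue_null_cube_null A : lebesgue_null A -> cube_null A.
Proof.
move=> nA e e0; have e2 : 0 < e / 2 by rewrite divr_gt0.
have : (lebesgue_outer A < (e / 2)%:E)%E by rewrite nA lte_fin.
move=> /ereal_inf_lt[_ [a [b [ab cov ->]]] small].
apply: (sub_cube_cover cov); pose v k := \prod_(i < m) (b k 0 i - a k 0 i).
have v0 k : 0 <= v k by apply: prodr_ge0 => i _; rewrite subr_ge0.
apply: (@cube_cover_bigcup _ (fun k => v k + e / 2 / (2 ^ k.+1)%:R)) => [k|].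
  by apply: cube_cover_box => //; rewrite divr_gt0 // ltr0n expn_gt0.
rewrite -nneseries_esumT => [|k]; last by rewrite lee_fin addr_ge0 // divr_ge0 // ltW.
have := @epsilon_trick R (fun k => (v k)%:E) (e / 2) xpredT (fun k => v0 k) (ltW e2).
by move=> /le_trans; apply; rewrite [in leRHS](splitr e) EFinD leeD2r // ltW.
Qed.

Lemma cube_null_lebesgue_null A : cube_null A -> lebesgue_null A.
Proof.
move=> nA; apply/eqP; rewrite eq_le; apply/andP; split; last first.
  apply: le_ereal_inf_tmp => _ [a [b [ab _ ->]]]; apply: nneseries_ge0 => k _ _.
  by rewrite lee_fin; apply: prodr_ge0 => i _; rewrite subr_ge0.
apply/lee_addgt0Pr => e e0; rewrite add0e.
have [|c [r [r0 cov vol]]] := nA (e / 2 ^+ m); first by rewrite divr_gt0 // exprn_gt0.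
apply: ge_ereal_inf; exists (\sum_(0 <= k <oo) ((2 * r k) ^+ m)%:E)%E; last first.
  under eq_eseriesr do rewrite exprMn EFinM.
  have rm0 k : (0 <= (r k ^+ m)%:E)%E by rewrite lee_fin exprn_ge0.
  rewrite nneseriesZl; last by move=> k _; exact: rm0.
  rewrite nneseries_esumT //.
  rewrite -lee_pdivlMl ?exprn_gt0 // -EFinM mulrC; exact: vol.
exists (fun k => c k - const_mx (r k)), (fun k => c k + const_mx (r k)); split.
- by move=> k i; rewrite !mxE lerD2l ge0_cp // r0.
- move=> x /cov[k xk]; exists k => // i; rewrite !mxE.
  have := le_trans (ler_coord_distl _ _ i) xk; rewrite ler_norml.
  by move: (x 0 i) (c k 0 i) (r k) => ? ? ?; lra.
apply: congr_lim; apply/funext => N; apply: eq_bigr => k _; congr EFin.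
rewrite -[m in LHS]card_ord -prodr_const; apply: eq_bigr => i _; rewrite !mxE.
by move: (c k 0 i) (r k) => ? ?; ring.
Qed.

End PositiveDimension.

Section StepMap.
Context {R : realType} {m' : nat}.
Local Notation m := m'.+1.
Variable g : 'rV[R]_m -> R.
Hypothesis g2 : contdiff 2 g.
Implicit Types (x y v : 'rV[R]_m) (al : R) (N : set 'rV[R]_m).

(* The inverse of [al] is an eigenvalue of the Hessian of [g] at [x]. *)
Definition singular al x : Prop := exists2 v : 'rV[R]_m, `|v| = 1 &
  forall i, v 0 i = al * \sum_j v 0 j * partial j (partial i g) x.

Definition grad_step al x : 'rV[R]_m := x - al *: gradient g x.

Lemma continuous_hessian i j : continuous (partial j (partial i g)).
Proof. by apply: contdiff_continuous; do 2!apply: contdiff_partial; exact: g2. Qed.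

Lemma singular_cluster U al (v : nat -> 'rV[R]_m) (y : nat -> 'I_m -> 'I_m -> 'rV[R]_m) x :
  free_ultrafilter U -> (forall k, `|v k| <= 1) -> (\forall k \near U, `|v k| = 1) ->
  (forall i j, y k i j @[k --> U] --> x) ->
  (forall i, v k 0 i - al * \sum_j v k 0 j * partial j (partial i g) (y k i j) @[k --> U] --> 0) ->
  singular al x.
Proof.
move=> UU v_le1 v1 yx eigen; have [l vl] := @ultra_cvg_rV _ U _ R m v 1 v_le1.
have coord j : v k 0 j @[k --> U] --> l 0 j by exact: cvg_coord.
exists l => [|i].
  apply: (cvg_unique _ (cvg_norm vl)) => //=.
  by apply: cvg_near_cst; apply: filterS v1.
apply/eqP; rewrite -subr_eq0; apply/eqP; apply: (cvg_unique _ _ (eigen i)) => //=.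
apply: cvgB => //; apply: cvgM; first exact: cvg_cst.
apply: cvg_sum => j; apply: cvgM => //.
exact: (cvg_comp _ _ (yx i j) (@continuous_hessian i j x)).
Qed.

Lemma singular_closed U al (y : nat -> 'rV[R]_m) x : free_ultrafilter U ->
  y k @[k --> U] --> x -> (\forall k \near U, singular al (y k)) -> singular al x.
Proof.
move=> UU yx sing; have /choice[v vP] : forall k, exists v : 'rV[R]_m, `|v| <= 1 /\
    (singular al (y k) -> `|v| = 1 /\
      forall i, v 0 i = al * \sum_j v 0 j * partial j (partial i g) (y k)).
  move=> k; have [[v v1 eigen]|nsing] := pselect (singular al (y k)).
    by exists v; rewrite v1.
  by exists 0; rewrite normr0.
apply: (@singular_cluster U al v (fun k _ _ => y k)) => // [k||i].
- by case: (vP k).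
- by apply: filterS sing => k /(proj2 (vP k))[].
apply: cvg_near_cst; apply: filterS sing => k /(proj2 (vP k))[_ eigen].
by rewrite -eigen subrr.
Qed.

Lemma grad_step_difference al x y : exists2 xi : 'I_m -> 'I_m -> 'rV[R]_m,
  forall i j, in_rectangle x y (xi i j) &
  forall i, (grad_step al y - grad_step al x) 0 i =
    (y - x) 0 i - al * \sum_j (y - x) 0 j * partial j (partial i g) (xi i j).
Proof.
have /choice[xi xiP] : forall i, exists xi : 'I_m -> 'rV[R]_m,
    (forall j, in_rectangle x y (xi j)) /\ partial i g y - partial i g x =
      \sum_j (y 0 j - x 0 j) * partial j (partial i g) (xi j).
  move=> i; have [|xi xyxi E] := @coordwise_mvt R m (partial i g) x y; last by exists xi.
  by move=> j z; apply: (@contdiff_derivable _ _ 0); exact: contdiff_partial.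
exists xi => [i j|i]; first by case: (xiP i).
have [_] := xiP i; rewrite /grad_step !mxE => diff.
have -> : \sum_j (y - x) 0 j * partial j (partial i g) (xi i j) = partial i g y - partial i g x.
  by rewrite diff; apply: eq_bigr => j _; rewrite !mxE.
by move: (partial i g y) (partial i g x) => p q; rewrite ?mxE; ring.
Qed.

(* Otherwise the step would contract displacements near x by arbitrarily
   large factors, and their directions would accumulate at an eigenvector. *)
Lemma grad_step_expands al x0 : ~ singular al x0 ->
  exists n : nat, forall x y, `|x - x0| <= n.+1%:R^-1 -> `|y - x0| <= n.+1%:R^-1 ->
    `|y - x| <= n.+1%:R * `|grad_step al y - grad_step al x|.
Proof.
move=> nsing; apply: contrapT => contracts; apply: nsing.
have /choice[p pP] : forall n : nat, exists p : 'rV[R]_m * 'rV[R]_m,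
    [/\ `|p.1 - x0| <= n.+1%:R^-1, `|p.2 - x0| <= n.+1%:R^-1 &
     n.+1%:R * `|grad_step al p.2 - grad_step al p.1| < `|p.2 - p.1|].
  move=> n; apply: contrapT => noP; apply: contracts; exists n => x y xx0 yx0.
  by rewrite leNgt; apply/negP => contract; apply: noP; exists (x, y).
have /choice[xi xiP] : forall n : nat, exists xi : 'I_m -> 'I_m -> 'rV[R]_m,
    (forall i j, in_rectangle (p n).1 (p n).2 (xi i j)) /\
    forall i, (grad_step al (p n).2 - grad_step al (p n).1) 0 i = ((p n).2 - (p n).1) 0 i -
      al * \sum_j ((p n).2 - (p n).1) 0 j * partial j (partial i g) (xi i j).
  by move=> n; have [xi] := grad_step_difference al (p n).1 (p n).2; exists xi.
have [U UU] := free_ultrafilter_exists.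
pose d n := (p n).2 - (p n).1.
have d0 n : 0 < `|d n| by have [_ _] := pP n; apply: le_lt_trans; rewrite mulr_ge0.
have v1 n : `| `|d n|^-1 *: d n| = 1 by rewrite normrZ normfV normr_id mulVf // gt_eqF.
apply: (@singular_cluster U al (fun n => `|d n|^-1 *: d n) xi) => // [n||i j|i].
- by rewrite v1.
- exact: filterE.
- apply: cvg_free_ultrafilter; apply: cvg_natSinv_dist => n.
  by have [p1 p2 _] := pP n; apply: in_rectangle_ball p1 p2; case: (xiP n).
apply: cvg_free_ultrafilter; apply: cvg_natSinv_dist => n; rewrite subr0.
have -> : (`|d n|^-1 *: d n) 0 i -
    al * \sum_j (`|d n|^-1 *: d n) 0 j * partial j (partial i g) (xi n i j) =
    `|d n|^-1 * (grad_step al (p n).2 - grad_step al (p n).1) 0 i.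
  have [_ ->] := xiP n; rewrite mulrBr -/(d n) mxE; congr (_ - _).
  rewrite mulrCA; congr (_ * _); rewrite mulr_sumr; apply: eq_bigr => j _.
  by rewrite mxE mulrA.
have [_ _ contract] := pP n; rewrite normrM normfV normr_id ler_pdivrMl // mulrC.
rewrite ler_pdivlMl //; apply: le_trans (ltW contract).
by rewrite ler_pM2l // ler_coord_norm.
Qed.

Lemma rational_approx x (e : R) : 0 < e -> exists q : 'rV[rat]_m, `|x - map_mx ratr q| <= e.
Proof.
move=> e0; have /choice[q xq] : forall i, exists q : rat, `|x 0 i - ratr q| <= e.
  move=> i; have [|q] := @rat_in_itvoo R (x 0 i - e) (x 0 i + e); first by lra.
  rewrite in_itv /= => /andP[lo hi]; exists q; move: lo hi.
  by move: (x 0 i) (ratr q : R) => u w *; rewrite ler_norml; lra.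
exists (\row_i q i); apply/rV_norm_leP; first exact: ltW.
by move=> i; rewrite !mxE.
Qed.

(* Picking a point of E in every cube that meets T @` E at most doubles it. *)
Lemma expanding_preimage_null (T : 'rV[R]_m -> 'rV[R]_m) (E N : set 'rV[R]_m) (L : R) :
  0 < L -> (forall x y, E x -> E y -> `|y - x| <= L * `|T y - T x|) ->
  cube_null N -> cube_null (E `&` T @^-1` N).
Proof.
move=> L0 expands nN e e0.
have [|c [r [r0 cov vol]]] := nN (e / (L * 2) ^+ m).
  by rewrite divr_gt0 // exprn_gt0 // mulr_gt0.
have /choice[c' c'P] : forall k, exists c', (exists2 x, E x & `|T x - c k| <= r k) ->
    E c' /\ `|T c' - c k| <= r k.
  move=> k; have [[x Ex xk]|none] := pselect (exists2 x, E x & `|T x - c k| <= r k).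
    by exists x.
  by exists 0.
exists c', (fun k => L * 2 * r k); split=> [k|x [Ex Nx]|].
- by rewrite !mulr_ge0 // ltW.
- have [k xk] := cov _ Nx; exists k; have [|Ec ck] := c'P k; first by exists x.
  apply: le_trans (expands _ _ Ec Ex) _; rewrite -mulrA ler_pM2l // -(subrKA (c k)).
  apply: le_trans (ler_normD _ _) _; rewrite mulr_natl mulr2n lerD //.
  by rewrite distrC.
under eq_esum do rewrite exprMn EFinM.
have Lm0 : 0 < (L * 2) ^+ m by rewrite exprn_gt0 // mulr_gt0.
have rm0 k : (0 <= (r k ^+ m)%:E)%E by rewrite lee_fin exprn_ge0.
rewrite -nneseries_esumT => [|k]; last by rewrite mule_ge0 // lee_fin ltW.
rewrite nneseriesZl; last by move=> k _; exact: rm0.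
by rewrite nneseries_esumT // -lee_pdivlMl // -EFinM mulrC.
Qed.

Lemma grad_step_preimage_null al N : cube_null (singular al) -> cube_null N ->
  cube_null (grad_step al @^-1` N).
Proof.
move=> nsing nN.
pose E (qn : 'rV[rat]_m * nat) : set 'rV[R]_m :=
  [set x | `|x - map_mx ratr qn.1| <= (2 * qn.2.+1%:R)^-1].
pose expands (qn : 'rV[rat]_m * nat) := forall x y, E qn x -> E qn y ->
  `|y - x| <= qn.2.+1%:R * `|grad_step al y - grad_step al x|.
apply: (@sub_cube_null _ _ _ (singular al `|`
    [set x | exists qn, [/\ expands qn, E qn x & N (grad_step al x)]])) => [x Nx|].
  have [sx|nsx] := pselect (singular al x); [by left|right].
  have [n expand_n] := grad_step_expands nsx.
  have [|q xq] := @rational_approx x (2 * n.+1%:R)^-1; first by rewrite invr_gt0 mulr_gt0.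
  have near_x w : E (q, n) w -> `|w - x| <= n.+1%:R^-1.
    move=> wq; rewrite -(subrKA (map_mx ratr q)) (le_trans (ler_normD _ _)) //.
    have -> : (n.+1%:R^-1 : R) = (2 * n.+1%:R)^-1 + (2 * n.+1%:R)^-1.
      by rewrite invfM; move: (n.+1%:R^-1) => z; lra.
    by rewrite lerD // distrC.
  by exists (q, n); split=> // u w /near_x ux /near_x wx; exact: expand_n.
apply: cube_nullU => //; apply: cube_null_exists => qn.
have [expand_qn|nexp] := pselect (expands qn); last first.
  by apply: (@sub_cube_null _ _ _ N) => // x [].
apply: (@sub_cube_null _ _ _ (E qn `&` grad_step al @^-1` N)); first by move=> x [].
exact: expanding_preimage_null expand_qn nN.
Qed.

Lemma singular_card x (n : nat) (al : 'I_n -> R) (A : {set 'I_n}) : injective al ->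
  (forall i, 0 < al i) -> (forall i, i \in A -> singular (al i) x) -> (#|A| <= m)%N.
Proof.
move=> al_inj al0 singA; pose H : 'M[R]_m := \matrix_(j, i) partial j (partial i g) x.
have nz : char_poly H != 0 by apply: monic_neq0; exact: char_poly_monic.
have := @max_poly_roots _ (char_poly H) [seq (al i)^-1 | i in A] nz.
rewrite size_image size_char_poly ltnS; apply; last first.
  by rewrite map_inj_uniq ?enum_uniq // => i j /invr_inj/al_inj.
apply/allP => z /mapP[i iA ->]; rewrite mem_enum in iA; have [v v1 eigen] := singA i iA.
rewrite -eigenvalue_root_char; apply/eigenvalueP; exists v; last first.
  by apply/eqP => v0; move: v1; rewrite v0 normr0 => /esym/eqP; rewrite oner_eq0.
apply/rowP => j; rewrite mxE [RHS]mxE (eigen j) mulrA mulVf ?gt_eqF // mul1r.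
by apply: eq_bigr => k _; rewrite mxE.
Qed.

Section Grid.
Variable b : R.
Hypothesis b_gt0 : 0 < b.

Definition cell_singular L al (z : {ffun 'I_m -> 'I_L.+2}) : Prop :=
  exists2 x, `|x - grid_center b z| <= b / L.+1%:R & singular al x.

Lemma cell_singular_card L al e :
  ~ cube_cover ([set x | `|x| <= b] `&` singular al) e ->
  e <= #|[set z | `[< @cell_singular L al z >]]%SET|%:R * (b / L.+1%:R) ^+ m.
Proof.
move=> ncov; rewrite leNgt; apply/negP => small; apply: ncov.
have h0 : 0 <= b / L.+1%:R by rewrite divr_ge0 // ltW.
apply: (@cube_cover_finite _ _ {ffun 'I_m -> 'I_L.+2} _ _ (@grid_center R m b L)
  (fun z => if `[< @cell_singular L al z >] then b / L.+1%:R else 0)).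
- by move=> z; case: ifP.
- move=> x [xb sx]; have [z xz] := grid_cover L b_gt0 xb; exists z.
  by case: asboolP => // nz; exfalso; apply: nz; exists x.
apply: le_trans (ltW small); rewrite [leRHS]mulr_natl -[leRHS]sumr_const [leRHS]big_mkcond /=.
by apply: ler_sum => z _; rewrite finset.in_set; case: ifP => // _; rewrite expr0n.
Qed.

(* As the mesh shrinks, steps that stay singular in a common cell become
   singular at a common point. *)
Lemma cell_singular_multiplicity (n : nat) (al : 'I_n -> R) : injective al ->
  (forall i, 0 < al i) ->
  exists L, forall z, (#|[set i | `[< @cell_singular L (al i) z >]]%SET| <= m)%N.
Proof.
move=> al_inj al0; apply: contrapT => crowded.
have crowd L : exists z, (m < #|[set i | `[< @cell_singular L (al i) z >]]%SET|)%N.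
  apply: contrapT => sparse; apply: crowded; exists L => z; rewrite leqNgt.
  by apply/negP => many; apply: sparse; exists z.
pose z L := projT1 (cid (crowd L)); have zP L := projT2 (cid (crowd L)).
have [U UU] := free_ultrafilter_exists.
have [A UA] := @ultra_constant _ U _ _ (fun L => [set i | `[< cell_singular (al i) (z L) >]]%SET).
have [x zx] := @ultra_cvg_rV _ U _ R m (fun L => grid_center b (z L)) (2 * b)
  (fun L => grid_center_norm b_gt0 (z L)).
have [L AL] := filter_ex UA; have := zP L; rewrite -/(z L) AL ltnNge => /negP; apply.
apply: (singular_card (x := x) al_inj al0) => i iA.
have /choice[y yP] : forall L, exists y, `|y - grid_center b (z L)| <= b / L.+1%:R /\
    (cell_singular (al i) (z L) -> singular (al i) y).
  move=> L'; have [[y yz sy]|ncell] := pselect (cell_singular (al i) (z L')); first by exists y.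
  by exists (grid_center b (z L')); rewrite subrr normr0 divr_ge0 // ltW.
apply: (singular_closed (y := y) UU); last first.
  apply: filterS UA => L' AL'; apply: (yP L').2; apply/asboolP.
  by move: iA; rewrite -AL' finset.in_set.
apply: cvg_sub0 zx; apply: cvg_free_ultrafilter; apply/norm_cvg0P.
have mesh0 : b / L.+1%:R @[L --> \oo] --> b * 0.
  by apply: cvgM; [exact: cvg_cst|exact: cvg_harmonic].
rewrite mulr0 in mesh0; apply: squeeze_cvgr (cvg_cst 0) mesh0.
by apply: filterE => L'; rewrite normr_ge0; case: (yP L').
Qed.

(* Double counting of the pairs of a step and a cell where it is singular. *)
Lemma bad_steps_le (e : R) (n : nat) (al : 'I_n -> R) : injective al -> (forall i, 0 < al i) ->
  (forall i, ~ cube_cover ([set x | `|x| <= b] `&` singular (al i)) e) ->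
  n%:R * e <= m%:R * (2 * b) ^+ m.
Proof.
move=> al_inj al0 bad; have [L sparse] := cell_singular_multiplicity al_inj al0.
apply: (@le_trans _ _ (\sum_(i < n)
    #|[set z | `[< @cell_singular L (al i) z >]]%SET|%:R * (b / L.+1%:R) ^+ m)).
  rewrite mulr_natl -[X in e *+ X]card_ord -sumr_const; apply: ler_sum => i _.
  exact: cell_singular_card.
rewrite -mulr_suml -natr_sum.
apply: (@le_trans _ _ (m%:R * (#|{: {ffun 'I_m -> 'I_L.+2}}|%:R * (b / L.+1%:R) ^+ m))); last first.
  by rewrite ler_wpM2l // grid_volume.
rewrite mulrA -natrM ler_wpM2r ?exprn_ge0 ?divr_ge0 ?(ltW b_gt0) // ler_nat.
under eq_bigr do rewrite -sum1_card big_mkcond.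
rewrite exchange_big /= mulnC -sum_nat_const; apply: leq_sum => z _.
apply: leq_trans (sparse z); rewrite -sum1_card [leqRHS]big_mkcond /=.
by apply: leq_sum => i _; rewrite !finset.in_set.
Qed.

Lemma finite_bad_steps (e : R) : 0 < e ->
  finite_set [set al | 0 < al /\ ~ cube_cover ([set x | `|x| <= b] `&` singular al) e].
Proof.
move=> e0; apply: contrapT => infin; pose K := m%:R * (2 * b) ^+ m / e.
have K0 : 0 <= K by rewrite divr_ge0 ?mulr_ge0 ?exprn_ge0 ?mulr_ge0 // ltW.
have [B Bbad] := infinite_set_fset (Num.truncn K).+1 infin.
pose s := finmap.enum_fset B; apply/negP; rewrite -ltnNge ltnS -/s.
rewrite truncn_ge_nat // ler_pdivlMr //.
have sbad i : _ := Bbad (tnth (in_tuple s) i) (mem_tnth i (in_tuple s)).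
apply: (bad_steps_le (al := tnth (in_tuple s))) => [|i|i]; last 2 first.
- by case: (sbad i).
- by case: (sbad i).
by apply/tuple_uniqP; exact: finmap.fset_uniq.
Qed.

End Grid.

Lemma countable_singular : countable [set al | 0 < al /\ ~ cube_null (singular al)].
Proof.
pose bad (p : nat * nat) : set R := [set al | 0 < al /\
  ~ cube_cover ([set x | `|x| <= p.1.+1%:R] `&` singular al) p.2.+1%:R^-1].
apply: (@sub_countable _ _ _ (\bigcup_p bad p)); last first.
  apply: bigcup_countable => // -[B N] _; apply: finite_set_countable.
  by apply: finite_bad_steps; rewrite ?invr_gt0.
apply: subset_card_le => al [al0 nnull]; apply: contrapT => good; apply: nnull.
apply: (@sub_cube_null _ _ _
  [set x | exists B : nat, ([set x | `|x| <= B.+1%:R] `&` singular al) x]).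
  by move=> x sx; exists (Num.truncn `|x|); split=> //=; apply: ltW; exact: truncnS_gt.
apply: cube_null_exists => B e e0; have [N _ Ne] := near_infty_natSinv_lt (PosNum e0).
apply: (cube_cover_le (ltW (Ne N (leqnn N)))); apply: contrapT => ncov; apply: good.
by exists (B, N).
Qed.

End StepMap.

(** * Almost sure control of the noise *)

Lemma borel_cantelli_inv_square {d : measure_display} {T : measurableType d} {R : realType}
    (P : probability T R) (B : nat -> set T) : (forall k, measurable (B k)) ->
  (\forall k \near \oo, (P (B k) <= (k%:R ^- 2)%:E)%E) ->
  {ae P, forall w, \forall k \near \oo, ~ B k w}.
Proof.
move=> mB [N _ PB]; pose B' i := B (i + N.+1)%N.
have PB' i : (P (B' i) <= (2 * (i.+1%:R^-1 - i.+2%:R^-1))%:E)%E.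
  apply: (@le_trans _ _ (((i + N.+1)%:R ^- 2)%:E)); first by apply: PB; rewrite /= ltnW // leq_addl.
  have i0 : (0 : R) < i.+1%:R by [].
  rewrite lee_fin; apply: (@le_trans _ _ (i.+1%:R ^- 2)).
    by rewrite lef_pV2 ?posrE ?exprn_gt0 ?ltr0n ?addnS // lerXn2r ?nnegrE // ler_nat ltnS leq_addr.
  rewrite -[i.+2%:R]natr1; have i1 : (1 : R) <= i.+1%:R by rewrite ler1n.
  move: i.+1%:R i0 i1 => q q0 q1; rewrite -subr_ge0.
  have -> : 2 * (q^-1 - (q + 1)^-1) - q ^- 2 = (q - 1) / (q ^+ 2 * (q + 1)).
    by field; rewrite !gt_eqF // ltr_wpDl // ltW.
  by rewrite divr_ge0 ?subr_ge0 // mulr_ge0 ?exprn_ge0 ?addr_ge0 ?(ltW q0).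
have sumB' : (\sum_(0 <= i <oo) P (B' i) < +oo)%E.
  apply: (@le_lt_trans _ _ (2 : R)%:E); last exact: ltry.
  apply: lime_le; first by apply: is_cvg_nneseries => k _ _; exact: measure_ge0.
  apply: filterE => K.
  apply: (@le_trans _ _ (\sum_(0 <= i < K) (2 * (i.+1%:R^-1 - i.+2%:R^-1))%:E)%E).
    exact: lee_sum.
  rewrite sumEFin lee_fin -mulr_sumr ler_piMr //.
  under eq_bigr do rewrite -opprB.
  by rewrite sumrN (telescope_sumr (fun i => i.+1%:R^-1 : R)) // opprB invr1 gerBl invr_ge0.
exists (lim_sup_set B'); split.
- by apply: bigcapT_measurable => k; apply: bigcup_measurable => i _; exact: mB.
- by apply: lim_sup_set_cvg0 => // k; exact: mB.
move=> w /= notB k _; apply: contrapT => noB; apply: notB; exists (k + N.+1)%N => // i /= ki Bi.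
have Ni : (N < i)%N by apply: leq_trans ki; rewrite leq_addl.
apply: noB; exists (i - N.+1)%N; first by rewrite /= leq_subRL // addnC.
by rewrite /B' subnK.
Qed.

Lemma ae_forall_countable (d : measure_display) (T : measurableType d) (R : realType)
    (P : probability T R) (I : countType) (Q : I -> T -> Prop) :
  (forall i, {ae P, forall x, Q i x}) -> {ae P, forall x, forall i, Q i x}.
Proof.
move=> aeQ; have : {ae P, forall x, forall k i, @pickle I i = k -> Q i x}.
  apply: ae_foralln => k.
  have [[i ik]|none] := pselect (exists i : I, pickle i = k); last first.
    by apply: filterE => x i ik; exfalso; apply: none; exists i.
  apply: filterS (aeQ i) => x Qi i'; rewrite -ik => /(pcan_inj (@pickleK I)).
  by move=> ->.
by apply: filterS => x Qx i; exact: Qx.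
Qed.

Lemma expR_le_quadratic {R : realType} (y : R) : `|y| <= 2^-1 -> expR y <= 1 + y + 2 * y ^+ 2.
Proof.
rewrite ler_norml => /andP[ly uy]; have y1 : 0 < 1 - y by lra.
apply: (@le_trans _ _ (1 - y)^-1).
  rewrite -[expR y]invrK lef_pV2 ?posrE ?invr_gt0 ?expR_gt0 // -expRN.
  exact: (expR_ge1Dx (- y)).
rewrite -[leLHS]mul1r ler_pdivrMr //.
have -> : (1 + y + 2 * y ^+ 2) * (1 - y) = 1 + y ^+ 2 * (1 - 2 * y) by ring.
by rewrite lerDl mulr_ge0 ?sqr_ge0 //; lra.
Qed.

Section Words.
Context {R : realType} {n : nat}.
Variable i0 : 'I_n.
Implicit Types (u : seq 'I_n) (c : 'I_n) (k l : nat).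

Fixpoint words l : seq (seq 'I_n) :=
  if l is l'.+1 then [seq rcons u c | u <- words l', c <- enum 'I_n] else [:: [::]].

Lemma sum_words l (F : seq 'I_n -> R) :
  \sum_(u <- words l.+1) F u = \sum_(u <- words l) \sum_c F (rcons u c).
Proof.
rewrite /= big_allpairs_dep; apply: eq_bigr => u _.
by rewrite big_enum.
Qed.

Lemma size_words l u : u \in words l -> size u = l.
Proof.
elim: l u => [|l IH] u /=; first by rewrite inE => /eqP ->.
by move=> /allpairsP[[v c] /= [/IH vl _ ->]]; rewrite size_rcons vl.
Qed.

Lemma mem_words (h : nat -> 'I_n) l : mkseq h l \in words l.
Proof.
elim: l => [//|l IH]; rewrite mkseqS; apply/allpairsP.
by exists (mkseq h l, h l); rewrite mem_enum.
Qed.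

(* [xi u c] is the increment at time [size u] after the history [u]; adaptedness
   is thus built into the type. *)
Variables (xi : seq 'I_n -> 'I_n -> R) (b : nat -> R).
Hypothesis xi_mean0 : forall u, \sum_c xi u c = 0.
Hypothesis xi_bounded : forall u c, `|xi u c| <= b (size u).

Definition window_sum k u : R := \sum_(k <= i < size u) xi (take i u) (nth i0 u i).

Lemma window_sum_rcons k u c : window_sum k (rcons u c) =
  window_sum k u + (if (k <= size u)%N then xi u c else 0).
Proof.
rewrite /window_sum size_rcons; case: leqP => ku.
  rewrite big_nat_recr //= nth_rcons ltnn eqxx -cats1 take_size_cat //; congr (_ + _).
  rewrite big_nat_cond [RHS]big_nat_cond; apply: eq_bigr => i /andP[/andP[_ iu] _].
  by rewrite cats1 nth_rcons iu -cats1 takel_cat // ltnW.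
by rewrite !big_geq ?addr0 // ltnW.
Qed.

Lemma window_sum_mkseq (h : nat -> 'I_n) k l :
  window_sum k (mkseq h l) = \sum_(k <= i < l) xi (mkseq h i) (h i).
Proof.
rewrite /window_sum size_mkseq big_nat_cond [RHS]big_nat_cond.
apply: eq_bigr => i /andP[/andP[_ il] _]; rewrite nth_mkseq //; congr (xi _ _).
apply: (@eq_from_nth _ i0) => [|j]; rewrite size_take size_mkseq il ?size_mkseq // => ji.
by rewrite nth_take // !nth_mkseq // (ltn_trans ji).
Qed.

Lemma exponential_step (th : R) u : `|th| * b (size u) <= 2^-1 ->
  \sum_c expR (th * xi u c) <= n%:R * expR (2 * th ^+ 2 * b (size u) ^+ 2).
Proof.
move=> thb; have th_xi c : `|th * xi u c| <= `|th| * b (size u).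
  by rewrite normrM ler_wpM2l.
apply: (@le_trans _ _ (\sum_c (1 + th * xi u c + 2 * (th ^+ 2 * b (size u) ^+ 2)))).
  apply: ler_sum => c _; apply: le_trans (expR_le_quadratic (le_trans (th_xi c) thb)) _.
  rewrite lerD2l ler_pM2l // -exprMn -real_normK ?num_real // -[leRHS]real_normK ?num_real //.
  rewrite ler_sqr ?nnegrE // [leRHS]normrM; apply: le_trans (th_xi c) _.
  by rewrite ler_wpM2l // ler_norm.
rewrite big_split big_split /= sumr_const -mulr_sumr xi_mean0 mulr0 addr0 sumr_const card_ord.
rewrite -mulrnDl -[leLHS]mulr_natl ler_wpM2l // mulrA; exact: expR_ge1Dx.
Qed.

Lemma exponential_moment k l (th : R) : (forall i, (k <= i)%N -> `|th| * b i <= 2^-1) ->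
  \sum_(u <- words l) expR (th * window_sum k u) <=
  n%:R ^+ l * expR (2 * th ^+ 2 * \sum_(k <= i < l) b i ^+ 2).
Proof.
move=> thb; elim: l => [|l IH].
  by rewrite /= big_seq1 expr0 mul1r /window_sum !big_geq ?mulr0 ?leqnn.
pose q := if (k <= l)%N then b l ^+ 2 else 0.
have -> : \sum_(k <= i < l.+1) b i ^+ 2 = \sum_(k <= i < l) b i ^+ 2 + q.
  by rewrite /q; case: leqP => kl; [rewrite big_nat_recr|rewrite !big_geq ?addr0 // ltnW].
have step u : u \in words l -> \sum_c expR (th * window_sum k (rcons u c)) <=
    expR (th * window_sum k u) * (n%:R * expR (2 * th ^+ 2 * q)).
  move=> /size_words ul; under eq_bigr do rewrite window_sum_rcons ul mulrDr expRD.
  rewrite -mulr_sumr ler_wpM2l ?expR_ge0 // /q; case: leqP => kl.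
    by have := @exponential_step th u; rewrite ul; apply; exact: thb.
  by rewrite !mulr0 expR0 sumr_const card_ord mulr1.
rewrite sum_words big_seq; apply: le_trans (ler_sum _ step) _; rewrite -big_seq -mulr_suml.
apply: le_trans (ler_wpM2r _ IH) _; first by rewrite mulr_ge0 // expR_ge0.
by rewrite mulrDr expRD [n%:R ^+ l.+1]exprSr mulrACA.
Qed.

End Words.

Section NoiseAlmostSurely.
Context {R : realType} {n : nat}.
Hypothesis n_gt0 : (0 < n)%N.
Variables (d0 : measure_display) (T0 : measurableType d0) (P0 : probability T0 R)
  (iota : T0 -> 'I_n).
Hypothesis iota_measurable : forall l, measurable (iota @^-1` [set l]).
Hypothesis iota_uniform : forall l, P0 (iota @^-1` [set l]) = (n%:R^-1)%:E.
Variable P : probability (infinite_product T0) R.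
Hypothesis P_product : is_product_measure P0 P.
Variable i0 : 'I_n.
Implicit Types (u : seq 'I_n) (c : 'I_n) (w : infinite_product T0).

Definition cylinder u : set (infinite_product T0) :=
  [set w | forall k, (k < size u)%N -> (iota @^-1` [set nth i0 u k]) (w k)].

Lemma measurable_cylinder u : measurable (cylinder u).
Proof.
have -> : cylinder u = \bigcap_(k in [set k | (k < size u)%N])
    [set w : infinite_product T0 | (iota @^-1` [set nth i0 u k]) (w k)].
  by apply/seteqP; split.
apply: bigcap_measurableType => k _; apply: sub_sigma_algebra; exists k => //.
by exists (iota @^-1` [set nth i0 u k]) => //; rewrite setTI.
Qed.

Lemma measure_cylinder u : P (cylinder u) = (n%:R ^- size u)%:E.
Proof.
rewrite /cylinder (@P_product (size u) (fun k => iota @^-1` [set nth i0 u k])) //.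
under eq_bigr do rewrite iota_uniform.
by rewrite prodEFin prodr_const card_ord exprVn.
Qed.

Lemma measure_cylinders_le (s : seq (seq 'I_n)) (Q : pred (seq 'I_n)) :
  (P (\big[setU/set0]_(u <- s | Q u) cylinder u) <= \sum_(u <- s | Q u) (n%:R ^- size u)%:E)%E.
Proof.
elim: s => [|u s IH]; first by rewrite !big_nil measure0.
rewrite !big_cons; case: ifP => // Qu; apply: (le_trans (measureU2 _ _ _)).
- exact: measurable_cylinder.
- by apply: bigsetU_measurable => v _; exact: measurable_cylinder.
by apply: leeD => //; rewrite -measure_cylinder.
Qed.

Section Tail.
Variables (xi : seq 'I_n -> 'I_n -> R) (b : nat -> R).
Hypothesis xi_mean0 : forall u, \sum_c xi u c = 0.
Hypothesis xi_bounded : forall u c, `|xi u c| <= b (size u).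

Definition large_window k l (eta : R) : set (infinite_product T0) :=
  \big[setU/set0]_(u <- words l | eta <= window_sum i0 xi k u) cylinder u.

Lemma measurable_large_window k l eta : measurable (large_window k l eta).
Proof. by apply: bigsetU_measurable => u _; exact: measurable_cylinder. Qed.

Lemma large_windowP k l eta w :
  eta <= window_sum i0 xi k (mkseq (iota \o w) l) -> large_window k l eta w.
Proof.
move=> large; rewrite /large_window -bigcup_seq_cond; exists (mkseq (iota \o w) l).
  by rewrite /= mem_words large.
by move=> i; rewrite size_mkseq => il; rewrite nth_mkseq.
Qed.

Lemma chernoff k l (th eta : R) : 0 <= th -> (forall i, (k <= i)%N -> th * b i <= 2^-1) ->
  (P (large_window k l eta) <=
    (expR (- (th * eta) + 2 * th ^+ 2 * \sum_(k <= i < l) b i ^+ 2))%:E)%E.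
Proof.
move=> th0 thb; have nl0 : (0 : R) < n%:R ^+ l by rewrite exprn_gt0 // ltr0n.
apply: (le_trans (measure_cylinders_le _ _)); rewrite sumEFin lee_fin.
apply: (@le_trans _ _ (n%:R ^- l * expR (- (th * eta)) *
    \sum_(u <- words l) expR (th * window_sum i0 xi k u))).
  rewrite mulr_sumr [leLHS]big_mkcond big_seq [leRHS]big_seq; apply: ler_sum => u /size_words ->.
  case: ifP => large; last by rewrite !mulr_ge0 ?expR_ge0 // invr_ge0 ltW.
  rewrite -mulrA -[leLHS]mulr1 ler_wpM2l ?invr_ge0 ?(ltW nl0) //.
  by rewrite -expRD -[leLHS]expR0 ler_expR addrC subr_ge0 ler_wpM2l.
have moment := @exponential_moment R n i0 xi b xi_mean0 xi_bounded k l th.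
apply: (le_trans (ler_wpM2l _ (moment _))) => [|i ki|].
- by rewrite mulr_ge0 ?expR_ge0 // invr_ge0 ltW.
- by rewrite ger0_norm // thb.
by rewrite mulrACA mulVf ?gt_eqF // mul1r -expRD.
Qed.

End Tail.

Variables (a : nat -> R) (C T : R) (l : nat -> nat).
Hypothesis C_gt0 : 0 < C.
Hypothesis T_gt0 : 0 < T.
Hypothesis a_gt0 : forall k, 0 < a k.
Hypothesis a_log : forall e, 0 < e -> \forall k \near \oo, a k * ln k%:R <= e.
Hypothesis window_length : forall k, \sum_(k <= i < l k) a i <= T.

Lemma near_tail_log (e : R) : 0 < e ->
  \forall k \near \oo, forall i, (k <= i)%N -> a i * ln k%:R <= e.
Proof.
move=> e0; have [N _ aN] := a_log e0; near=> k.
have k0 : (0 < k)%N by near: k; exact: nbhs_infty_gt.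
have Nk : (N <= k)%N by near: k; exact: nbhs_infty_ge.
move=> i ki; apply: le_trans (aN i (leq_trans Nk ki)); rewrite ler_pM2l //.
by rewrite ler_ln ?posrE ?ler_nat ?ltr0n // (leq_trans k0 ki).
Unshelve. all: by end_near. Qed.

(* The optimal exponent is of order ln k; a k = o (1 / ln k) makes it admissible. *)
Lemma near_chernoff_exponent (eta : R) : 0 < eta -> \forall k \near \oo, exists th : R,
  [/\ 0 <= th, forall i, (k <= i)%N -> th * (C * a i) <= 2^-1 &
    - (th * eta) + 2 * th ^+ 2 * \sum_(k <= i < l k) (C * a i) ^+ 2 <= - 2 * ln k%:R].
Proof.
move=> eta0; pose e := Num.min (eta / (8 * C)) (eta ^+ 2 / (16 * C ^+ 2 * T)).
have e0 : 0 < e by rewrite lt_min !divr_gt0 // ?mulr_gt0 // exprn_gt0.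
have e_eta : e * (8 * C) <= eta by rewrite -ler_pdivlMr ?mulr_gt0 // ge_min lexx.
have e_eta2 : e * (16 * C ^+ 2 * T) <= eta ^+ 2.
  by rewrite -ler_pdivlMr ?mulr_gt0 ?exprn_gt0 // ge_min lexx orbT.
near=> k; have k0 : (0 < k)%N by near: k; exact: nbhs_infty_gt.
have : forall i, (k <= i)%N -> a i * ln k%:R <= e by near: k; exact: near_tail_log.
have : 0 <= ln (k%:R : R) by rewrite ln_ge0 // ler1n.
move: (ln k%:R) => L L0 aL; exists (4 * L / eta).
split=> [|i ki|]; first by rewrite divr_ge0 ?mulr_ge0 // ltW.
  rewrite mulrAC ler_pdivrMr //; apply: (@le_trans _ _ (4 * C * e)); last by move: e_eta; lra.
  have -> : 4 * L * (C * a i) = 4 * C * (a i * L) by ring.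
  by rewrite ler_wpM2l ?aL // mulr_ge0 // ltW.
have variance : L * \sum_(k <= i < l k) (C * a i) ^+ 2 <= C ^+ 2 * e * T.
  apply: (@le_trans _ _ (C ^+ 2 * e * \sum_(k <= i < l k) a i)); last first.
    by rewrite ler_wpM2l // mulr_ge0 ?sqr_ge0 // ltW.
  rewrite !mulr_sumr big_nat_cond [leRHS]big_nat_cond; apply: ler_sum => i /andP[/andP[ki _] _].
  have -> : L * (C * a i) ^+ 2 = C ^+ 2 * (a i * L) * a i by ring.
  by rewrite ler_pM2r // ler_wpM2l ?sqr_ge0 // aL.
move: variance; set S := \sum_(_ <= i < _) _ => variance.
have -> : - (4 * L / eta * eta) + 2 * (4 * L / eta) ^+ 2 * S =
    - 4 * L + 32 * L / eta ^+ 2 * (L * S) by field; rewrite gt_eqF.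
have : 32 * L / eta ^+ 2 * (L * S) <= 2 * L; last by lra.
apply: (le_trans (ler_wpM2l _ variance)); first by rewrite divr_ge0 ?mulr_ge0 // ltW.
rewrite mulrAC ler_pdivrMr ?exprn_gt0 //.
have -> : 32 * L * (C ^+ 2 * e * T) = 2 * L * (e * (16 * C ^+ 2 * T)) by ring.
by rewrite ler_wpM2l // mulr_ge0.
Unshelve. all: by end_near. Qed.

Section OneSided.
Variable xi : seq 'I_n -> 'I_n -> R.
Hypothesis xi_mean0 : forall u, \sum_c xi u c = 0.
Hypothesis xi_bounded : forall u c, `|xi u c| <= C * a (size u).

Lemma window_sum_tail (eta : R) : 0 < eta -> {ae P, forall w, \forall k \near \oo,
  \sum_(k <= i < l k) xi (mkseq (iota \o w) i) (iota (w i)) < eta}.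
Proof.
move=> eta0; have : {ae P, forall w, \forall k \near \oo, ~ large_window xi k (l k) eta w}.
  apply: borel_cantelli_inv_square => [k|]; first exact: measurable_large_window.
  near=> k; have k0 : (0 < k)%N by near: k; exact: nbhs_infty_gt.
  have [th [th0 tha bound]] : exists th : R, [/\ 0 <= th,
      forall i, (k <= i)%N -> th * (C * a i) <= 2^-1 &
      - (th * eta) + 2 * th ^+ 2 * \sum_(k <= i < l k) (C * a i) ^+ 2 <= - 2 * ln k%:R].
    by near: k; exact: near_chernoff_exponent.
  apply: le_trans (chernoff xi_mean0 (b := fun i => C * a i) xi_bounded _ _ th0 tha) _.
  rewrite lee_fin; apply: (@le_trans _ _ (expR (- 2 * ln k%:R))); first by rewrite ler_expR.
  by rewrite mulNr expRN expRM_natl lnK // posrE ltr0n.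
apply: filterS => w small; near=> k; rewrite -(window_sum_mkseq i0) ltNge; apply/negP => large.
suff : ~ large_window xi k (l k) eta w by apply; exact: large_windowP.
by near: k.
Unshelve. all: by end_near. Qed.

End OneSided.

Lemma window_sum_cvg0 (xi : seq 'I_n -> 'I_n -> R) :
  (forall u, \sum_c xi u c = 0) -> (forall u c, `|xi u c| <= C * a (size u)) ->
  {ae P, forall w,
    \sum_(k <= i < l k) xi (mkseq (iota \o w) i) (iota (w i)) @[k --> \oo] --> (0 : R)}.
Proof.
move=> xi_mean0 xi_bounded.
have tails (z : seq 'I_n -> 'I_n -> R) : (forall u, \sum_c z u c = 0) ->
    (forall u c, `|z u c| <= C * a (size u)) ->
    {ae P, forall w, forall j : nat, \forall k \near \oo,
      \sum_(k <= i < l k) z (mkseq (iota \o w) i) (iota (w i)) < j.+1%:R^-1}.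
  by move=> z0 zb; apply: ae_foralln => j; apply: window_sum_tail; rewrite ?invr_gt0.
have upper := tails xi xi_mean0 xi_bounded.
have lower : {ae P, forall w, forall j : nat, \forall k \near \oo,
    \sum_(k <= i < l k) - xi (mkseq (iota \o w) i) (iota (w i)) < j.+1%:R^-1}.
  by apply: (tails (fun u c => - xi u c)) => [u|u c]; rewrite ?sumrN ?xi_mean0 ?oppr0 ?normrN.
apply: filterS2 upper lower => w upper lower; apply/cvgr0Pnorm_lt => e e0.
have [N _ /(_ N (leqnn N)) Ne] := near_infty_natSinv_lt (PosNum e0).
near=> k; apply: lt_trans Ne; rewrite ltr_norml ltrNl -sumrN; apply/andP; split.
  by near: k; exact: lower.
by near: k; exact: upper.
Unshelve. all: by end_near. Qed.

End NoiseAlmostSurely.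

Section DenseTimes.
Context {R : realType} {m : nat}.
Variables (a : nat -> R) (nu : nat -> 'rV[R]_m) (K : R).
Hypothesis a_gt0 : forall k, 0 < a k.
Hypothesis a_cvg0 : a k @[k --> \oo] --> 0.
Hypothesis a_divergent : forall k (t : R), exists l, t <= \sum_(k <= i < l) a i.
Hypothesis nu_bounded : forall k, `|nu k| <= K * a k.
Local Notation stop := (stop a_gt0 a_divergent).

Lemma window_norm_le k (t s : R) : t <= s ->
  `|\sum_(k <= i < stop k t) nu i| <= `|\sum_(k <= i < stop k s) nu i| +
    K * (clock a k (stop k s) - clock a k (stop k t)).
Proof.
move=> ts; have kt := stop_ge a_gt0 a_divergent k t; have st := stop_mono a_gt0 a_divergent k ts.
have -> : \sum_(k <= i < stop k t) nu i =
    \sum_(k <= i < stop k s) nu i - \sum_(stop k t <= i < stop k s) nu i.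
  by rewrite (big_cat_nat kt st) /= addrK.
apply: le_trans (ler_normB _ _) _; rewrite lerD2l; apply: le_trans (ler_norm_sum _ _ _) _.
by rewrite (clockD a kt st) [clock a k _ + _]addrC addrK /clock mulr_sumr ler_sum.
Qed.

Lemma window_cvg0_dense :
  (forall q : rat, \sum_(k <= i < stop k (ratr q)) nu i @[k --> \oo] --> (0 : 'rV[R]_m)) ->
  forall t, \sum_(k <= i < stop k t) nu i @[k --> \oo] --> (0 : 'rV[R]_m).
Proof.
move=> dense t; apply/cvgr0Pnorm_lt => e e0.
have K0 : 0 <= K by have := le_trans (normr_ge0 _) (nu_bounded 0); rewrite pmulr_lge0.
pose d := e / 2 / (K + 1); have d0 : 0 < d by rewrite !divr_gt0 // ltr_wpDl.
have [|q] := @rat_in_itvoo R t (t + d); first by rewrite ltrDl.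
rewrite in_itv /= => /andP[/ltW tq qd].
have clock_q : clock a k (stop k (ratr q)) - clock a k (stop k t) @[k --> \oo] -->
    Num.max (ratr q) 0 - Num.max t 0 by apply: cvgB; exact: clock_stop_cvg.
have max_q : Num.max (ratr q) 0 - Num.max t 0 < d.
  by move: tq qd d0; rewrite !maxEle; case: (leP t 0); case: (leP (ratr q : R) 0); lra.
have e2 : 0 < e / 2 by rewrite divr_gt0.
have window_q : \forall k \near \oo, `|\sum_(k <= i < stop k (ratr q)) nu i| < e / 2.
  by move/cvgr0Pnorm_lt: (dense q) => /(_ _ e2).
near=> k; apply: le_lt_trans (window_norm_le k tq) _.
rewrite [ltRHS]splitr ltr_leD //; first by near: k.
apply: (@le_trans _ _ (K * d)); last first.
  by rewrite /d mulrA ler_pdivrMr ?ltr_wpDl // mulrC ler_wpM2l ?lerDl // divr_ge0 // ltW.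
by rewrite ler_wpM2l // ltW //; near: k; exact: (cvgr_lt _ clock_q).
Unshelve. all: by end_near. Qed.

End DenseTimes.

(** * Critical points of piecewise smooth functions *)

Section Differentiability.
Context {R : realType} {m : nat}.
Implicit Types (x y : 'rV[R]_m) (f g : 'rV[R]_m -> R).

Definition dot (c h : 'rV[R]_m) : R := \sum_i c 0 i * h 0 i.

Lemma dot_linear c : linear (dot c).
Proof.
move=> t u v; rewrite /dot scaler_sumr -big_split /=; apply: eq_bigr => i _.
by rewrite !mxE mulrDr mulrCA.
Qed.

HB.instance Definition _ c :=
  GRing.isLinear.Build R 'rV[R]_m R _ (dot c) (dot_linear c).

Lemma dot_continuous c : continuous (dot c).
Proof.
apply: continuous_sum => i; apply: continuous_mul; first exact: cst_continuous.
exact: coord_continuous.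
Qed.

Lemma near_contdiff_differentiable f g x : contdiff 2 g -> (\forall y \near x, f y = g y) ->
  differentiable f x.
Proof.
move=> g2 fg; have /pinfty_ex_gt0[L L0 gL] := contdiff2_near_quadratic (`|x| + 1) g2.
have expansion : f \o shift x = cst (f x) + dot (gradient g x) +o_ (0 : 'rV[R]_m) id.
  apply/eqaddoP => e e0; near=> h.
  have h1 : `|h| <= 1 by near: h; apply: cvgr0_norm_le.
  have hL : L * `|h| <= e.
    by rewrite mulrC -ler_pdivlMr //; near: h; apply: cvgr0_norm_le; rewrite ?divr_gt0.
  have fgh : f (h + x) = g (h + x).
    by near: h; move: fg; rewrite (near_shift 0) subr0; exact.
  have := gL x (h + x); rewrite addrK lerDl ler01 => /(_ isT)/(_ _)/wrap[|quadratic].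
    by rewrite (le_trans (ler_normD _ _)) // addrC lerD2l.
  have -> : (f \o shift x - (cst (f x) + dot (gradient g x))) h =
      g (h + x) - g x - \sum_i partial i g x * ((h + x) 0 i - x 0 i).
    rewrite /= -[LHS]/(f (h + x) - (f x + dot (gradient g x) h)) fgh (nbhs_singleton fg).
    by rewrite opprD addrA; congr (_ - _); apply: eq_bigr => i _; rewrite !mxE addrK.
  by apply: le_trans quadratic _; rewrite expr2 mulrA ler_wpM2r.
apply/diff_locallyP; rewrite (diff_unique (@dot_continuous (gradient g x)) expansion).
by split=> //; exact: dot_continuous.
Unshelve. all: by end_near. Qed.

Lemma near_gradient f g x : (\forall y \near x, f y = g y) -> gradient f x = gradient g x.
Proof. by move=> fg; apply/rowP => i; rewrite !mxE; exact: near_eq_derive. Qed.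

Lemma continuous_gradient g : contdiff 1 g -> continuous (gradient g).
Proof.
move=> g1 x; apply: (@cvg_rV R m _ (nbhs x) (nbhs_filter x)) => i; rewrite mxE.
under eq_cvg do rewrite mxE.
exact: (contdiff_continuous (contdiff_partial i g1)).
Qed.

Lemma closure_limiting_gradient (A : set 'rV[R]_m) f g x : contdiff 2 g ->
  (forall y, A y -> \forall z \near y, f z = g z) -> closure A x ->
  exists xs : nat -> 'rV[R]_m, [/\ forall k, differentiable f (xs k), xs k @[k --> \oo] --> x
    & gradient f (xs k) @[k --> \oo] --> gradient g x].
Proof.
move=> g2 fg clA; have /choice[xs xsP] : forall k : nat, exists y, A y /\ `|y - x| <= k.+1%:R^-1.
  move=> k; have [|y [Ay]] := clA (ball x (k.+1%:R^-1 : R)).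
    by apply: nbhsx_ballx; rewrite invr_gt0.
  by rewrite -ball_normE /= distrC => /ltW; exists y.
have xsx : xs k @[k --> \oo] --> x by apply: cvg_natSinv_dist => k; case: (xsP k).
exists xs; split=> // [k|]; first by apply: near_contdiff_differentiable g2 (fg _ (xsP k).1).
under eq_cvg => k do rewrite (near_gradient (fg _ (xsP k).1)).
apply: (cvg_comp _ _ xsx); apply: continuous_gradient; exact: contdiff_leq g2.
Qed.

Lemma crit_point_clarke (J : finType) (A : J -> set 'rV[R]_m) (g : J -> 'rV[R]_m -> R) f x :
  (forall j, contdiff 2 (g j)) -> (forall j y, A j y -> \forall z \near y, f z = g j z) ->
  crit_point (fun j => closure (A j)) g x -> clarke_subdifferential f x 0.
Proof.
move=> g2 fg [l [[l0 l1] lA lg]].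
have [j0 lj0] : exists j, l j != 0.
  apply: contrapT => l_eq0; have : \sum_j l j = 0.
    by apply: big1 => j _; apply/eqP/negPn/negP => lj; apply: l_eq0; exists j.
  by rewrite l1 => /eqP; rewrite oner_eq0.
(* Pieces of weight zero need not be active at x: their gradients are replaced. *)
pose v j := if l j != 0 then gradient (g j) x else gradient (g j0) x.
exists #|J|, (fun k => l (enum_val k)), (fun k => v (enum_val k)); split => //.
- by rewrite -(big_enum_val (A := J) l).
- move=> k; rewrite /v; case: ifP => lk.
    exact: closure_limiting_gradient (g2 _) (@fg _) (lA _ lk).
  exact: closure_limiting_gradient (g2 _) (@fg _) (lA _ lj0).
rewrite -(big_enum_val (A := J) (fun j => l j *: v j)); apply/rowP => i.
rewrite mxE summxE -[LHS](lg i); apply: eq_bigr => j _; rewrite mxE /v.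
by case: ifPn => [_|]; rewrite ?mxE // negbK => /eqP ->; rewrite !mul0r.
Qed.

End Differentiability.

Lemma eq_sgd (R : realType) (m n : nat) (grad : 'I_n -> 'rV[R]_m -> 'rV[R]_m) step idx idx' x k :
  (forall i, (i < k)%N -> idx i = idx' i) ->
  sgd grad step idx x k = sgd grad step idx' x k.
Proof.
elim: k => [//|k IH] eq_idx /=; rewrite IH => [|i ik]; last by apply: eq_idx; rewrite ltnW.
by rewrite eq_idx.
Qed.

Section Pieces.
Context {R : realType} {m : nat}.
Variables (J : nat) (P : 'I_J -> set 'rV[R]_m).
Hypothesis P_trivIset : trivIset setT P.
Hypothesis P_cover : \bigcup_j P j = setT.

Lemma piece_exists x : exists j, P j x.
Proof. by have [j _ Pj] : (\bigcup_j P j) x by [rewrite P_cover]; exists j. Qed.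

Lemma piecewise_gradientE (gs : 'I_J -> 'rV[R]_m -> R) j x :
  P j x -> piecewise_gradient P gs x = gradient (gs j) x.
Proof.
move=> Pj; rewrite /piecewise_gradient (big_pred1 j) // => i /=.
apply/idP/eqP => [|->]; last exact: mem_set.
by rewrite inE => Pi; apply: P_trivIset => //; exists x.
Qed.

Lemma piece_nbhs j x : P j x -> ~ interface P x -> nbhs x (P j).
Proof.
move=> Pj nI; have avoid i : \forall y \near x, i != j -> ~ P i y.
  have [->|ij] := eqVneq i j; first by apply: (@filterE _ (nbhs x)).
  have : nbhs x (~` closure (P i)).
    apply: open_nbhs_nbhs; split; first by apply: closed_openC; exact: closed_closure.
    by move=> clPi; apply: nI; exists (i, j) => //; split=> //; exact: subset_closure.
  by apply: filterS => y ncl _ /subset_closure.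
have others : \forall y \near x, forall i, i != j -> ~ P i y.
  exact: (@filter_forall _ _ _ _ (nbhs_filter x) avoid).
apply: filterS others => y others; have [i Pi] := piece_exists y.
by have [<-//|ij] := eqVneq i j; have := others i ij.
Qed.

End Pieces.

(** * Stochastic subgradient iterates *)

Section NullStarts.
Context {R : realType} {m' : nat}.
Local Notation m := m'.+1.
Implicit Types (N : set 'rV[R]_m).

Lemma piecewise_step_preimage_null (J : nat) (P : 'I_J -> set 'rV[R]_m)
    (gs : 'I_J -> 'rV[R]_m -> R) al N :
  trivIset setT P -> \bigcup_j P j = setT -> (forall j, contdiff 2 (gs j)) ->
  (forall j, cube_null (singular (gs j) al)) -> cube_null N ->
  cube_null [set x | N (x - al *: piecewise_gradient P gs x)].
Proof.
move=> trivP coverP g2 regular nN.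
apply: (@sub_cube_null _ _ _ [set x | exists j, (grad_step (gs j) al @^-1` N) x]).
  move=> x Nx; have [j Pj] := piece_exists coverP x; exists j.
  by rewrite /preimage /= /grad_step -(piecewise_gradientE trivP gs Pj).
by apply: cube_null_exists => j; exact: grad_step_preimage_null.
Qed.

Variables (n : nat) (grad : 'I_n -> 'rV[R]_m -> 'rV[R]_m) (step : nat -> R).
Hypothesis step_preimage_null : forall k i N, cube_null N ->
  cube_null [set x | N (x - step k *: grad i x)].

Lemma sgd_preimage_null idx k N : cube_null N -> cube_null [set x | N (sgd grad step idx x k)].
Proof.
elim: k N => [|k IH] N nN //=.
exact: (IH [set x | N (x - step k *: grad (idx k) x)] (step_preimage_null k (idx k) nN)).
Qed.

(* Only the finitely many indices before time k matter at time k, so countably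
   many null sets of starting points have to be removed. *)
Lemma avoiding_starts (i0 : 'I_n) (bad : 'I_n -> set 'rV[R]_m) :
  (forall i, lebesgue_null (bad i)) ->
  exists G : set 'rV[R]_m, lebesgue_null (~` G) /\
    forall x, G x -> forall idx k i, ~ bad i (sgd grad step idx x k).
Proof.
move=> bad_null; pose F (p : seq 'I_n * 'I_n) : set 'rV[R]_m :=
  [set x | bad p.2 (sgd grad step (nth i0 p.1) x (size p.1))].
exists (~` [set x | exists p, F p x]); split.
  rewrite setCK; apply: cube_null_lebesgue_null; apply: cube_null_exists => -[u i].
  by apply: sgd_preimage_null; exact: lebesgue_null_cube_null.
move=> x Gx idx k i bad_x; apply: Gx; exists (mkseq idx k, i); rewrite /F /= size_mkseq.
rewrite (_ : sgd grad step _ x k = sgd grad step idx x k) //.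
by apply: eq_sgd => j jk; rewrite nth_mkseq.
Qed.

End NullStarts.

Section RegularSteps.
Context {R : realType} {m' : nat}.
Variables (I : countType) (g : I -> 'rV[R]_m'.+1 -> R).
Hypothesis g2 : forall i, contdiff 2 (g i).

Definition regular_steps : set R :=
  [set al | 0 < al /\ forall i, cube_null (singular (g i) al)].

Lemma countable_irregular_steps : countable ([set al | 0 < al] `\` regular_steps).
Proof.
apply: (@sub_countable _ _ _ (\bigcup_i [set al | 0 < al /\ ~ cube_null (singular (g i) al)])).
  apply: subset_card_le => al [/= al0 irreg]; apply: contrapT => reg; apply: irreg.
  by split=> // i; apply: contrapT => sing; apply: reg; exists i.
by apply: bigcup_countable => [|i _]; [exact: countableP|exact: countable_singular].
Qed.

Lemma countable_negligible (A : set R) : countable A -> lebesgue_measure.-negligible A.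
Proof.
move=> cA; exists A; split=> //; last exact: countable_lebesgue_measure0.
by apply: countable_measurable => // t; exact: measurable_set1.
Qed.

Lemma ae_regular_steps (alpha : nat -> R) : (forall k, 0 < alpha k) ->
  {ae lebesgue_measure, forall c : R, 0 < c -> forall k, regular_steps (c * alpha k)}.
Proof.
move=> alpha0.
have : {ae lebesgue_measure, forall c : R, forall k, 0 < c -> regular_steps (c * alpha k)}.
  apply: ae_foralln => k; apply: countable_negligible.
  apply: (@sub_countable _ _ _ ((fun b => b / alpha k) @` ([set al | 0 < al] `\` regular_steps))).
    apply: subset_card_le => c /= irreg; exists (c * alpha k); last by rewrite mulfK ?gt_eqF.
    have c0 : 0 < c by apply: contrapT => nc; apply: irreg.
    by split=> [|reg]; [rewrite /= mulr_gt0|apply: irreg].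
  by apply: sub_countable (card_image_le _ _) _; exact: countable_irregular_steps.
by apply: negligibleS => c /= irreg reg; apply: irreg => c0 k; exact: reg.
Qed.

End RegularSteps.

Lemma class_C_contdiff (R : realType) (m : nat) (p : option nat) (g : 'rV[R]_m -> R) k q :
  le_exponent q p -> (k <= q)%N -> class_C p g -> contdiff k g.
Proof.
case: p => [p|] /= qp kq; last exact.
by apply: contdiff_leq; exact: leq_trans qp.
Qed.

Section PiecewiseMean.
Context {R : realType} {m' n : nat}.
Local Notation m := m'.+1.
Variables (p : option nat) (J : 'I_n -> nat) (f_ : 'I_n -> 'rV[R]_m -> R)
  (Pt : forall i : 'I_n, 'I_(J i) -> set 'rV[R]_m)
  (fs : forall i : 'I_n, 'I_(J i) -> 'rV[R]_m -> R) (f : 'rV[R]_m -> R).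
Arguments Pt : clear implicits.
Arguments fs : clear implicits.
Hypothesis n_gt0 : (0 < n)%N.
Hypothesis p_ge : le_exponent (maxn m 2) p.
Hypothesis f_repr : forall i, piecewise_representation p (f_ i) (Pt i) (fs i).
Hypothesis f_mean : forall x, f x = n%:R^-1 * \sum_(i < n) f_ i x.

Let i0 : 'I_n := Ordinal n_gt0.

Let Pt_trivIset i : trivIset setT (Pt i).
Proof. by have [_ [_ _ ]] := f_repr i. Qed.

Let Pt_cover i : \bigcup_j Pt i j = setT.
Proof. by have [_ [_ _ ]] := f_repr i. Qed.

Let fs2 i j : contdiff 2 (fs i j).
Proof. by have [_ _ fsC _] := f_repr i; apply: class_C_contdiff p_ge (leq_maxr _ _) (fsC j). Qed.

Let fsm i j : contdiff m (fs i j).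
Proof. by have [_ _ fsC _] := f_repr i; apply: class_C_contdiff p_ge (leq_maxl _ _) (fsC j). Qed.

Local Notation choices := {dffun forall i : 'I_n, 'I_(J i)}.
Local Notation grad i := (piecewise_gradient (Pt i) (fs i)).
Implicit Types (j : choices) (c : 'I_n) (x : 'rV[R]_m).

Definition mean_piece j x := n%:R^-1 * \sum_(i < n) fs i (j i) x.

Definition inner_piece j : set 'rV[R]_m := [set x | forall i, nbhs x (Pt i (j i))].

Lemma choice_exists x : exists j, forall i, Pt i (j i) x.
Proof.
have piece i := piece_exists (Pt_cover i) x.
exists [ffun i => projT1 (cid (piece i))] => i; rewrite ffunE; exact: projT2 (cid (piece i)).
Qed.

Lemma contdiff_mean_piece k j : (forall i (l : 'I_(J i)), contdiff k (fs i l)) ->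
  contdiff k (mean_piece j).
Proof.
move=> fsk; apply: contdiffZ.
by apply: (@contdiff_sum _ _ k _ _ (fun i => fs i (j i))) => i; exact: fsk.
Qed.

Lemma gradient_mean_piece j x :
  gradient (mean_piece j) x = n%:R^-1 *: \sum_i gradient (fs i (j i)) x.
Proof.
apply/rowP => e; rewrite !mxE summxE.
have d i : derivable (fs i (j i)) x (delta_mx 0 e)
  by apply: (@contdiff_derivable _ _ 1); exact: fs2.
have -> : mean_piece j = n%:R^-1 *: \sum_(i < n) fs i (j i).
  by apply/funext => y; rewrite /mean_piece fct_sumE.
rewrite deriveZ; last by apply: derivable_sum.
by rewrite derive_sum //; congr (_ * _); apply: eq_bigr => i _; rewrite mxE.
Qed.

Lemma mean_piece_near j x : inner_piece j x -> \forall y \near x, f y = mean_piece j y.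
Proof.
move=> Ix; have : \forall y \near x, forall i, Pt i (j i) y.
  exact: (@filter_forall _ _ _ _ (nbhs_filter x) Ix).
apply: filterS => y Py; rewrite f_mean /mean_piece; congr (_ * _).
by apply: eq_bigr => i _; have [_ _ _] := f_repr i; apply.
Qed.

Lemma continuous_mean : continuous f.
Proof.
have -> : f = (fun x => n%:R^-1 * \sum_(i < n) f_ i x) by apply/funext.
apply: continuous_mul; first exact: cst_continuous.
by apply: continuous_sum => i; have [] := f_repr i.
Qed.

Lemma mean_piece_closure j x : closure (inner_piece j) x -> f x = mean_piece j x.
Proof.
have cl : closed [set x | f x = mean_piece j x].
  apply: closed_eq_continuous; first exact: continuous_mean.
  exact: contdiff_continuous (contdiff_mean_piece j fs2).
move=> cl_x; apply: cl; move: x cl_x; apply: closureS => x Ix /=.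
exact: (nbhs_singleton (mean_piece_near Ix)).
Qed.

Lemma piecewise_gradient_bounded (M : R) :
  exists2 B, 0 < B & forall i x, `|x| <= M -> `|grad i x| <= B.
Proof.
have : \forall B \near +oo, forall (ij : {i : 'I_n & 'I_(J i)}) (e : 'I_m) x, `|x| <= M ->
    `|partial e (fs (tag ij) (tagged ij)) x| <= B.
  do 2!apply: filter_forall => ?; apply: continuous_near_bounded.
  apply: contdiff_continuous; exact: contdiff_partial.
move=> /pinfty_ex_gt0[B B0 fsB]; exists B => // i x xM.
have [j Pj] := piece_exists (Pt_cover i) x.
rewrite (piecewise_gradientE (@Pt_trivIset i) (fs i) Pj).
apply/rV_norm_leP => [|e]; first exact: ltW.
by rewrite mxE; exact: (fsB (Tagged (fun i => 'I_(J i)) j)).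
Qed.

Definition mean_gap c x : 'rV[R]_m := n%:R^-1 *: (\sum_i grad i x) - grad c x.

Let n_neq0 : n%:R != 0 :> R. Proof. by rewrite pnatr_eq0 -lt0n. Qed.

Lemma sum_mean_gap x : \sum_c mean_gap c x = 0.
Proof.
by rewrite /mean_gap sumrB sumr_const card_ord -scaler_nat scalerA divff // scale1r subrr.
Qed.

Lemma mean_gap_bounded (M : R) :
  exists2 B, 0 < B & forall c x, `|x| <= M -> `|mean_gap c x| <= B.
Proof.
have [B B0 gradB] := piecewise_gradient_bounded M.
exists (B + B) => [|c x xM]; first exact: addr_gt0.
apply: le_trans (ler_normB _ _) _; apply: lerD; last exact: gradB.
rewrite normrZ ger0_norm ?invr_ge0 // mulrC ler_pdivrMr ?lt0r ?n_neq0 ?ler0n //.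
apply: le_trans (ler_norm_sum _ _ _) _.
apply: (@le_trans _ _ (\sum_(i < n) B)); first by apply: ler_sum => i _; exact: gradB.
by rewrite sumr_const card_ord mulr_natr.
Qed.

Variables (a : nat -> R).
Hypothesis a_gt0 : forall k, 0 < a k.
Hypothesis a_cvg0 : a k @[k --> \oo] --> 0.
Hypothesis a_divergent : forall k (t : R), exists l, t <= \sum_(k <= i < l) a i.
Local Notation stop := (stop a_gt0 a_divergent).
Local Notation iter := (sgd (fun i => grad i) a).

Section Deterministic.
Variables (x0 : 'rV[R]_m) (idx : nat -> 'I_n) (M : R).
Local Notation x := (iter idx x0).
Hypothesis x_bounded : forall k, `|x k| <= M.
Hypothesis x_avoid : forall k i, ~ interface (Pt i) (x k).

Lemma noise_mean_piece (j : nat -> choices) k : (forall i, Pt i (j k i) (x k)) ->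
  noise mean_piece a x j k = a k *: mean_gap (idx k) (x k).
Proof.
move=> Pj; rewrite /noise /= gradient_mean_piece /mean_gap scalerBr.
rewrite [X in X + _]addrAC subrr add0r addrC; congr (_ *: (_ *: _) - _).
by apply: eq_bigr => i _; rewrite (piecewise_gradientE (@Pt_trivIset i) (fs i) (Pj i)).
Qed.

Hypothesis noise_cvg0_rat : forall (q : rat) (e : 'I_m),
  \sum_(k <= i < stop k (ratr q)) a i * mean_gap (idx i) (x i) 0 e @[k --> \oo] --> (0 : R).

Lemma mean_gap_cvg0 t :
  \sum_(k <= i < stop k t) a i *: mean_gap (idx i) (x i) @[k --> \oo] --> (0 : 'rV[R]_m).
Proof.
have [B B0 gapB] := mean_gap_bounded M.
apply: (window_cvg0_dense (K := B) a_cvg0) => [k|q].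
  by rewrite normrZ gtr0_norm // mulrC ler_wpM2r ?gapB // ltW.
apply: cvg_rV => e; rewrite mxE.
under eq_cvg => k do [rewrite summxE; under eq_bigr do rewrite mxE].
exact: noise_cvg0_rat.
Qed.

Lemma iterates_converge :
  [/\ dist_to (x k) [set y | clarke_subdifferential f y 0] @[k --> \oo] --> 0%E,
      cvg (f (x k) @[k --> \oo]) & connected (limit_points x)].
Proof.
have /choice[j Pj] : forall k, exists j, forall i, Pt i (j i) (x k).
  by move=> k; exact: choice_exists.
have xC k : closure (inner_piece (j k)) (x k).
  by apply: subset_closure => i; apply: (piece_nbhs (Pt_cover i)).
have [V V0 gradV] := piecewise_gradient_bounded M.
have x_step k : `|x k.+1 - x k| <= V * a k.
  rewrite /= addrAC subrr add0r normrN normrZ gtr0_norm // mulrC.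
  by rewrite ler_wpM2r ?gradV // ltW.
have x_bounded1 k : `|x k| <= `|M| + 1.
  by rewrite (le_trans (x_bounded k)) // ler_wpDr // ler_norm.
have M0 : 0 < `|M| + 1 by rewrite ltr_wpDl.
have noise_cvg0 t :
    \sum_(k <= i < stop k t) noise mean_piece a x j i @[k --> \oo] --> (0 : 'rV[R]_m).
  by under eq_cvg => k do under eq_bigr do rewrite noise_mean_piece //; exact: mean_gap_cvg0.
have g2 k : contdiff 2 (mean_piece k) by exact: contdiff_mean_piece.
have gm k : contdiff m (mean_piece k) by exact: contdiff_mean_piece.
have clC k : closed (closure (inner_piece k)) by exact: closed_closure.
split.
- apply: (dist_to_cvg0 x_bounded) => U y UU xy; apply: (crit_point_clarke g2 mean_piece_near).
  exact: (ultra_limit_crit clC g2 gm continuous_mean mean_piece_closure M0 a_cvg0 xC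
    x_bounded1 x_step noise_cvg0 UU xy).
- have [l fl] := values_cvg clC g2 gm continuous_mean mean_piece_closure M0 a_cvg0 xC
    x_bounded1 x_step noise_cvg0.
  by apply/cvg_ex; exists l.
apply: (connected_limit_points x_bounded); apply/norm_cvg0P.
have Va : V * a k @[k --> \oo] --> V * 0 by apply: cvgM => //; exact: cvg_cst.
rewrite mulr0 in Va; apply: squeeze_cvgr (cvg_cst 0) Va.
by apply: nearW => k; rewrite normr_ge0 x_step.
Qed.

End Deterministic.

Variables (d0 : measure_display) (T0 : measurableType d0) (P0 : probability T0 R)
  (iota : T0 -> 'I_n).
Hypothesis iota_measurable : forall l, measurable (iota @^-1` [set l]).
Hypothesis iota_uniform : forall l, P0 (iota @^-1` [set l]) = (n%:R^-1)%:E.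
Variable P : probability (infinite_product T0) R.
Hypothesis P_product : is_product_measure P0 P.
Hypothesis a_log : forall e, 0 < e -> \forall k \near \oo, a k * ln k%:R <= e.
Variable x0 : 'rV[R]_m.
Hypothesis avoid : forall idx k i, ~ interface (Pt i) (iter idx x0 k).

(* Only iterates of norm at most M contribute, so that the noise is bounded
   whatever the history. *)
Definition truncated_gap (M : nat) (e : 'I_m) k c x : R :=
  if `|x| <= M%:R then a k * mean_gap c x 0 e else 0.

Lemma sum_truncated_gap M e k x : \sum_c truncated_gap M e k c x = 0.
Proof.
rewrite /truncated_gap; have [xM|xM] := boolP (`|x| <= M%:R); last by rewrite big1.
by rewrite -mulr_sumr -summxE sum_mean_gap mxE mulr0.
Qed.

Lemma truncated_gap_bounded M : exists2 B, 0 < B &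
  forall e k c x, `|truncated_gap M e k c x| <= B * a k.
Proof.
have [B B0 gapB] := mean_gap_bounded M%:R; exists B => // e k c x.
rewrite /truncated_gap; case: ifP => xM; last by rewrite normr0 mulr_ge0 ?ltW.
rewrite normrM gtr0_norm // mulrC ler_pM2r //.
exact: le_trans (ler_coord_norm _ _) (gapB _ _ xM).
Qed.

Lemma truncated_noise_cvg0 : {ae P, forall w, forall Meq : nat * 'I_m * rat,
  \sum_(k <= i < stop k (ratr Meq.2))
    truncated_gap Meq.1.1 Meq.1.2 i (iota (w i)) (iter (iota \o w) x0 i) @[k --> \oo] --> (0 : R)}.
Proof.
apply: ae_forall_countable => -[[M e] q] /=.
pose X (u : seq 'I_n) := iter (nth i0 u) x0 (size u).
have [B B0 gapB] := truncated_gap_bounded M.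
have [A A0 aA] := cvg0_bounded a_cvg0.
have T_gt0 : 0 < Num.max (ratr q) 0 + A by rewrite ltr_wpDl // le_max lexx orbT.
have length_le k : \sum_(k <= i < stop k (ratr q)) a i <= Num.max (ratr q) 0 + A.
  rewrite -lerBlDl; apply: le_trans (ler_norm _) _.
  by apply: clock_stop_dist.
have := window_sum_cvg0 n_gt0 iota_measurable iota_uniform P_product i0 B0 T_gt0 a_gt0 a_log
  length_le (fun u => sum_truncated_gap M e (size u) (X u)) (fun u c => gapB e (size u) c (X u)).
have history w i : iter (nth i0 (mkseq (iota \o w) i)) x0 i = iter (iota \o w) x0 i.
  by apply: eq_sgd => l li; rewrite nth_mkseq.
apply: filterS => w.
by under eq_cvg => k do under eq_bigr => i _ do rewrite /X /= size_mkseq history.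
Qed.

Lemma iterates_converge_almost_surely :
  {ae P, forall w, exists M : R, forall k, enorm (iter (iota \o w) x0 k) <= M} ->
  {ae P, forall w,
    [/\ dist_to (iter (iota \o w) x0 k) [set y | clarke_subdifferential f y 0]
          @[k --> \oo] --> 0%E,
        cvg (f (iter (iota \o w) x0 k) @[k --> \oo])
      & connected (limit_points (iter (iota \o w) x0))]}.
Proof.
move=> bounded; have FP : Filter (nbhs (almost_everywhere P)) := ae_filter_ringOfSetsType P.
apply: filterS2 bounded truncated_noise_cvg0 => w [M wM] noise_cvg0.
pose N := (Num.truncn M).+1.
have wN k : `|iter (iota \o w) x0 k| <= N%:R.
  by rewrite (le_trans (norm_le_enorm _)) // (le_trans (wM k)) // ltW // truncnS_gt.
apply: (iterates_converge wN) => [k i|q e]; first exact: avoid.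
have := noise_cvg0 (N, e, q) => /=.
by under eq_cvg => k do under eq_bigr do rewrite /truncated_gap wN.
Qed.

End PiecewiseMean.

Section StepSizes.
Context {R : realType}.
Variables (alpha : nat -> R) (c : R).
Hypothesis c_gt0 : 0 < c.
Hypothesis alpha_gt0 : forall k, 0 < alpha k.

Lemma steps_divergent : (\sum_(0 <= k < N) alpha k) @[N --> \oo] --> +oo ->
  forall k (t : R), exists l, t <= \sum_(k <= i < l) c * alpha i.
Proof.
move=> /cvgryPge div k t.
have [N _ large] := div (t / c + \sum_(0 <= i < k) alpha i).
exists (maxn k N); rewrite -mulr_sumr -ler_pdivrMl // mulrC -(lerD2r (\sum_(0 <= i < k) alpha i)).
apply: le_trans (large (maxn k N) (leq_maxr k N)) _.
by rewrite [leLHS](big_cat_nat (leq0n k) (leq_maxl k N)) /= addrC.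
Qed.

Hypothesis alpha_o : alpha =o_\oo (fun k => (ln (k%:R : R))^-1).

Lemma near_steps_log (e : R) : 0 < e -> \forall k \near \oo, c * alpha k * ln k%:R <= e.
Proof.
move=> e0; have ec : 0 < e / c by rewrite divr_gt0.
have /eqoP/(_ _ ec) := alpha_o; apply: filterS => k /=.
have [L0 _|L0] := leP (ln (k%:R : R)) 0.
  by apply: le_trans (ltW e0); rewrite pmulr_rle0 // mulr_gt0.
rewrite !gtr0_norm ?invr_gt0 // ler_pdivlMr // ler_pdivlMr //.
by rewrite [_ * c]mulrC mulrA.
Qed.

Lemma steps_cvg0 : c * alpha k @[k --> \oo] --> 0.
Proof.
apply/cvgr0Pnorm_le => e e0; have L2 : 0 < ln (2 : R) by rewrite ln_gt0 // ltr1n.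
near=> k; rewrite gtr0_norm ?mulr_gt0 // -(ler_pM2r L2).
apply: (@le_trans _ _ (c * alpha k * ln k%:R)).
  have k2 : (2 <= k)%N by near: k; exact: nbhs_infty_ge.
  by rewrite ler_pM2l ?mulr_gt0 // ler_ln ?posrE // ?ler_nat // ltr0n (leq_trans _ k2).
by near: k; apply: near_steps_log; exact: mulr_gt0.
Unshelve. all: by end_near. Qed.

End StepSizes.

Theorem theorem4p3 (R : realType) (m n : nat) (p : option nat)
  (m_gt0 : (0 < m)%N) (n_gt0 : (0 < n)%N) (p_ge : le_exponent (maxn m 2) p)
  (f_ : 'I_n -> 'rV[R]_m -> R) (J : 'I_n -> nat)
  (Pt : forall i : 'I_n, 'I_(J i) -> set 'rV[R]_m)
  (fs : forall i : 'I_n, 'I_(J i) -> 'rV[R]_m -> R)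
  (f_repr : forall i, piecewise_representation p (f_ i) (Pt i) (fs i))
  (f : 'rV[R]_m -> R)
  (fE : forall x, f x = n%:R^-1 * \sum_(i < n) f_ i x)
  (f_bounded_below : exists b : R, forall x, b <= f x)
  (d0 : measure_display) (T0 : measurableType d0) (P0 : probability T0 R)
  (iota : T0 -> 'I_n)
  (iota_measurable : forall l, measurable (iota @^-1` [set l]))
  (iota_uniform : forall l, P0 (iota @^-1` [set l]) = (n%:R^-1)%:E)
  (P : probability (infinite_product T0) R)
  (P_product : is_product_measure P0 P)
  (alpha : nat -> R)
  (alpha_gt0 : forall k, 0 < alpha k)
  (alpha_sum : (\sum_(0 <= k < N) alpha k) @[N --> \oo] --> +oo)
  (alpha_o : alpha =o_\oo (fun k => (ln (k%:R : R))^-1))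
  (interface_null : forall i, lebesgue_null (interface (Pt i))) :
  let iter (c : R) (x0 : 'rV[R]_m) (w : infinite_product T0) : nat -> 'rV[R]_m :=
    sgd (fun i => piecewise_gradient (Pt i) (fs i))
        (fun k => c * alpha k) (fun k => iota (w k)) x0 in
  exists Gamma : set R,
    [/\ Gamma `<=` [set c | 0 < c],
        lebesgue_measure.-negligible ([set c | 0 < c] `\` Gamma),
        {ae lebesgue_measure, forall c : R,
          0 < c -> forall k, Gamma (c * alpha k)}
      & forall c : R, 0 < c -> (forall k, Gamma (c * alpha k)) ->
        exists G : set 'rV[R]_m,
          lebesgue_null (~` G) /\
          forall x0, G x0 ->
            {ae P, forall w, exists M : R,
              forall k, enorm (iter c x0 w k) <= M} ->
            {ae P, forall w,
              [/\ dist_to (iter c x0 w k)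
                    [set x | clarke_subdifferential f x 0]
                    @[k --> \oo] --> 0%E,
                  cvg (f (iter c x0 w k) @[k --> \oo])
                & connected (limit_points (iter c x0 w))]}].
Proof.
case: m m_gt0 p_ge f_ Pt fs f_repr f fE f_bounded_below interface_null => [//|m'].
move=> _ p_ge f_ Pt fs f_repr f fE _ interface_null iter.
pose g (ij : {i : 'I_n & 'I_(J i)}) := fs (tag ij) (tagged ij).
have g2 ij : continuously_differentiable 2 (g ij).
  have [_ _ fsC _] := f_repr (tag ij).
  exact: class_C_contdiff p_ge (leq_maxr _ _) (fsC (tagged ij)).
exists (regular_steps g); split.
- by move=> c [].
- by apply: countable_negligible; exact: countable_irregular_steps.
- exact: ae_regular_steps.
move=> c c0 regular.
have [|G [nG avoidG]] := @avoiding_starts R m' n (fun i => piecewise_gradient (Pt i) (fs i))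
    (fun k => c * alpha k) _ (Ordinal n_gt0) _ interface_null.
  move=> k i N nN; have [_ [_ _ trivP coverP] _ _] := f_repr i.
  apply: piecewise_step_preimage_null => // j; first exact: (g2 (Tagged _ j)).
  exact: ((regular k).2 (Tagged (fun i => 'I_(J i)) j)).
exists G; split=> // x0 Gx0.
apply: (iterates_converge_almost_surely n_gt0 p_ge f_repr fE) => //.
- by move=> k; rewrite mulr_gt0.
- exact: steps_cvg0.
- exact: steps_divergent.
- by move=> e e0; exact: near_steps_log.
- exact: avoidG.
Qed.
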